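(* $\mathrm{MAVal}_k(\mathbb{R}^n)$ is a finite dimensional irreducible representation of $\mathrm{GL}(n,\mathbb{R})$, where $g\in\mathrm{GL}(n,\mathbb{R})$ acts by $[g\cdot\Psi](f)[B]=\Psi(f\circ g)[g^{-1}B]$ for $f\in\mathrm{Conv}(\mathbb{R}^n,\mathbb{R})$ and bounded Borel sets $B\subset\mathbb{R}^n$.
   Context: $\mathrm{Conv}(\mathbb{R}^n,\mathbb{R})$ is the space of finite-valued convex functions on $\mathbb{R}^n$ with the topology of locally uniform convergence, and $\mathcal{M}(\mathbb{R}^n)$ the complex Radon measures with the weak*-topology. $\mathrm{MAVal}_k(\mathbb{R}^n)$ is the space of continuous valuations $\Psi:\mathrm{Conv}(\mathbb{R}^n,\mathbb{R})\to\mathcal{M}(\mathbb{R}^n)$ that are dually epi-translation invariant ($\Psi(f+l)=\Psi(f)$ for affine $l$), locally determined ($f\equiv h$ on open $V$ implies $\Psi(f)[B\cap V]=\Psi(h)[B\cap V]$ for bounded Borel $B$), translation equivariant ($\Psi(f(\cdot+x))[B]=\Psi(f)[B+x]$), and $k$-homogeneous ($\Psi(tf)=t^k\Psi(f)$, $t\ge0$).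
   Formalization: The theorem is stated for n ≥ 1 and 0 ≤ k ≤ n; for k > n the space MAVal_k(R^n) is zero and hence not an irreducible representation. *)

(* Defs.v *)
From HB Require Import structures.
From mathcomp Require Import all_boot all_order all_algebra.
From mathcomp Require Import all_classical all_reals all_analysis.
From mathcomp Require Import complex.
Set Implicit Arguments. Unset Strict Implicit. Unset Printing Implicit Defensive.
Import Order.TTheory GRing.Theory Num.Theory.
Import numFieldNormedType.Exports.
Local Open Scope classical_set_scope.
Local Open Scope ring_scope.

Section MAValDefs.
Variables (R : realType) (n : nat).

(* R^n is modelled by row vectors 'rV[R]_n (sup-norm; boundedness and the
   topology do not depend on the chosen norm). *)
Local Notation V := 'rV[R]_n.
Local Notation C := (complex R).

Definition Borel : Type := g_sigma_algebraType (@open V).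

Definition bounded_set_V (A : set V) : Prop :=
  exists r : R, forall x, A x -> `|x| <= r.

Definition bborel (A : set V) : Prop := (<<s @open V >>) A /\ bounded_set_V A.

(* A complex Radon measure on R^n, viewed as a set function on bounded Borel
   sets (normalized to 0 on all other sets), given as
   (m0 - m1) + i (m2 - m3) with m_j locally finite positive Borel measures
   (on R^n these are exactly the positive Radon measures). *)
Definition cradon_decomp (mu : set V -> C)
    (m : 'I_4 -> {measure set Borel -> \bar R}) : Prop :=
  (forall j (r : R), (m j [set x : Borel | (`|(x : V)| <= r)%R] < +oo)%E) /\
  (forall B : set V, bborel B ->
     mu B = Complex (fine (m (inord 0) B) - fine (m (inord 1) B))
                    (fine (m (inord 2) B) - fine (m (inord 3) B))) /\
  (forall B : set V, ~ bborel B -> mu B = 0).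

Definition is_cradon (mu : set V -> C) : Prop := exists m, cradon_decomp mu m.

Definition testfun (phi : V -> R) : Prop :=
  continuous phi /\ exists r : R, forall x, r < `|x| -> phi x = 0.

Definition int_real (m : {measure set Borel -> \bar R}) (phi : V -> R) : R :=
  fine (\int[m]_(x in [set: Borel]) (phi x)%:E)%E.

Definition cint_is (mu : set V -> C) (phi : V -> R) (z : C) : Prop :=
  exists m, cradon_decomp mu m /\
    z = Complex (int_real (m (inord 0)) phi - int_real (m (inord 1)) phi)
                (int_real (m (inord 2)) phi - int_real (m (inord 3)) phi).

(* the integral (well-defined: independent of the decomposition) *)
Definition cint (mu : set V -> C) (phi : V -> R) : C :=
  xget 0 [set z | cint_is mu phi z].

(* weak-* convergence of a sequence of complex Radon measures
   (testing against real C_c functions suffices by C-linearity) *)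
Definition wstar_cvg (mu_ : nat -> set V -> C) (mu : set V -> C) : Prop :=
  forall phi, testfun phi ->
    forall e : R, 0 < e -> exists N : nat, forall j, (N <= j)%N ->
      `|cint (mu_ j) phi - cint mu phi| < (e%:C)%C.

Definition convexf (f : V -> R) : Prop :=
  forall (x y : V) (t : R), 0 <= t <= 1 ->
    f (t *: x + (1 - t) *: y) <= t * f x + (1 - t) * f y.

Definition lu_cvg (f_ : nat -> V -> R) (f : V -> R) : Prop :=
  forall r e : R, 0 < e -> exists N : nat, forall j, (N <= j)%N ->
    forall x : V, `|x| <= r -> `|f_ j x - f x| < e.

(* candidate elements: maps from functions to set functions; values on
   non-convex functions are normalized to 0 *)
Definition MAV : Type := (V -> R) -> set V -> C.

Definition MAVal (k : nat) (Psi : MAV) : Prop :=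
  (forall f, ~ convexf f -> Psi f = (fun _ => 0)) /\
  (forall f, convexf f -> is_cradon (Psi f)) /\
  (* continuity (Conv is metrizable, so sequential continuity) *)
  (forall (f_ : nat -> V -> R) f, (forall j, convexf (f_ j)) -> convexf f ->
     lu_cvg f_ f -> wstar_cvg (fun j => Psi (f_ j)) (Psi f)) /\
  (forall f h, convexf f -> convexf h -> convexf (fun x => Num.min (f x) (h x)) ->
     forall B, Psi (fun x => Num.max (f x) (h x)) B + Psi (fun x => Num.min (f x) (h x)) B
               = Psi f B + Psi h B) /\
  (forall f (y : V) (c : R), convexf f ->
     Psi (fun x => f x + (\sum_(i < n) y ord0 i * x ord0 i + c)) = Psi f) /\
  (forall f h (U : set V), open U -> convexf f -> convexf h ->
     (forall x, U x -> f x = h x) ->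
     forall B, bborel B -> Psi f (B `&` U) = Psi h (B `&` U)) /\
  (forall f (x : V), convexf f -> forall B, bborel B ->
     Psi (fun z => f (z + x)) B = Psi f [set b + x | b in B]) /\
  (forall f (t : R), convexf f -> 0 <= t ->
     Psi (fun x => t * f x) = (fun B => (t%:C)%C ^+ k * Psi f B)).

(* linear map of g in GL(n,R) acting on (row-)vectors: x |-> g x *)
Definition lin (g : 'M[R]_n) (x : V) : V := x *m g^T.

Definition act (g : 'M[R]_n) (Psi : MAV) : MAV :=
  fun f B => Psi (f \o lin g) (lin (invmx g) @` B).

Definition MAVzero : MAV := fun _ _ => 0.
Definition MAVadd (P Q : MAV) : MAV := fun f B => P f B + Q f B.
Definition MAVscale (c : C) (P : MAV) : MAV := fun f B => c * P f B.

End MAValDefs.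

(* Main.v *)
Require Import Defs.
From HB Require Import structures.
From mathcomp Require Import all_boot all_order all_algebra fingroup perm.
From mathcomp Require Import all_classical all_reals all_analysis.
From mathcomp Require Import complex measurable_realfun ring lra.
Set Implicit Arguments. Unset Strict Implicit. Unset Printing Implicit Defensive.
Import Order.TTheory GRing.Theory Num.Theory.
Import numFieldNormedType.Exports.
Local Open Scope classical_set_scope.
Local Open Scope ring_scope.

(* A valuation in MAVal_k splits into real and imaginary parts, so let Psi be
   real. On the quadratic function q_M(x) = sum_i <M_i, x>^2 attached to a
   k x n matrix M, Psi is translation invariant, i.e. Q(M) times Lebesgue
   measure. Here Q is quadratic in each row of M and does not change when two
   rows are rotated into each other, which forces Q(H M) = det(H)^2 Q(M): such
   a Q is determined by finitely many values.

   Q determines Psi. Psi of a sum of k hinges max(0, <u, x> - c) lives where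
   all of them break, and averaging over the break points turns hinges into
   squares; so Q = 0 kills hinges, hence finite sums of convex ridge functions.
   Locally, an arbitrary f is a square plus a compactly supported function;
   mollified by an exponential-sum kernel, the latter becomes a difference of
   ridge sums, and affinity of Psi along ridge directions carries the vanishing
   over to f.

   Irreducibility: letting g degenerate to a projection of rank k extracts from
   Q <> 0 a multiple of det(M E^T)^2, and the GL-orbit of this form spans all
   admissible Q because squared minors have a reproducing kernel.

   Nonzero element: split x = (x', x'') with x' the first k coordinates and
   push Lebesgue measure in (y, x'') forward to (x', x''), where x' minimizes
   f(., x'') - <y, .>; it is unique for almost every y because subgradients are
   monotone. *)

(** * Radon measures and test functions *)

(** The obstacle is that Psi is a priori neither additive nor polynomial in f. The substitute is
    that Psi(f + t z) is affine in t >= 0 for one ridge function z at a time and every convex f,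
    because parallel hinges break along disjoint hyperplanes and cannot interact. Once the shorter
    sums vanish, doubling a sum of m ridges multiplies its value by 2^m by affinity and by 2^k by
    homogeneity, so only k-fold sums matter. The rotation invariance of Q is the identity (a + b)^2
    + (a - b)^2 = 2 a^2 + 2 b^2: q_M depends on M^T M only. Exponentials are chosen for the kernel
    because their products are again exponentials of linear forms: powers of the kernel, hence the
    mollified functions, are finite sums of ridge functions, each convex up to sign. The
    degeneration to a projection is not a topological limit: Q is polynomial along the degenerating
    curve, so its end value is a fixed linear combination of values at invertible matrices, which
    stays in any invariant subspace, closed or not. *)

Section ContinuityRules.
Variables (R : realType) (T : topologicalType).
Implicit Types f g : T -> R.

Lemma contD f g : continuous f -> continuous g -> continuous (fun x => f x + g x).
Proof. by move=> cf cg x; apply: cvgD; [exact: cf|exact: cg]. Qed.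
Lemma contN f : continuous f -> continuous (fun x => - f x).
Proof. by move=> cf x; apply: cvgN; exact: cf. Qed.
Lemma contB f g : continuous f -> continuous g -> continuous (fun x => f x - g x).
Proof. by move=> cf cg; apply: contD => //; exact: contN. Qed.
Lemma contM f g : continuous f -> continuous g -> continuous (fun x => f x * g x).
Proof. by move=> cf cg x; apply: cvgM; [exact: cf|exact: cg]. Qed.
Lemma cont_cst (c : R) : continuous (fun _ : T => c).
Proof. by move=> x; exact: cvg_cst. Qed.
Lemma contZ c f : continuous f -> continuous (fun x => c * f x).
Proof. by move=> cf; apply: contM => //; exact: cont_cst. Qed.
Lemma cont_abs f : continuous f -> continuous (fun x => `|f x|).
Proof. by move=> cf x; apply: cvg_norm; exact: cf. Qed.
Lemma cont_max f g : continuous f -> continuous g -> continuous (fun x => Num.max (f x) (g x)).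
Proof. by move=> cf cg x; apply: continuous_max; [exact: cf|exact: cg]. Qed.
Lemma cont_min f g : continuous f -> continuous g -> continuous (fun x => Num.min (f x) (g x)).
Proof. by move=> cf cg x; apply: continuous_min; [exact: cf|exact: cg]. Qed.
Lemma cont_sum (I : Type) (r : seq I) (P : pred I) (F : I -> T -> R) :
  (forall i, P i -> continuous (F i)) -> continuous (fun x => \sum_(i <- r | P i) F i x).
Proof.
move=> cF; elim: r => [|i r IH].
  by under eq_fun do rewrite big_nil; exact: cont_cst.
under eq_fun do rewrite big_cons.
by case Pi: (P i) => //; apply: contD => //; exact: cF.
Qed.
Lemma cont_comp (U : topologicalType) (h : U -> T) f : continuous h -> continuous f ->
  continuous (fun x => f (h x)).
Proof. by move=> ch cf x; apply: continuous_comp; [exact: ch|exact: cf]. Qed.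

End ContinuityRules.

Section Dot.
Variables (R : realType) (n : nat).
Local Notation V := 'rV[R]_n.

Definition dotp (v x : V) : R := \sum_(i < n) v ord0 i * x ord0 i.

Lemma dotpC v x : dotp v x = dotp x v.
Proof. by apply: eq_bigr => i _; rewrite mulrC. Qed.
Lemma dotpDr v x y : dotp v (x + y) = dotp v x + dotp v y.
Proof. by rewrite -big_split; apply: eq_bigr => i _ /=; rewrite mxE mulrDr. Qed.
Lemma dotpZr v c x : dotp v (c *: x) = c * dotp v x.
Proof. by rewrite mulr_sumr; apply: eq_bigr => i _; rewrite mxE mulrCA. Qed.
Lemma dotpDl v w x : dotp (v + w) x = dotp v x + dotp w x.
Proof. by rewrite dotpC dotpDr !(dotpC x). Qed.
Lemma dotpZl v c x : dotp (c *: v) x = c * dotp v x.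
Proof. by rewrite dotpC dotpZr dotpC. Qed.
Lemma dotpNr v x : dotp v (- x) = - dotp v x.
Proof. by rewrite -scaleN1r dotpZr mulN1r. Qed.
Lemma dotpNl v x : dotp (- v) x = - dotp v x.
Proof. by rewrite dotpC dotpNr dotpC. Qed.
Lemma dotpBl v w x : dotp (v - w) x = dotp v x - dotp w x.
Proof. by rewrite dotpDl dotpNl. Qed.
Lemma dotp0l x : dotp 0 x = 0.
Proof. by rewrite -(scale0r 0) dotpZl mul0r. Qed.
Lemma dotp0r x : dotp x 0 = 0.
Proof. by rewrite dotpC dotp0l. Qed.

Lemma dotp_delta i x : dotp (delta_mx ord0 i) x = x ord0 i.
Proof.
rewrite /dotp (bigD1 i)//= mxE !eqxx mul1r big1 ?addr0// => j ji.
by rewrite mxE (negbTE ji) andbF mul0r.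
Qed.

Lemma norm_coord (x : V) i : `|x ord0 i| <= `|x|.
Proof.
rewrite [leRHS]/Num.norm/= mx_normrE; apply/bigmax_geP; right.
by exists (ord0, i).
Qed.

Lemma norm_le_coord (x : V) r : 0 <= r -> (forall i, `|x ord0 i| <= r) -> `|x| <= r.
Proof.
move=> r0 xr; rewrite [leLHS]/Num.norm/= mx_normrE; apply/bigmax_leP; split => // -[i j] _ /=.
by rewrite ord1.
Qed.

(** The l^1 norm, dual to the sup norm carried by row vectors. *)
Definition dotn (v : V) : R := \sum_(i < n) `|v ord0 i|.

Lemma dotn_ge0 v : 0 <= dotn v. Proof. exact: sumr_ge0. Qed.

Lemma dotp_le v x : `|dotp v x| <= dotn v * `|x|.
Proof.
rewrite mulr_suml; apply: (le_trans (ler_norm_sum _ _ _)); apply: ler_sum => i _.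
by rewrite normrM ler_wpM2l// norm_coord.
Qed.

Lemma dotp_continuous v : continuous (dotp v).
Proof.
by apply: cont_sum => i _; apply: contZ; exact: coord_continuous.
Qed.

Lemma lipschitz_continuous (f : V -> R) (C : R) :
  (forall x y, `|f x - f y| <= C * `|x - y|) -> continuous f.
Proof.
move=> fC x; apply/(@cvgrPdist_lt _ _ _ (nbhs x)) => e e0.
have C1 : 0 < `|C| + 1 by rewrite ltr_pwDr.
near=> y; apply: (le_lt_trans (fC x y)).
apply: (@le_lt_trans _ _ ((`|C| + 1) * `|x - y|)).
  by rewrite ler_wpM2r// (le_trans (ler_norm C))// lerDl.
rewrite mulrC -ltr_pdivlMr//; near: y.
apply/nbhs_ballP; exists (e / (`|C| + 1)) => /=; first by rewrite divr_gt0.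
by move=> y; rewrite mx_norm_ball.
Unshelve. all: by end_near. Qed.

End Dot.

Lemma integrable_indic_fin d (T : measurableType d) (R : realType)
    (mu : {measure set T -> \bar R}) (A : set T) :
  measurable A -> (mu A < +oo)%E -> mu.-integrable setT (EFin \o \1_A).
Proof.
move=> mA fA; apply/integrableP; split; first by apply/measurable_EFinP.
under eq_integral do rewrite /= ger0_norm//.
by rewrite integral_indic// setIT.
Qed.

Section RadonBasics.
Variables (R : realType) (n : nat).
Hypothesis hn : (0 < n)%N.
Local Notation V := 'rV[R]_n.
Local Notation BV := (Borel R n).
Local Notation meas := {measure set BV -> \bar R}.

Definition locfin (m : meas) : Prop :=
  forall r : R, (m [set x : BV | (`|(x : V)| <= r)%R] < +oo)%E.

Lemma open_borel (U : set V) : open U -> measurable (U : set BV).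
Proof. by move=> oU; apply: sub_sigma_algebra. Qed.

Lemma closed_borel (U : set V) : closed U -> measurable (U : set BV).
Proof. by move=> oU; rewrite -[U]setCK; apply: measurableC; apply: open_borel; rewrite openC. Qed.

Lemma continuous_borel (f : V -> R) : continuous f -> measurable_fun setT (f : BV -> R).
Proof.
move=> cf; apply: (measurability _ (RGenOpens.measurableE R)) => _ [_ [a [b ->] <-]].
rewrite setTI; apply: open_borel; by apply: open_comp.
Qed.

Lemma closed_ball_closed (r : R) : closed [set x : V | `|x| <= r].
Proof.
apply: (@closed_comp _ _ (fun x : V => `|x|) [set y | y <= r]); last exact: closed_le.
by move=> x _; apply: norm_continuous.
Qed.

Lemma cball_borel (r : R) : measurable ([set x : V | `|x| <= r] : set BV).
Proof. by apply: closed_borel; exact: closed_ball_closed. Qed.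

Lemma cball_compact (r : R) : compact [set x : V | `|x| <= r].
Proof.
apply: bounded_closed_compact; last exact: closed_ball_closed.
by exists r; split; rewrite ?num_real// => M rM x /= xr; apply: le_trans (ltW rM).
Qed.

Lemma continuous_bounded (f : V -> R) (r : R) : continuous f ->
  exists2 M, 0 <= M & forall x, `|x| <= r -> `|f x| <= M.
Proof.
move=> cf.
have : compact ((fun x => `|f x|) @` [set x : V | `|x| <= r]).
  apply: continuous_compact; last exact: cball_compact.
  by apply: continuous_subspaceT; exact: cont_abs.
move=> /compact_bounded[M [_ HM]].
exists (`|M| + 1) => // x xr.
have M1 : M < `|M| + 1 by rewrite ltr_pwDr ?ler_norm.
have /= := HM _ M1 `|f x|; rewrite normr_id; apply.
by exists x.
Qed.

Lemma testfun_bounded (f : V -> R) : testfun f -> exists2 M, 0 <= M & forall x, `|f x| <= M.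
Proof.
move=> [cf [r fr]]; have [M M0 fM] := continuous_bounded r cf.
exists M => // x; have [/fM//|/fr->] := leP `|x| r.
by rewrite normr0.
Qed.

Lemma testfun_radius (f : V -> R) : testfun f ->
  exists2 r, 0 < r & forall x, r < `|x| -> f x = 0.
Proof.
move=> [cf [r fr]]; exists (`|r| + 1); first by rewrite ltr_pwDr.
move=> x rx; apply: fr; apply: le_lt_trans rx.
by rewrite (le_trans (ler_norm _))// lerDl.
Qed.

Lemma testfun_continuous (f : V -> R) : testfun f -> continuous f.
Proof. by case. Qed.

Lemma testfunD (f g : V -> R) : testfun f -> testfun g -> testfun (fun x => f x + g x).
Proof.
move=> tf tg; have [[cf _] [cg _]] := (tf, tg).
have [[r _ fr] [s _ gs]] := (testfun_radius tf, testfun_radius tg).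
split; first exact: contD.
by exists (Num.max r s) => x; rewrite gt_max => /andP[/fr-> /gs->]; rewrite addr0.
Qed.

Lemma testfunM (f g : V -> R) : testfun f -> continuous g -> testfun (fun x => f x * g x).
Proof.
move=> [cf [r fr]] cg; split; first exact: contM.
by exists r => x /fr ->; rewrite mul0r.
Qed.

Lemma testfunZ (f : V -> R) c : testfun f -> testfun (fun x => c * f x).
Proof.
move=> [cf [r fr]]; split; first exact: contZ.
by exists r => x /fr ->; rewrite mulr0.
Qed.

Lemma testfun_integrable (m : meas) (f : V -> R) : locfin m -> testfun f ->
  m.-integrable setT (EFin \o (f : BV -> R)).
Proof.
move=> lm tf.
have [r r0 fr] := testfun_radius tf; have [M M0 fM] := testfun_bounded tf.
pose D : set BV := [set x : V | `|x| <= r].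
have mD : measurable D by exact: cball_borel.
have mf := continuous_borel (testfun_continuous tf).
apply: (le_integrable _ _ _ (_ : m.-integrable setT (fun x => (M%:E * (\1_D x)%:E)%E))) => //.
- exact/measurable_EFinP.
- move=> x _ /=; rewrite lee_fin.
  have [xr|/fr->] := leP `|x : V| r; last by rewrite normr0.
  by rewrite indicE mem_set//= mulr1 (le_trans (fM x))// ler_norm.
- apply: integrableZl => //; apply: integrable_indic_fin => //.
  exact: lm.
Qed.

Lemma rintD (m : meas) (f g : V -> R) : locfin m -> testfun f -> testfun g ->
  int_real m (fun x => f x + g x) = int_real m f + int_real m g.
Proof.
move=> lm tf tg; have [If Ig] := (testfun_integrable lm tf, testfun_integrable lm tg).
by rewrite /int_real (integralD_EFin _ If Ig)// fineD//; apply: integrable_fin_num.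
Qed.

Lemma rintZ (m : meas) (f : V -> R) c : locfin m -> testfun f ->
  int_real m (fun x => c * f x) = c * int_real m f.
Proof.
move=> lm tf; have If := testfun_integrable lm tf.
rewrite /int_real; under eq_integral do rewrite EFinM.
by rewrite integralZl//= fineM//; apply: integrable_fin_num.
Qed.

Lemma rint_ge0 (m : meas) (f : V -> R) : (forall x, 0 <= f x) -> 0 <= int_real m f.
Proof. by move=> f0; apply: fine_ge0; apply: integral_ge0 => x _; rewrite lee_fin. Qed.

Lemma eq_rint (m : meas) (f g : V -> R) : f =1 g -> int_real m f = int_real m g.
Proof. by move=> /funext ->. Qed.

Lemma locfin_add (m m' : meas) : locfin m -> locfin m' -> locfin (measure_add m m').
Proof. by move=> lm lm' r; rewrite [ltLHS]measure_addE lte_add_pinfty. Qed.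

Lemma locfin_scale (m : meas) (c : {nonneg R}) : locfin m -> locfin (mscale c m).
Proof. by move=> lm r; rewrite /= /mscale/= lte_mul_pinfty// lee_fin. Qed.

Lemma rint_add (m m' : meas) (f : V -> R) : locfin m -> locfin m' -> testfun f ->
  int_real (measure_add m m') f = int_real m f + int_real m' f.
Proof.
move=> lm lm' tf; have [I1 I2] := (testfun_integrable lm tf, testfun_integrable lm' tf).
by rewrite /int_real integral_measure_add// fineD//; apply: integrable_fin_num.
Qed.

(** Scaling is first treated on nonnegative integrands, then on the positive and negative parts of
    [f], which are again test functions. *)
Lemma rint_scale (m : meas) (c : {nonneg R}) (f : V -> R) : locfin m -> testfun f ->
  int_real (mscale c m) f = c%:num * int_real m f.
Proof.
move=> lm tf.
have pos (g : V -> R) : testfun g -> (forall x, 0 <= g x) ->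
    int_real (mscale c m) g = c%:num * int_real m g.
  move=> tg g0; rewrite /int_real ge0_integral_mscale//=; last 2 first.
    by apply/measurable_EFinP; apply: continuous_borel; exact: testfun_continuous.
    by move=> x _; rewrite lee_fin.
  by rewrite fineM//; apply: integrable_fin_num => //; exact: testfun_integrable.
have tp : testfun (fun x => Num.max (f x) 0).
  case: tf => [cf [r fr]]; split; last by exists r => x /fr ->; rewrite maxxx.
  by apply: cont_max => //; exact: cont_cst.
have tq : testfun (fun x => Num.max (- f x) 0).
  case: tf => [cf [r fr]]; split; last by exists r => x /fr ->; rewrite oppr0 maxxx.
  by apply: cont_max; [exact: contN|exact: cont_cst].
have fE x : f x = Num.max (f x) 0 + (-1) * Num.max (- f x) 0.
  by rewrite /Num.max; case: ltrP => h1; case: ltrP => h2; lra.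
have ge0m (a : R) : 0 <= Num.max a 0 by rewrite le_max lexx orbT.
rewrite (eq_rint _ fE) (eq_rint m fE) !rintD ?rintZ ?pos//; try exact: locfin_scale; try exact: testfunZ.
by ring.
Qed.

End RadonBasics.

(** * Uniqueness of Radon measures tested on continuous functions *)

Section RadonUniqueness.
Variables (R : realType) (n : nat).
Hypothesis hn : (0 < n)%N.
Local Notation V := 'rV[R]_n.
Local Notation BV := (Borel R n).
Local Notation meas := {measure set BV -> \bar R}.

(** Distance to the complement of [U]; the functions [min 1 (j * distC U)] increase to the indicator
    of a proper open set. *)
Definition distC (U : set V) (x : V) : R := inf [set `|x - y| | y in ~` U].

Lemma distC_has_inf (U : set V) x : (~` U) !=set0 -> has_inf [set `|x - y| | y in ~` U].
Proof. by move=> [y Uy]; split; [exists `|x - y|, y|exists 0 => _ [z _ <-]]. Qed.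

Lemma distC_ge0 (U : set V) x : (~` U) !=set0 -> 0 <= distC U x.
Proof.
move=> U0; apply: lb_le_inf; first by case: (distC_has_inf x U0).
by move=> _ [z _ <-].
Qed.

Lemma distC_lip (U : set V) : (~` U) !=set0 ->
  forall x y, `|distC U x - distC U y| <= 1 * `|x - y|.
Proof.
move=> U0; suff H x y : distC U x <= distC U y + `|x - y|.
  move=> x y; have := H x y; have := H y x; rewrite (distrC y) mul1r ler_norml => h1 h2.
  by apply/andP; split; lra.
rewrite -lerBlDr; apply: lb_le_inf; first by case: (distC_has_inf y U0).
move=> _ [z Uz <-]; rewrite lerBlDr; apply: (@le_trans _ _ `|x - z|).
  by apply: ge_inf; [case: (distC_has_inf x U0)|exists z].
have -> : x - z = (x - y) + (y - z) by rewrite addrA subrK.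
by rewrite addrC ler_normD.
Qed.

Lemma distC_eq0 (U : set V) x : ~ U x -> distC U x = 0.
Proof.
move=> Ux; have U0 : (~` U) !=set0 by exists x.
apply/le_anti; rewrite distC_ge0// andbT; apply: ge_inf; first by case: (distC_has_inf x U0).
by exists x => //; rewrite subrr normr0.
Qed.

Lemma distC_gt0 (U : set V) x : open U -> (~` U) !=set0 -> U x -> 0 < distC U x.
Proof.
move=> oU U0 Ux.
have /nbhs_ballP[e /= e0 He] : nbhs x U by exact: open_nbhs_nbhs.
apply: (lt_le_trans e0); apply: lb_le_inf; first by case: (distC_has_inf x U0).
move=> _ [z Uz <-]; rewrite leNgt; apply/negP => xze; apply: Uz; apply: He.
by rewrite mx_norm_ball.
Qed.

(** The point with all coordinates [|r| + 1] lies outside. This is where [0 < n] enters: [R^0] is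
    itself bounded and open. *)
Lemma bounded_open_neqT (U : set V) (r : R) : (forall x, U x -> `|x| <= r) -> (~` U) !=set0.
Proof.
move=> Ur; exists (\row_i (`|r| + 1)) => /Ur; apply/negP; rewrite -ltNge.
apply: (@lt_le_trans _ _ (`|r| + 1)); first by rewrite ltr_pwDr ?ler_norm.
have := norm_coord (\row_(i < n) (`|r| + 1) : V) (Ordinal hn).
by rewrite mxE ger0_norm// addr_ge0.
Qed.

Lemma open_ball0 (r : R) : open [set x : V | `|x| < r].
Proof.
apply: (@open_comp _ _ (fun x : V => `|x|) [set y | y < r]); last exact: open_lt.
by move=> x _; apply: norm_continuous.
Qed.

Lemma bounded_open_bborel (U : set V) : open U -> bounded_set_V U -> bborel U.
Proof. by move=> oU bU; split => //; exact: open_borel. Qed.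

Lemma natr_unbounded (x : R) : exists k : nat, x < k%:R.
Proof. by exists (Num.trunc `|x|).+1; rewrite (le_lt_trans (ler_norm x))// truncnS_gt. Qed.

Lemma balls_cover : \bigcup_k [set x : BV | `|x : V| < k%:R] = setT.
Proof.
apply/seteqP; split => // x _.
by have [k xk] := natr_unbounded `|x : V|; exists k.
Qed.

Lemma bounded_set_ball (r : R) : bounded_set_V [set x : V | `|x| < r].
Proof. by exists r => x /ltW. Qed.

Lemma locfin_bborel (m : meas) (B : set V) : locfin m -> bborel B -> (m B < +oo)%E.
Proof.
move=> lm [mB [r Br]]; apply: le_lt_trans (lm r); apply: le_measure; rewrite ?inE//.
exact: cball_borel.
Qed.

Lemma locfin_fin_num (m : meas) (B : set V) : locfin m -> bborel B -> m B \is a fin_num.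
Proof. by move=> lm bB; rewrite ge0_fin_numE// locfin_bborel. Qed.

(** An open set is the countable union of its intersections with open balls. Bounded generators are
    wanted because locally finite measures are finite on them. *)
Lemma borel_generated_bounded (G : set (set V)) :
  (forall U, open U -> bounded_set_V U -> G U) -> G `<=` <<s @open V >> ->
  @measurable _ BV = <<s G >>.
Proof.
move=> oG Gb; apply/seteqP; split; last first.
  by apply: smallest_sub => //; exact: smallest_sigma_algebra.
apply: smallest_sub; first exact: smallest_sigma_algebra.
move=> U oU; have -> : U = \bigcup_k (U `&` [set x : V | `|x| < k%:R]).
  by rewrite -setI_bigcupr balls_cover setIT.
apply: (@bigcupT_measurable _ (g_sigma_algebraType G)) => k; apply: sub_sigma_algebra.
apply: oG; first by apply: openI => //; exact: open_ball0.
by exists k%:R => x [_ /ltW].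
Qed.

(** Bounded open sets form a generating class stable under intersection, and balls of finite measure
    exhaust the space. *)
Lemma eq_meas_bborel (m m' : meas) : locfin m ->
  (forall U, open U -> bounded_set_V U -> m U = m' U) ->
  forall A, measurable A -> m A = m' A.
Proof.
move=> lm mm' A mA.
apply: (measure_unique [set U : set BV | open (U : set V) /\ bounded_set_V (U : set V)]
   (fun k => [set x : BV | `|x : V| < k%:R])) => //.
- apply: borel_generated_bounded => // U [oU _]; exact: open_borel.
- move=> U U' [oU [r Ur]] [oU' _]; split; first exact: openI.
  by exists r => x [/Ur].
- by move=> i; split; [exact: open_ball0|exact: bounded_set_ball].
- exact: balls_cover.
- by move=> B [oB bB]; exact: mm'.
- by move=> k; apply: locfin_bborel => //; apply: bounded_open_bborel; [exact: open_ball0|exact: bounded_set_ball].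
Qed.

(** Monotone convergence along [phi j], which increases to the indicator of a bounded open set. *)
Lemma eq_meas_testfun (m m' : meas) : locfin m -> locfin m' ->
  (forall phi, testfun phi -> int_real m phi = int_real m' phi) ->
  forall A, measurable A -> m A = m' A.
Proof.
move=> lm lm' mm'; apply: eq_meas_bborel => // U oU [r Ur].
have U0 := bounded_open_neqT Ur.
pose phi (j : nat) (x : V) : R := Num.min 1 (j%:R * distC U x).
have phi0 j x : 0 <= phi j x by rewrite le_min ler01 mulr_ge0// distC_ge0.
have tphi j : testfun (phi j).
  split; last by exists r => x rx; rewrite /phi distC_eq0 ?mulr0 ?min_r// => /Ur; rewrite leNgt rx.
  apply: cont_min; first exact: cont_cst.
  by apply: contZ; apply: lipschitz_continuous; exact: distC_lip.
have lim (mu : meas) : locfin mu -> mu U = limn (fun j => \int[mu]_(x in [set: BV]) (phi j x)%:E)%E.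
  move=> lmu; have mU := open_borel oU.
  transitivity (\int[mu]_(x in [set: BV]) (\1_(U : set BV) x)%:E)%E.
    by rewrite integral_indic// setIT.
  have limx (x : V) : limn (fun j => (phi j x)%:E) = (\1_(U : set BV) x)%:E.
    apply/cvg_lim => //; rewrite indicE; case: (asboolP (U x)) => Ux.
      rewrite mem_set//=.
      have d0 := distC_gt0 oU U0 Ux.
      have [k xk] := natr_unbounded (distC U x)^-1.
      apply: cvg_near_cst; exists k => // j /= kj; congr EFin; rewrite /phi min_l//.
      rewrite -ler_pdivrMr// div1r (le_trans (ltW xk))// ler_nat//.
    rewrite memNset//; apply: cvg_near_cst; exists 0 => // j _ /=; congr EFin.
    by rewrite /phi distC_eq0// mulr0 min_r.
  under eq_integral do rewrite -limx.
  apply/esym/cvg_lim => //; apply: cvg_monotone_convergence => //.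
  - by move=> j; apply/measurable_EFinP; apply: continuous_borel; exact: testfun_continuous.
  - by move=> j x _; rewrite lee_fin.
  - move=> x _ i j ij; rewrite lee_fin /phi le_min ge_min lexx/=.
    by rewrite ge_min ler_wpM2r ?orbT// ?distC_ge0// ler_nat.
rewrite !lim//; congr (limn _); apply/funext => j.
have := mm' _ (tphi j); rewrite /int_real => e; have {e} := congr1 EFin e; rewrite !fineK//.
- by apply: integrable_fin_num => //; exact: testfun_integrable.
- by apply: integrable_fin_num => //; exact: testfun_integrable.
Qed.

Lemma meas_addE (m m' : meas) B : (measure_add m m' : meas) B = (m B + m' B)%E.
Proof. exact: measure_addE. Qed.

Definition rdecomp (nu : set V -> R) (m0 m1 : meas) : Prop :=
  [/\ locfin m0, locfin m1,
      forall B : set V, bborel B -> nu B = fine (m0 B) - fine (m1 B) &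
      forall B : set V, ~ bborel B -> nu B = 0].

Definition rrad (nu : set V -> R) : Prop := exists m0 m1, rdecomp nu m0 m1.

Definition rcint (nu : set V -> R) (phi : V -> R) : R :=
  xget 0 [set z | exists m0 m1, rdecomp nu m0 m1 /\ z = int_real m0 phi - int_real m1 phi].

(** Independence of the decomposition: equality of two differences of measures is read as equality
    of the positive measures [m0 + m1'] and [m0' + m1], which agree on bounded open sets. *)
Lemma rcintE nu m0 m1 phi : rdecomp nu m0 m1 -> testfun phi ->
  rcint nu phi = int_real m0 phi - int_real m1 phi.
Proof.
move=> d tphi; rewrite /rcint; case: xgetP => [z _ [m0' [m1' [d' ->]]]|/(_ (int_real m0 phi - int_real m1 phi))]; last first.
  by case; exists m0, m1.
have [l0 l1 h _] := d; have [l0' l1' h' _] := d'.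
have E : forall A, measurable A -> measure_add m0 m1' A = measure_add m0' m1 A.
  apply: eq_meas_bborel; first exact: locfin_add.
  move=> U oU bU; have bb := bounded_open_bborel oU bU.
  have := h' _ bb; rewrite (h _ bb) => e.
  rewrite !meas_addE.
  rewrite -(fineK (locfin_fin_num l0 bb)) -(fineK (locfin_fin_num l1 bb)).
  rewrite -(fineK (locfin_fin_num l0' bb)) -(fineK (locfin_fin_num l1' bb)).
  by rewrite -!EFinD; congr EFin; lra.
have : int_real (measure_add m0 m1') phi = int_real (measure_add m0' m1) phi.
  by rewrite /int_real; congr fine; apply: eq_measure_integral => A mA _; exact: E.
by rewrite !rint_add// => e; lra.
Qed.

Lemma rcint_inj nu nu' : rrad nu -> rrad nu' ->
  (forall phi, testfun phi -> rcint nu phi = rcint nu' phi) -> nu = nu'.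
Proof.
move=> [m0 [m1 d]] [m0' [m1' d']] e; apply/funext => B.
have [l0 l1 h hN] := d; have [l0' l1' h' hN'] := d'.
have [bb|nb] := pselect (bborel B); last by rewrite hN// hN'.
have E A : measurable A -> (m0 A + m1' A = m0' A + m1 A)%E.
  rewrite -!meas_addE; move: A; apply: eq_meas_testfun; [exact: locfin_add|exact: locfin_add|].
  move=> phi tphi; rewrite !rint_add//.
  by have := e _ tphi; rewrite (rcintE d)// (rcintE d')// => e'; lra.
rewrite h// h'//; have [mB _] := bb; have e' := congr1 fine (E _ mB); move: e'.
by rewrite !fineD ?locfin_fin_num// => e'; lra.
Qed.

(** Coefficients are split into positive and negative part, the latter exchanging the two measures,
    so that both components stay positive. *)
Lemma rrad_lincomb (nu nu' : set V -> R) (a b : R) : rrad nu -> rrad nu' ->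
  rrad (fun B => a * nu B + b * nu' B) /\
  forall phi, testfun phi ->
    rcint (fun B => a * nu B + b * nu' B) phi = a * rcint nu phi + b * rcint nu' phi.
Proof.
move=> [m0 [m1 d]] [m0' [m1' d']].
have [l0 l1 h hN] := d; have [l0' l1' h' hN'] := d'.
have pos (c : R) : 0 <= Num.max c 0 by rewrite le_max lexx orbT.
pose p c : {nonneg R} := NngNum (pos c).
have pE (c : R) : c = (p c)%:num - (p (- c))%:num.
  by rewrite /= /Num.max; case: ltrP => h1; case: ltrP => h2; lra.
pose M0 : meas := measure_add (measure_add (mscale (p a) m0) (mscale (p (- a)) m1))
  (measure_add (mscale (p b) m0') (mscale (p (- b)) m1')).
pose M1 : meas := measure_add (measure_add (mscale (p a) m1) (mscale (p (- a)) m0))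
  (measure_add (mscale (p b) m1') (mscale (p (- b)) m0')).
have D : rdecomp (fun B => a * nu B + b * nu' B) M0 M1.
  split; try by do ?apply: locfin_add; exact: locfin_scale.
  - move=> B bB; rewrite h// h'//.
    have f (m : meas) (c : {nonneg R}) : locfin m ->
       ((mscale c m : meas) B = (c%:num * fine (m B))%:E)%E.
      by move=> lm; rewrite EFinM fineK// locfin_fin_num.
    rewrite /M0 /M1 !meas_addE !f//= [in LHS](pE a) [in LHS](pE b) /=.
    by ring.
  - by move=> B nB; rewrite hN// hN'// !mulr0 addr0.
split; first by exists M0, M1.
move=> phi tphi; rewrite (rcintE D)// (rcintE d)// (rcintE d')//.
rewrite /M0 /M1 !rint_add ?rint_scale//; try by do ?apply: locfin_add; exact: locfin_scale.
by rewrite [in RHS](pE a) [in RHS](pE b) /=; ring.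
Qed.

Lemma cradon_re_im (mu : set V -> complex R) : is_cradon mu <->
  rrad (fun B => complex.Re (mu B)) /\ rrad (fun B => complex.Im (mu B)).
Proof.
split=> [[m [lm [h hN]]]|[[m0 [m1 [l0 l1 h hN]]] [m2 [m3 [l2 l3 h' hN']]]]].
  by split; [exists (m (inord 0)), (m (inord 1))|exists (m (inord 2)), (m (inord 3))];
    (split; try exact: lm) => B bB; first [by rewrite (h _ bB)|by rewrite (hN _ bB)].
exists (fun j => match val j with 0%N => m0 | 1%N => m1 | 2%N => m2 | _ => m3 end).
split; first by move=> [[|[|[|[|]]]]]//=.
split=> B bB; rewrite /= ?(@inordK 3 0) ?(@inordK 3 1) ?(@inordK 3 2) ?(@inordK 3 3)//.
  by have := (h _ bB, h' _ bB); case: (mu B) => a b /= [-> ->].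
by have := (hN _ bB, hN' _ bB); case: (mu B) => a b /= [-> ->].
Qed.

Lemma cintE (mu : set V -> complex R) phi : is_cradon mu -> testfun phi ->
  cint mu phi = Complex (rcint (fun B => complex.Re (mu B)) phi)
                        (rcint (fun B => complex.Im (mu B)) phi).
Proof.
move=> [m d] tphi; rewrite /cint; case: xgetP => [z _ [m' [d' ->]]|]; last first.
  move=> /(_ (Complex (int_real (m (inord 0)) phi - int_real (m (inord 1)) phi)
                (int_real (m (inord 2)) phi - int_real (m (inord 3)) phi))); case.
  by exists m.
have [lm [h hN]] := d'; congr Complex; apply/esym; apply: rcintE => //; split;
  try exact: lm; move=> B bB; first [by rewrite (h _ bB)|by rewrite (hN _ bB)].
Qed.

End RadonUniqueness.

Definition pushm d1 d2 (X : measurableType d1) (Y : measurableType d2) (R : realType)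
    (m : {measure set X -> \bar R}) (h : X -> Y) (mh : measurable_fun setT h) :
    {measure set Y -> \bar R} :=
  measure_function_pushforward__canonical__measure_function_Measure m mh.

Lemma pushmE d1 d2 (X : measurableType d1) (Y : measurableType d2) (R : realType)
  (m : {measure set X -> \bar R}) (h : X -> Y) (mh : measurable_fun setT h) A :
  pushm m mh A = m (h @^-1` A).
Proof. by []. Qed.

Lemma integral_pushm d1 d2 (X : measurableType d1) (Y : measurableType d2) (R : realType)
  (m : {measure set X -> \bar R}) (h : X -> Y) (mh : measurable_fun setT h) f :
  measurable_fun setT f -> m.-integrable setT (f \o h) ->
  (\int[pushm m mh]_(y in setT) f y = \int[m]_(x in setT) f (h x))%E.
Proof. by move=> mf If; rewrite (@integral_pushforward _ _ _ _ _ _ mh m setT f). Qed.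

(** * Real-valued valuations and their pairing with test functions *)

Section RealMAVal.
Variables (R : realType) (n : nat).
Hypothesis hn : (0 < n)%N.
Local Notation V := 'rV[R]_n.
Local Notation BV := (Borel R n).
Local Notation meas := {measure set BV -> \bar R}.

Lemma continuous_borel_map (h : V -> V) : continuous h ->
  measurable_fun setT (h : BV -> BV).
Proof.
move=> ch _ A mA; rewrite setTI.
have : <<s @open V >> `<=` [set B | measurable (h @^-1` B : set BV)].
  apply: smallest_sub => /=; last first.
    by move=> U oU /=; apply: open_borel; apply: open_comp => // x _; exact: ch.
  split => /=.
  - by rewrite preimage_set0.
  - by move=> B mB; rewrite setTD -preimage_setC; exact: measurableC.
  - by move=> F mF; rewrite preimage_bigcup; exact: bigcupT_measurable.
by apply.
Qed.

Definition bounded_map (h : V -> V) : Prop :=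
  forall r : R, exists s : R, forall x, `|x| <= r -> `|h x| <= s.

Lemma continuous_bounded_map (h : V -> V) : continuous h -> bounded_map h.
Proof.
move=> ch r; have : compact (h @` [set x : V | `|x| <= r]).
  by apply: continuous_compact; [exact: continuous_subspaceT|exact: cball_compact].
move=> /compact_bounded[M [_ HM]]; exists (M + 1) => x xr.
by apply: HM; rewrite ?ltrDl//; exists x.
Qed.

Lemma bborel_preimage (h : V -> V) (B : set V) : continuous h ->
  (forall r : R, exists s : R, forall x, `|h x| <= r -> `|x| <= s) ->
  bborel B -> bborel (h @^-1` B).
Proof.
move=> ch bh [mB [r Br]]; split.
  by rewrite -[_ @^-1` _]setTI; exact: (continuous_borel_map ch).
have [s hs] := bh r; exists s => x /Br; exact: hs.
Qed.

Lemma image_inv (h h' : V -> V) (B : set V) : cancel h h' -> cancel h' h ->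
  h' @` B = h @^-1` B.
Proof.
move=> hK h'K; apply/seteqP; split=> [_ [x Bx <-]|x Bx] /=; first by rewrite h'K.
by exists (h x) => //; rewrite hK.
Qed.

Lemma testfun_comp (h h' : V -> V) phi : continuous h -> continuous h' -> cancel h h' ->
  testfun phi -> testfun (fun x => phi (h x)).
Proof.
move=> ch ch' hK [cphi [r hr]]; split; first exact: cont_comp.
have [s hs] := continuous_bounded_map ch' r; exists s => x sx; apply: hr.
by rewrite ltNge; apply/negP => /hs; rewrite hK leNgt sx.
Qed.

(** The image under [h'] is the preimage under [h], so the set function is a pushforward. Continuity
    of both maps keeps bounded Borel sets bounded Borel in both directions. *)
Lemma rdecomp_push (nu : set V -> R) m0 m1 (h h' : V -> V)
  (ch : continuous h) (ch' : continuous h') : cancel h h' -> cancel h' h ->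
  rdecomp nu m0 m1 ->
  rdecomp (fun B => nu (h' @` B)) (pushm m0 (continuous_borel_map ch))
    (pushm m1 (continuous_borel_map ch)).
Proof.
move=> hK h'K [l0 l1 e eN].
have bh (r : R) : exists s : R, forall x, `|h x| <= r -> `|x| <= s.
  have [s hs] := continuous_bounded_map ch' r; exists s => x /hs; by rewrite hK.
have bh' (r : R) : exists s : R, forall x, `|h' x| <= r -> `|x| <= s.
  have [s hs] := continuous_bounded_map ch r; exists s => x /hs; by rewrite h'K.
have lf (m : meas) : locfin m -> locfin (pushm m (continuous_borel_map ch)).
  move=> lm r; rewrite pushmE; apply: locfin_bborel => //.
  apply: (@bborel_preimage h [set x : V | `|x| <= r]) => //; split; first exact: cball_borel.
  by exists r.
split; [exact: lf|exact: lf|move=> B bB|move=> B nB].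
  rewrite (image_inv B hK h'K) e//; exact: bborel_preimage.
rewrite eN// => bB; apply: nB; rewrite (image_inv B hK h'K) in bB.
have -> : B = h' @^-1` (h @^-1` B) by apply/funext => x /=; rewrite h'K.
exact: bborel_preimage.
Qed.

Lemma rrad_push (nu : set V -> R) (h h' : V -> V) : continuous h -> continuous h' ->
  cancel h h' -> cancel h' h -> rrad nu ->
  rrad (fun B => nu (h' @` B)) /\ forall phi, testfun phi ->
    rcint (fun B => nu (h' @` B)) phi = rcint nu (fun x => phi (h x)).
Proof.
move=> ch ch' hK h'K [m0 [m1 d]]; have d' := rdecomp_push ch ch' hK h'K d.
split; first by eexists; eexists; exact: d'.
move=> phi tphi; have tc := testfun_comp ch ch' hK tphi.
have [l0 l1 _ _] := d.
rewrite (rcintE d')// (rcintE d)// /int_real.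
have E (m : meas) : locfin m ->
  (\int[pushm m (continuous_borel_map ch)]_(y in setT) (phi y)%:E = \int[m]_(x in setT) (phi (h x))%:E)%E.
  move=> lm; apply: (@integral_pushm _ _ _ _ _ m _ _ (EFin \o (phi : BV -> R))).
    by apply/measurable_EFinP; apply: continuous_borel; exact: testfun_continuous.
  exact: testfun_integrable.
by rewrite !E.
Qed.

(** The integrand lives in [U] and in a ball, so only bounded Borel subsets of [U] contribute. The
    closed support of [phi] may leave [U]. *)
Lemma rrad_local (nu nu' : set V -> R) (U : set V) phi : open U -> rrad nu -> rrad nu' ->
  (forall B, bborel B -> nu (B `&` U) = nu' (B `&` U)) ->
  testfun phi -> (forall x, phi x != 0 -> U x) -> rcint nu phi = rcint nu' phi.
Proof.
move=> oU [m0 [m1 d]] [m0' [m1' d']] e tphi phiU.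
have [[l0 l1 h _] [l0' l1' h' _]] := (d, d').
rewrite (rcintE d)// (rcintE d')//.
have [r r0 hr] := testfun_radius tphi.
pose D : set BV := U `&` [set x : V | `|x| <= r].
have bD : bborel D.
  split; last by exists r => x [].
  by apply: (@measurableI _ BV); [exact: open_borel|exact: cball_borel].
have ID (m : meas) : int_real m phi = fine (\int[m]_(x in D) (phi x)%:E)%E.
  rewrite /int_real [in RHS]integral_mkcond; congr fine; apply: eq_integral => x _.
  rewrite patchE; case: ifPn => // /negP xD; congr EFin; apply: contrapT => /eqP px.
  apply: xD; rewrite inE; split; first exact: phiU.
  by rewrite /= leNgt; apply/negP => /hr e0; rewrite e0 eqxx in px.
have : int_real (measure_add m0 m1') phi = int_real (measure_add m0' m1) phi.
  rewrite !ID; congr fine; apply: eq_measure_integral => A mA AD.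
  have bA : bborel A by split => //; exists r => x /AD[].
  have AU : A `&` U = A by apply/setIidPl => x /AD[].
  have := e _ bA; rewrite AU (h _ bA) (h' _ bA) => e'.
  rewrite !meas_addE -(fineK (locfin_fin_num l0 bA)) -(fineK (locfin_fin_num l1 bA)).
  rewrite -(fineK (locfin_fin_num l0' bA)) -(fineK (locfin_fin_num l1' bA)).
  by rewrite -!EFinD; congr EFin; lra.
by rewrite !rint_add// => e'; lra.
Qed.

Definition rMAVal (k : nat) (P : (V -> R) -> set V -> R) : Prop :=
  (forall f, ~ convexf f -> P f = (fun _ => 0)) /\
  (forall f, convexf f -> rrad (P f)) /\
  (forall (f_ : nat -> V -> R) f, (forall j, convexf (f_ j)) -> convexf f ->
     lu_cvg f_ f -> forall phi, testfun phi ->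
       (fun j => rcint (P (f_ j)) phi) @ \oo --> rcint (P f) phi) /\
  (forall f h, convexf f -> convexf h -> convexf (fun x => Num.min (f x) (h x)) ->
     forall B, P (fun x => Num.max (f x) (h x)) B + P (fun x => Num.min (f x) (h x)) B
               = P f B + P h B) /\
  (forall f (y : V) (c : R), convexf f -> P (fun x => f x + (dotp y x + c)) = P f) /\
  (forall f h (U : set V), open U -> convexf f -> convexf h ->
     (forall x, U x -> f x = h x) ->
     forall B, bborel B -> P f (B `&` U) = P h (B `&` U)) /\
  (forall f (x : V), convexf f -> forall B, bborel B ->
     P (fun z => f (z + x)) B = P f [set b + x | b in B]) /\
  (forall f (t : R), convexf f -> 0 <= t ->
     P (fun x => t * f x) = (fun B => t ^+ k * P f B)).

Lemma complexP (z w : complex R) : z = w <->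
  complex.Re z = complex.Re w /\ complex.Im z = complex.Im w.
Proof. by case: z w => a b [c d] /=; split=> [[-> ->]|[-> ->]]. Qed.

Lemma cvg_complex (z : nat -> complex R) (w : complex R) :
  (forall e : R, 0 < e -> exists N : nat, forall j, (N <= j)%N -> `|z j - w| < (e%:C)%C) <->
  ((fun j => complex.Re (z j)) @ \oo --> complex.Re w /\
   (fun j => complex.Im (z j)) @ \oo --> complex.Im w).
Proof.
have nE (u : complex R) (e : R) :
   (`|u| < (e%:C)%C) = (Num.sqrt (complex.Re u ^+ 2 + complex.Im u ^+ 2) < e).
  by rewrite normc_def ltcE /= eqxx.
split=> [h|[hr hi] e e0].
  have H (c : complex R -> R) : (forall u, `|c u| <= Num.sqrt (complex.Re u ^+ 2 + complex.Im u ^+ 2)) ->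
      (forall u v, c (u - v) = c u - c v) -> (fun j => c (z j)) @ \oo --> c w.
    move=> hc cB; apply/cvgrPdist_lt => e e0; have [N hN] := h e e0.
    exists N => // j /= Nj; rewrite distrC -cB; apply: le_lt_trans (hc _) _.
    by rewrite -nE; exact: hN.
  split; apply: H => [[a b]|[a b] [c d]] //=; rewrite -sqrtr_sqr ler_sqrt ?addr_ge0 ?sqr_ge0//.
    by rewrite lerDl sqr_ge0.
  by rewrite lerDr sqr_ge0.
have e2 : 0 < e / 2 by rewrite divr_gt0.
move/cvgrPdist_lt : hr => /(_ _ e2)[N1 _ h1].
move/cvgrPdist_lt : hi => /(_ _ e2)[N2 _ h2].
exists (maxn N1 N2) => j; rewrite geq_max => /andP[/h1 /= j1 /h2 /= j2].
rewrite nE; case: (z j) (w) j1 j2 => a b [c d] /= j1 j2.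
rewrite -[ltRHS]ger0_norm ?(ltW e0)// -sqrtr_sqr ltr_sqrt ?exprn_gt0//.
rewrite -(real_normK (num_real (a - c))) -(real_normK (num_real (b - d))) (distrC a) (distrC b).
have [h3 h4] : 0 <= `|c - a| /\ 0 <= `|d - b| by [].
by nra.
Qed.

Lemma MAVal_re_im (k : nat) (P : MAV R n) : MAVal k P <->
  rMAVal k (fun f B => complex.Re (P f B)) /\ rMAVal k (fun f B => complex.Im (P f B)).
Proof.
have expC (t : R) (z : complex R) : (t%:C)%C ^+ k * z = Complex (t ^+ k * complex.Re z) (t ^+ k * complex.Im z).
  have -> : (t%:C)%C ^+ k = ((t ^+ k)%:C)%C by rewrite rmorphXn.
  by case: z => a b; rewrite /GRing.mul /= !mul0r subr0 addr0.
split=> [[p1 [p2 [p3 [p4 [p5 [p6 [p7 p8]]]]]]]|].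
  have cv f_ f phi : (forall j, convexf (f_ j)) -> convexf f -> lu_cvg f_ f -> testfun phi ->
     (fun j => rcint (fun B => complex.Re (P (f_ j) B)) phi) @ \oo --> rcint (fun B => complex.Re (P f B)) phi /\
     (fun j => rcint (fun B => complex.Im (P (f_ j) B)) phi) @ \oo --> rcint (fun B => complex.Im (P f B)) phi.
    move=> c1 c2 lu tphi; have := p3 _ _ c1 c2 lu phi tphi.
    move/(cvg_complex (fun j => cint (P (f_ j)) phi)).
    rewrite (cintE (p2 _ c2))//=.
    under [in X in X /\ _]eq_fun do rewrite (cintE (p2 _ (c1 _)))//=.
    by under [in X in _ /\ X]eq_fun do rewrite (cintE (p2 _ (c1 _)))//=.
  split; do ?split.
  - by move=> f nf; rewrite p1.
  - by move=> f /p2/cradon_re_im[].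
  - by move=> f_ f c1 c2 lu phi tphi; case: (cv f_ f phi).
  - by move=> f h cf ch cm B; have /complexP[/=] := p4 f h cf ch cm B; do 4 case: (P _ _) => ? ?.
  - by move=> f y c cf; rewrite -(p5 f y c cf).
  - by move=> f h U oU cf ch e B bB; rewrite (p6 f h U).
  - by move=> f x cf B bB; rewrite p7.
  - by move=> f t cf t0; rewrite p8//; apply/funext => B; rewrite expC.
  - by move=> f nf; rewrite p1.
  - by move=> f /p2/cradon_re_im[].
  - by move=> f_ f c1 c2 lu phi tphi; case: (cv f_ f phi).
  - by move=> f h cf ch cm B; have /complexP[_ /=] := p4 f h cf ch cm B; do 4 case: (P _ _) => ? ?.
  - by move=> f y c cf; rewrite -(p5 f y c cf).
  - by move=> f h U oU cf ch e B bB; rewrite (p6 f h U).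
  - by move=> f x cf B bB; rewrite p7.
  - by move=> f t cf t0; rewrite p8//; apply/funext => B; rewrite expC.
move=> [[p1 [p2 [p3 [p4 [p5 [p6 [p7 p8]]]]]]] [q1 [q2 [q3 [q4 [q5 [q6 [q7 q8]]]]]]]].
have rad f : convexf f -> is_cradon (P f).
  by move=> cf; apply/cradon_re_im; split; [exact: p2|exact: q2].
do ?split.
- move=> f nf; apply/funext => B; apply/complexP; split.
    exact: (congr1 (fun g => g B) (p1 f nf)).
  exact: (congr1 (fun g => g B) (q1 f nf)).
- exact: rad.
- move=> f_ f c1 c2 lu phi tphi; apply/(cvg_complex (fun j => cint (P (f_ j)) phi)).
  rewrite (cintE (rad _ c2))//=; split.
    under eq_fun do rewrite (cintE (rad _ (c1 _)))//=; exact: p3.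
  under eq_fun do rewrite (cintE (rad _ (c1 _)))//=; exact: q3.
- move=> f h cf ch cm B; have := p4 f h cf ch cm B; have := q4 f h cf ch cm B.
  by do 4 case: (P _ _) => ? ? /=; move=> e1 e2; apply/complexP.
- move=> f y c cf; apply/funext => B; apply/complexP; split.
    exact: (congr1 (fun g => g B) (p5 f y c cf)).
  exact: (congr1 (fun g => g B) (q5 f y c cf)).
- move=> f h U oU cf ch e B bB; apply/complexP; split; [exact: p6|exact: q6].
- move=> f x cf B bB; apply/complexP; split; [exact: p7|exact: q7].
- move=> f t cf t0; apply/funext => B; rewrite expC; apply/complexP; split.
    exact: (congr1 (fun g => g B) (p8 f t cf t0)).
  exact: (congr1 (fun g => g B) (q8 f t cf t0)).
Qed.

(** [J f phi] stands for the integral of [phi] against the value at [f]; the uniqueness argument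
    works with this pairing. Linearity in [phi] comes from [lf_rep], and equality of measures is
    recovered by [rcint_inj]. *)
Record lfun (k : nat) (J : (V -> R) -> (V -> R) -> R) : Prop := LFun {
  lf_rep : forall f, convexf f -> exists m0 m1 : meas, [/\ locfin m0, locfin m1 &
    forall phi, testfun phi -> J f phi = int_real m0 phi - int_real m1 phi];
  lf_cont : forall f_ f phi, (forall j, convexf (f_ j)) -> convexf f -> lu_cvg f_ f ->
    testfun phi -> (fun j => J (f_ j) phi) @ \oo --> J f phi;
  lf_aff : forall f y c phi, convexf f -> testfun phi ->
    J (fun x => f x + (dotp y x + c)) phi = J f phi;
  lf_loc : forall f h U phi, open U -> convexf f -> convexf h ->
    (forall x, U x -> f x = h x) -> testfun phi -> (forall x, phi x != 0 -> U x) ->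
    J f phi = J h phi;
  lf_trans : forall f x phi, convexf f -> testfun phi ->
    J (fun z => f (z + x)) phi = J f (fun z => phi (z - x));
  lf_hom : forall f t phi, convexf f -> 0 <= t -> testfun phi ->
    J (fun x => t * f x) phi = t ^+ k * J f phi }.

Lemma shift_continuous (x : V) : continuous (fun z : V => z + x).
Proof. by move=> z; apply: (@cvgD _ _ _ (nbhs z)); [exact: cvg_id|exact: cvg_cst]. Qed.

Lemma convexf_shift (f : V -> R) x : convexf f -> convexf (fun z => f (z + x)).
Proof.
move=> cf y z t t01; have := cf (y + x) (z + x) t t01.
by rewrite !scalerDr addrACA -scalerDl addrC (addrC t) subrK scale1r addrC.
Qed.

Lemma rcint_null (nu : set V -> R) phi c : rrad nu -> testfun phi ->
  rcint (fun B => c * nu B) phi = c * rcint nu phi.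
Proof.
move=> rn tphi; have [_ /(_ phi tphi)] := rrad_lincomb c 0 rn rn.
by rewrite mul0r addr0 => <-; congr rcint; apply/funext => B; rewrite mul0r addr0.
Qed.

Lemma lfun_of_rMAVal k P : rMAVal k P -> lfun k (fun f phi => rcint (P f) phi).
Proof.
move=> [p1 [p2 [p3 [p4 [p5 [p6 [p7 p8]]]]]]]; split.
- move=> f /p2[m0 [m1 d]]; exists m0, m1; have [l0 l1 _ _] := d; split => // phi tphi.
  exact: rcintE.
- by move=> f_ f phi c1 c2 lu tphi; exact: p3.
- by move=> f y c phi cf tphi; rewrite p5.
- move=> f h U phi oU cf ch e tphi hU; apply: (@rrad_local _ _ U) => //; [exact: p2|exact: p2|].
  by move=> B bB; exact: p6.
- move=> f x phi cf tphi.
  have [_ H] := rrad_push (@shift_continuous (- x)) (@shift_continuous x)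
    (fun z => subrK x z) (fun z => addrK x z) (p2 _ cf).
  rewrite -H//; apply: congr2 => //; apply/funext => B.
  have [bB|nB] := pselect (bborel B); first exact: p7.
  have [m0 [m1 [_ _ _ ->//]]] := p2 _ (convexf_shift x cf).
  have [m0' [m1' [_ _ _ ->//]]] := p2 _ cf.
  rewrite (image_inv _ (fun z => subrK x z) (fun z => addrK x z)) => bB; apply: nB.
  have -> : B = (fun z => z + x) @^-1` ((fun z => z - x) @^-1` B).
    by apply/funext => z /=; rewrite addrK.
  apply: bborel_preimage => //; first exact: shift_continuous.
  move=> r; exists (r + `|x|) => z zr; rewrite -[z](addrK x) (le_trans (ler_normB _ _))//.
  by rewrite lerD2r.
- by move=> f t phi cf t0 tphi; rewrite p8// rcint_null//; exact: p2.
Qed.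

End RealMAVal.

(** * Convex functions *)

Lemma inv_small (R : realType) (K e : R) : 0 < e ->
  exists N : nat, forall j, (N <= j)%N -> K / j.+1%:R < e.
Proof.
move=> e0; have [N hN] := natr_unbounded (K / e); exists N => j Nj.
rewrite ltr_pdivrMr// mulrC -ltr_pdivrMr// (lt_le_trans hN)// ler_nat.
exact: leq_trans Nj _.
Qed.

Section Convex.
Variables (R : realType) (n : nat).
Local Notation V := 'rV[R]_n.
Implicit Types f g : V -> R.

Definition conv1 (p : R -> R) : Prop := forall s t u : R, 0 <= u <= 1 ->
  p (u * s + (1 - u) * t) <= u * p s + (1 - u) * p t.

Lemma convexfD f g : convexf f -> convexf g -> convexf (fun x => f x + g x).
Proof. by move=> cf cg x y t t01; have := cf x y t t01; have := cg x y t t01; lra. Qed.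

Lemma convexfZ f c : 0 <= c -> convexf f -> convexf (fun x => c * f x).
Proof. by move=> c0 cf x y t t01; have := cf x y t t01; nra. Qed.

Lemma convexf_cst c : convexf (fun _ : V => c).
Proof. by move=> x y t t01; lra. Qed.

Lemma convexf_aff (y : V) c : convexf (fun x => dotp y x + c).
Proof. by move=> x z t t01; rewrite dotpDr !dotpZr; lra. Qed.

Lemma convexf_ridge (v : V) p : conv1 p -> convexf (fun x => p (dotp v x)).
Proof. by move=> cp x y t t01; rewrite dotpDr !dotpZr; exact: cp. Qed.

Lemma convexf_sum (I : Type) (r : seq I) (F : I -> V -> R) :
  (forall i, convexf (F i)) -> convexf (fun x => \sum_(i <- r) F i x).
Proof.
move=> cF; elim: r => [|i r IH].
  by under eq_fun do rewrite big_nil; exact: convexf_cst.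
under eq_fun do rewrite big_cons; exact: convexfD.
Qed.

Lemma convexf_max f g : convexf f -> convexf g -> convexf (fun x => Num.max (f x) (g x)).
Proof.
move=> cf cg x y t t01; have h1 := cf x y t t01; have h2 := cg x y t t01.
by rewrite /Num.max; do 3 case: ltrP => ?; nra.
Qed.

Lemma convexf_avg f (m : nat) (x : 'I_m -> V) : convexf f -> (0 < m)%N ->
  f (m%:R^-1 *: \sum_(i < m) x i) <= m%:R^-1 * \sum_(i < m) f (x i).
Proof.
case: m x => // m x cf _; elim: m x => [|m IH] x.
  by rewrite !big_ord1 invr1 scale1r mul1r.
rewrite !(big_ord_recr m.+1)/=.
set S := \sum_(i < m.+1) x _; set T := \sum_(i < m.+1) f _.
have h : f (m.+1%:R^-1 *: S) <= m.+1%:R^-1 * T := IH _.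
have m1 : m.+1%:R > 0 :> R by [].
have m2 : m.+2%:R = m.+1%:R + 1 :> R by rewrite -natr1.
set a := m.+1%:R in m1 m2 h *.
have t01 : 0 <= a / (a + 1) <= 1.
  apply/andP; split; first by rewrite divr_ge0 ?addr_ge0 ?ltW.
  by rewrite ler_pdivrMr ?mul1r ?lerDl// addr_gt0.
have := cf (a^-1 *: S) (x ord_max) _ t01.
have e1 : 1 - a / (a + 1) = (a + 1)^-1 by field; lra.
rewrite e1 m2 scalerA [a / (a + 1) * a^-1](_ : _ = (a + 1)^-1); last by field; lra.
rewrite -scalerDr => /le_trans; apply; rewrite mulrDr lerD2r.
have -> : (a + 1)^-1 * T = a / (a + 1) * (a^-1 * T) by field; lra.
by apply: ler_wpM2l => //; case/andP: t01.
Qed.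

(** [x] is the mean of the points [n x_i e_i], each on the segment from [- s e_i] to [s e_i], so
    [f x] is at most the mean of the larger end values. *)
Lemma convexf_ubound f r : convexf f -> exists M, forall x, `|x| <= r -> f x <= M.
Proof.
move=> cf; have [n0|n0] := posnP n.
  exists (f 0) => x _; suff -> : x = 0 by [].
  by apply/rowP => i; have := ltn_ord i; rewrite {2}n0.
pose s := n%:R * (`|r| + 1).
have n1 : 0 < n%:R :> R by rewrite ltr0n.
have s0 : 0 < s by rewrite mulr_gt0// ltr_pwDr.
pose p i : V := s *: delta_mx ord0 i.
exists (n%:R^-1 * \sum_(i < n) Num.max (f (p i)) (f (- p i))) => x xr.
have xE : x = n%:R^-1 *: \sum_(i < n) (n%:R * x ord0 i) *: delta_mx ord0 i.
  rewrite scaler_sumr [LHS]row_sum_delta; apply: eq_bigr => i _.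
  by rewrite scalerA mulrA mulVf ?mul1r// gt_eqF.
rewrite {1}xE; apply: le_trans (convexf_avg _ cf n0) _.
apply: ler_wpM2l; first by rewrite invr_ge0 ltW.
apply: ler_sum => i _.
(* Position of [n x_i] on the segment from [- s] to [s]. *)
pose t := (n%:R * x ord0 i / s + 1) / 2.
have xs : `|n%:R * x ord0 i / s| <= 1.
  rewrite normrM normfV (gtr0_norm s0) ler_pdivrMr// mul1r normrM (gtr0_norm n1) ler_pM2l//.
  rewrite (le_trans (norm_coord _ _))// (le_trans xr)// (le_trans (ler_norm r))// lerDl//.
have t01 : 0 <= t <= 1 by move: xs; rewrite ler_norml /t => /andP[? ?]; apply/andP; split; lra.
have := cf (p i) (- p i) t t01.
have -> : t *: p i + (1 - t) *: - p i = (n%:R * x ord0 i) *: delta_mx ord0 i.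
  rewrite scalerN -scalerBl /p scalerA; congr (_ *: _); rewrite /t.
  by field; rewrite gt_eqF.
move=> /le_trans; apply; rewrite /Num.max; case/andP: t01 => t0 t1.
by case: ltrP => h; nra.
Qed.

(** The lower bound comes from the midpoint 0: [2 f(0) <= f(x) + f(-x)], where [f(-x)] is bounded
    above. *)
Lemma convexf_bound f r : convexf f -> exists2 M, 0 <= M & forall x, `|x| <= r -> `|f x| <= M.
Proof.
move=> cf; have [M hM] := convexf_ubound r cf.
exists (`|M| + 2 * `|f 0|); first by rewrite addr_ge0// mulr_ge0.
move=> x xr; have h1 := hM _ xr; have h2 : f (- x) <= M by apply: hM; rewrite normrN.
have half01 : 0 <= (1 / 2 : R) <= 1 by apply/andP; split; lra.
have := cf x (- x) (1 / 2) half01.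
rewrite (_ : 1 - 1 / 2 = 1 / 2); last by lra.
rewrite scalerN subrr => h3; have h4 := ler_norm M; have h5 := ler_norm (f 0); have h6 := ler_norm (- f 0).
rewrite normrN in h6; have h7 := normr_ge0 (f 0).
by rewrite ler_norml; apply/andP; split; lra.
Qed.

(** The segment from [x] to [y] is prolonged by length 1 to [z]. Convexity at [y], with values
    between [- M] and [M] on the ball of radius [r + 1], bounds the slope by [2 M]. *)
Lemma convexf_lipschitz f r : convexf f ->
  exists2 C, 0 <= C & forall x y, `|x| <= r -> `|y| <= r -> `|f x - f y| <= C * `|x - y|.
Proof.
move=> cf; have [M M0 hM] := convexf_bound (r + 1) cf.
exists (2 * M); first by rewrite mulr_ge0.
suff H x y : `|x| <= r -> `|y| <= r -> f y - f x <= 2 * M * `|x - y|.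
  move=> x y xr yr; have h1 := H x y xr yr; have h2 := H y x yr xr.
  by rewrite distrC in h2; rewrite ler_norml; apply/andP; split; lra.
move=> xr yr; have [->|xy] := eqVneq x y; first by rewrite !subrr normr0 mulr0.
set d := `|x - y|; have d0 : 0 < d by rewrite normr_gt0 subr_eq0.
pose z := y + d^-1 *: (y - x).
have zr : `|z| <= r + 1.
  rewrite (le_trans (ler_normD _ _))// lerD// normrZ normfV gtr0_norm// distrC mulVf//.
  by rewrite gt_eqF.
have t01 : 0 <= (1 + d)^-1 <= 1.
  by rewrite invr_ge0 addr_ge0 ?(ltW d0)//= invf_le1 ?lerDl ?(ltW d0)// addr_gt0.
have := cf x z _ t01.
have -> : (1 + d)^-1 *: x + (1 - (1 + d)^-1) *: z = y.
  apply/rowP => i; rewrite !mxE; field; apply/andP; split; lra.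
have := hM _ zr; have : `|f x| <= M by apply: hM; rewrite (le_trans xr)// lerDl.
rewrite !ler_norml => /andP[h1 h2] /andP[h3 h4] h5.
have e1 : 1 - (1 + d)^-1 = d * (1 + d)^-1 by field; lra.
rewrite e1 in h5; case/andP: t01 => t0 t1; set t := (1 + d)^-1 in t0 t1 h5 e1.
have e2 : f y - f x <= d * t * (f z - f x).
  have : t * f x = f x - d * t * f x by rewrite -e1; ring.
  by lra.
apply: (le_trans e2); have : t * (f z - f x) <= 2 * M by nra.
by have := ltW d0; nra.
Qed.

Lemma convexf_continuous f : convexf f -> continuous f.
Proof.
move=> cf x; apply/(@cvgrPdist_lt _ _ _ (nbhs x)) => e e0.
have [C C0 hC] := convexf_lipschitz (`|x| + 1) cf.
have C1 : 0 < C + 1 by rewrite ltr_pwDr.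
near=> y.
have xy : `|x - y| < Num.min 1 (e / (C + 1)).
  near: y; apply/nbhs_ballP; exists (Num.min 1 (e / (C + 1))) => /=.
    by rewrite lt_min ltr01 divr_gt0.
  by move=> y; rewrite mx_norm_ball.
move: xy; rewrite lt_min => /andP[xy1 xy2].
apply: (@le_lt_trans _ _ (C * `|x - y|)).
  apply: hC; first by rewrite lerDl.
  have -> : y = x - (x - y) by rewrite subKr.
  by rewrite (le_trans (ler_normB _ _))// lerD2l ltW.
apply: (@le_lt_trans _ _ ((C + 1) * `|x - y|)); first by rewrite ler_wpM2r// lerDl.
by rewrite mulrC -ltr_pdivlMr.
Unshelve. all: by end_near. Qed.

End Convex.

(** * Locally uniform convergence *)

Section LU.
Variables (R : realType) (n : nat).
Local Notation V := 'rV[R]_n.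
Implicit Types f g : V -> R.

Lemma lu_cst f : lu_cvg (fun _ => f) f.
Proof. by move=> r e e0; exists 0%N => j _ x _; rewrite subrr normr0. Qed.

Lemma lu_cvgD (f_ : nat -> V -> R) f (g_ : nat -> V -> R) g : lu_cvg f_ f -> lu_cvg g_ g ->
  lu_cvg (fun j x => f_ j x + g_ j x) (fun x => f x + g x).
Proof.
move=> hf hg r e e0; have e2 : 0 < e / 2 by rewrite divr_gt0.
have [N1 h1] := hf r _ e2; have [N2 h2] := hg r _ e2.
exists (maxn N1 N2) => j; rewrite geq_max => /andP[/h1 j1 /h2 j2] x xr.
rewrite opprD addrACA (le_lt_trans (ler_normD _ _))//.
by have := j1 x xr; have := j2 x xr; lra.
Qed.

Lemma lu_ext (f_ f_' : nat -> V -> R) f f' : (forall j x, f_ j x = f_' j x) ->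
  (forall x, f x = f' x) -> lu_cvg f_ f -> lu_cvg f_' f'.
Proof.
move=> e1 e2; suff -> : f_ = f_' by suff -> : f = f' by []; exact/funext.
by apply/funext => j; exact/funext.
Qed.

Lemma lu_cvg_sum (I : Type) (r : seq I) (F_ : nat -> I -> V -> R) (F : I -> V -> R) :
  (forall i, lu_cvg (fun j => F_ j i) (F i)) ->
  lu_cvg (fun j x => \sum_(i <- r) F_ j i x) (fun x => \sum_(i <- r) F i x).
Proof.
move=> h; elim: r => [|i r IH].
  by apply: (lu_ext _ _ (@lu_cst (fun _ => 0))) => *; rewrite big_nil.
by apply: (lu_ext _ _ (lu_cvgD (h i) IH)) => *; rewrite big_cons.
Qed.

Lemma lu_cvg_rate (f_ : nat -> V -> R) f : (forall r, exists (K : R) (N : nat), forall j, (N <= j)%N ->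
    forall x, `|x| <= r -> `|f_ j x - f x| <= K / j.+1%:R) -> lu_cvg f_ f.
Proof.
move=> h r e e0; have [K [N hN]] := h r; have [N' hN'] := inv_small K e0.
exists (maxn N N') => j; rewrite geq_max => /andP[/hN j1 /hN' j2] x xr.
exact: le_lt_trans (j1 x xr) j2.
Qed.

Lemma lu_cvgZ (t_ : nat -> R) (t : R) g : continuous g -> t_ @ \oo --> t ->
  lu_cvg (fun j x => t_ j * g x) (fun x => t * g x).
Proof.
move=> cg ht r e e0; have [M M0 hM] := continuous_bounded r cg.
have e1 : 0 < e / (M + 1) by rewrite divr_gt0// ltr_pwDr.
move/cvgrPdist_lt : ht => /(_ _ e1)[N _ hN]; exists N => j /hN /= hj x xr.
rewrite -mulrBl normrM distrC.
apply: (@le_lt_trans _ _ (`|t - t_ j| * (M + 1))).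
  by rewrite ler_wpM2l// (le_trans (hM x xr))// lerDl.
by rewrite -ltr_pdivlMr// ltr_pwDr.
Qed.

Definition lu1 (p_ : nat -> R -> R) (p : R -> R) : Prop :=
  forall r e : R, 0 < e -> exists N : nat, forall j, (N <= j)%N ->
    forall s : R, `|s| <= r -> `|p_ j s - p s| < e.

Lemma lu_ridge (v : V) (p_ : nat -> R -> R) p : lu1 p_ p ->
  lu_cvg (fun j x => p_ j (dotp v x)) (fun x => p (dotp v x)).
Proof.
move=> h r e e0; have [N hN] := h (dotn v * r) e e0; exists N => j /hN hj x xr.
by apply: hj; rewrite (le_trans (dotp_le v x))// ler_wpM2l// dotn_ge0.
Qed.

End LU.

(** * Convex functions of one variable and piecewise linear interpolation *)

Section OneDim.
Variable R : realType.
Implicit Types p : R -> R.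

Lemma conv1_lipschitz p r : conv1 p ->
  exists2 C, 0 <= C & forall s t, `|s| <= r -> `|t| <= r -> `|p s - p t| <= C * `|s - t|.
Proof.
move=> cp; pose e (s : R) : 'rV[R]_1 := const_mx s.
have d s : dotp (const_mx 1) (e s) = s by rewrite /dotp big_ord1 !mxE mul1r.
have ne s : `|e s| = `|s|.
  apply/le_anti; rewrite norm_le_coord//=; last by move=> i; rewrite mxE.
  by have := norm_coord (e s) ord0; rewrite mxE.
have [C C0 hC] := convexf_lipschitz r (convexf_ridge (const_mx 1 : 'rV[R]_1) cp).
exists C => // s t sr tr; have := hC (e s) (e t); rewrite !d !ne => /(_ sr tr).
rewrite (_ : e s - e t = e (s - t)) ?ne//.
by apply/rowP => i; rewrite !mxE.
Qed.

(** The pairs in [l] are (slope increment, break point); nonnegative increments make the function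
    convex. *)
Definition pl (a b : R) (l : seq (R * R)) (s : R) : R :=
  a * s + b + \sum_(q <- l) q.1 * Num.max 0 (s - q.2).

Lemma pl_rcons a b l q s : pl a b (rcons l q) s = pl a b l s + q.1 * Num.max 0 (s - q.2).
Proof. by rewrite /pl -cats1 big_cat/= big_seq1 addrA. Qed.

Lemma conv1_slopes p s h : conv1 p -> 0 < h -> p (s + h) - p s <= p (s + h + h) - p (s + h).
Proof.
move=> cp h0; have h01 : 0 <= (1 / 2 : R) <= 1 by apply/andP; split; lra.
have := cp s (s + h + h) (1 / 2) h01.
rewrite (_ : 1 / 2 * s + _ = s + h); last by field.
by lra.
Qed.

(** Knots at [s0 + i h] for [1 <= i <= m], the increment being the jump between neighbouring chord
    slopes of [p]; [pl_interp] then interpolates [p] at [s0, ..., s0 + (m + 1) h]. *)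
Fixpoint pl_list (p : R -> R) (s0 h : R) (m : nat) : seq (R * R) :=
  if m is m'.+1 then rcons (pl_list p s0 h m')
     ((p (s0 + m.+1%:R * h) - p (s0 + m%:R * h) - (p (s0 + m%:R * h) - p (s0 + m'%:R * h))) / h,
       s0 + m%:R * h)
  else [::].

Definition pl_interp p s0 h m s :=
  pl ((p (s0 + h) - p s0) / h) (p s0 - (p (s0 + h) - p s0) / h * s0) (pl_list p s0 h m) s.

(** Beyond the last knot the interpolant continues the last chord; each induction step adds one
    slope jump. *)
Lemma pl_interp_right p s0 h m s : 0 < h -> s0 + m%:R * h <= s ->
  pl_interp p s0 h m s =
  p (s0 + m%:R * h) + (p (s0 + m.+1%:R * h) - p (s0 + m%:R * h)) / h * (s - (s0 + m%:R * h)).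
Proof.
move=> h0; elim: m => [|m IH] hs.
  by rewrite /pl_interp/= /pl big_nil mul0r !addr0 mul1r; field; rewrite gt_eqF.
have hm : s0 + m%:R * h <= s by rewrite (le_trans _ hs)// lerD2l ler_pM2r// ler_nat.
rewrite /pl_interp /= pl_rcons -/(pl_interp p s0 h m s) IH//= max_r ?subr_ge0//.
have e : m.+1%:R = m%:R + 1 :> R by rewrite -natr1.
by rewrite e; field; rewrite gt_eqF.
Qed.

(** The additional hinges break further to the right and vanish at [s]. *)
Lemma pl_interp_left p s0 h m d s : 0 < h -> s <= s0 + m.+1%:R * h ->
  pl_interp p s0 h (m + d) s = pl_interp p s0 h m s.
Proof.
move=> h0 hs; elim: d => [|d IH]; first by rewrite addn0.
rewrite addnS /pl_interp /= pl_rcons -/(pl_interp p s0 h (m + d) s) IH /= max_l ?mulr0 ?addr0//.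
by rewrite subr_le0 (le_trans hs)// lerD2l ler_pM2r// ler_nat ltnS leq_addr.
Qed.

Lemma pl_list_ge0 p s0 h m : conv1 p -> 0 < h -> all (fun q => 0 <= q.1) (pl_list p s0 h m).
Proof.
move=> cp h0; elim: m => //= m IH; rewrite all_rcons IH andbT /=.
apply: divr_ge0; last exact: ltW.
have := conv1_slopes (s0 + m%:R * h) cp h0.
have e : m.+1%:R = m%:R + 1 :> R by rewrite -natr1.
have e' : m.+2%:R = m%:R + 1 + 1 :> R by rewrite -natr1 e.
by rewrite e e' !mulrDl mul1r !addrA; lra.
Qed.

(** Interpolation on a grid of mesh [1 / (j + 1)] over [[-j, j]] has error at most [2 C] times the
    mesh, with [C] a Lipschitz constant near the point. *)
Lemma conv1_pl p : conv1 p -> exists (a b : nat -> R) (l : nat -> seq (R * R)),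
  (forall j, all (fun q => 0 <= q.1) (l j)) /\ lu1 (fun j => pl (a j) (b j) (l j)) p.
Proof.
move=> cp; pose h (j : nat) : R := j.+1%:R^-1.
have h0 j : 0 < h j by rewrite invr_gt0.
pose s0 (j : nat) : R := - j%:R.
(* So many steps of length [1 / (j + 1)] lead from [- j] to [j]. *)
pose m (j : nat) := (2 * j * j.+1)%N.
exists (fun j => (p (s0 j + h j) - p (s0 j)) / h j),
  (fun j => p (s0 j) - (p (s0 j + h j) - p (s0 j)) / h j * s0 j),
  (fun j => pl_list p (s0 j) (h j) (m j)).
split; first by move=> j; exact: pl_list_ge0.
move=> r e e0.
have [C C0 hC] := conv1_lipschitz (`|r| + 1) cp.
have [N hN] := inv_small (2 * C) e0.
have [N' hN'] := natr_unbounded (`|r| + 1).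
exists (maxn N N') => j; rewrite geq_max => /andP[/hN hj N'j] s sr.
rewrite -/(pl_interp p (s0 j) (h j) (m j) s).
have rj : `|r| + 1 <= j%:R by rewrite (le_trans (ltW hN'))// ler_nat.
have sr' : `|s| <= `|r| by rewrite (le_trans sr)// ler_norm.
have [s1 s2] : - `|r| <= s /\ s <= `|r| by move: sr'; rewrite ler_norml => /andP[].
have x0 : 0 <= (s + j%:R) * j.+1%:R by rewrite mulr_ge0//; lra.
(* Index of the grid cell that contains [s]. *)
pose i := Num.trunc ((s + j%:R) * j.+1%:R).
have /andP[i1 i2] := truncn_itv x0.
rewrite -/i in i1 i2.
have hE : h j * j.+1%:R = 1 by rewrite mulVf// pnatr_eq0.
have i1' : s0 j + i%:R * h j <= s.
  have : i%:R * h j <= s + j%:R.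
    by rewrite -(ler_pM2r (ltr0Sn R j)) -mulrA hE mulr1.
  by rewrite /s0; lra.
have i2' : s < s0 j + i.+1%:R * h j.
  have : s + j%:R < i.+1%:R * h j.
    by rewrite -(ltr_pM2r (ltr0Sn R j)) -mulrA hE mulr1.
  by rewrite /s0; lra.
have im : (i <= m j)%N.
  rewrite -(ler_nat R) (le_trans i1)// /m natrM ler_pM2r// natrM.
  by lra.
rewrite -(subnKC im) pl_interp_left ?ltW// pl_interp_right//.
have e1 : i.+1%:R = i%:R + 1 :> R by rewrite -natr1.
rewrite e1 mulrDl mul1r addrA in i2' *.
set y := s0 j + i%:R * h j in i1' i2' *.
have h1 : h j <= 1 by rewrite invf_le1// ler1n.
have yr : `|y| <= `|r| + 1 by rewrite ler_norml; apply/andP; split; lra.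
have yr' : `|y + h j| <= `|r| + 1 by rewrite ler_norml; apply/andP; split; have := h0 j; lra.
have sr1 : `|s| <= `|r| + 1 by rewrite (le_trans sr')// lerDl.
have c1 := hC _ _ yr sr1; have c2 := hC _ _ yr' yr.
rewrite (_ : y + h j - y = h j) ?(gtr0_norm (h0 j)) in c2; last by ring.
have c3 : `|y - s| <= h j by rewrite ler_norml; apply/andP; split; lra.
have c4 : `|p y - p s| <= C * h j by apply: le_trans c1 _; exact: ler_wpM2l.
have c5 : `|(p (y + h j) - p y) / h j * (s - y)| <= C * h j.
  rewrite normrM; apply: ler_pM => //; last by rewrite distrC.
  by rewrite normrM normfV (gtr0_norm (h0 j)) ler_pdivrMr.
rewrite addrAC (le_lt_trans (ler_normD _ _))//.
apply: le_lt_trans (lerD c4 c5) _.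
by move: hj; rewrite -/(h j); lra.
Qed.

End OneDim.

(** * Hinges and ridge sums *)

Section Sequences.
Variable R : realType.
Implicit Types u v : nat -> R.

Lemma seq_cvgD u v (a b : R) : u @ \oo --> a -> v @ \oo --> b -> (fun j => u j + v j) @ \oo --> a + b.
Proof. by move=> *; apply: cvgD. Qed.
Lemma seq_cvgM u v (a b : R) : u @ \oo --> a -> v @ \oo --> b -> (fun j => u j * v j) @ \oo --> a * b.
Proof. by move=> *; apply: cvgM. Qed.
Lemma seq_cvg_cst (a : R) : (fun _ : nat => a) @ \oo --> a.
Proof. exact: cvg_cst. Qed.
Arguments seq_cvg_cst : clear implicits.
Lemma seq_lim_eq u v (a b : R) : u @ \oo --> a -> v @ \oo --> b -> (forall j, u j = v j) -> a = b.
Proof. by move=> ua vb /funext e; rewrite e in ua; apply: (cvg_unique _ ua vb). Qed.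
Lemma seq_lim_ge u (a b : R) : u @ \oo --> a -> (forall j, b <= u j) -> b <= a.
Proof. by move=> ua h; apply: (ler_cvg_to (seq_cvg_cst b) ua); apply: nearW. Qed.

End Sequences.
Arguments seq_cvg_cst {R} a.

(** Jensen's functional equation on the half-line: [g - g 0] is additive, hence linear on rationals,
    and sequential continuity gives the rest. The approximants [t_ j] are rounded down multiples of
    [1 / (j + 1)], so they stay in the half-line. *)
Lemma cauchy_nonneg (R : realType) (g : R -> R) :
  (forall a b, 0 <= a -> 0 <= b -> g (a + b) + g 0 = g a + g b) ->
  (forall (t_ : nat -> R) t, (forall j, 0 <= t_ j) -> t_ @ \oo --> t ->
     (fun j => g (t_ j)) @ \oo --> g t) ->
  forall t, 0 <= t -> g t = g 0 + t * (g 1 - g 0).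
Proof.
move=> gA gc t t0.
have mulg (m : nat) a : 0 <= a -> g (m%:R * a) - g 0 = m%:R * (g a - g 0).
  move=> a0; elim: m => [|m IH]; first by rewrite !mul0r subrr.
  have := gA (m%:R * a) a (mulr_ge0 (ler0n _ _) a0) a0.
  by rewrite -natr1 !mulrDl !mul1r -IH; lra.
pose t_ (j : nat) : R := (Num.trunc (t * j.+1%:R))%:R / j.+1%:R.
have t_0 j : 0 <= t_ j by rewrite divr_ge0.
have tj j : `|t - t_ j| <= 1 / j.+1%:R.
  have /andP[h1 h2] := truncn_itv (mulr_ge0 t0 (ler0n R j.+1)).
  set i := Num.trunc _ in h1 h2; rewrite -natr1 in h2.
  have -> : t - t_ j = (t * j.+1%:R - i%:R) / j.+1%:R.
    by rewrite /t_ -/i; field; rewrite addr_eq0 gt_eqF// (@lt_le_trans _ _ 0) ?oppr_lt0.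
  rewrite normrM [X in _ * X]ger0_norm// ler_pM2r ?invr_gt0//.
  by rewrite ler_norml; apply/andP; split; lra.
have lt : t_ @ \oo --> t.
  apply/cvgrPdist_lt => e e0; have [N hN] := inv_small 1 e0.
  by exists N => // j /= /hN; exact: le_lt_trans.
have gt j : g (t_ j) = g 0 + t_ j * (g 1 - g 0).
  have h1 := mulg (Num.trunc (t * j.+1%:R)) j.+1%:R^-1; rewrite invr_ge0 ler0n in h1.
  have {h1} := h1 isT; rewrite -/(t_ j) => h1.
  have := mulg j.+1 j.+1%:R^-1; rewrite invr_ge0 ler0n => /(_ isT).
  rewrite mulfV ?pnatr_eq0// => h2; rewrite h2 mulrA /t_ divfK ?pnatr_eq0//.
  by rewrite -h1; ring.
have l1 := gc _ _ t_0 lt.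
have l2 : (fun j => g (t_ j)) @ \oo --> g 0 + t * (g 1 - g 0).
  under eq_fun do rewrite gt.
  by apply: cvgD; [exact: cvg_cst|apply: cvgM => //; exact: cvg_cst].
exact: (cvg_unique _ l1 l2).
Qed.

Section Hinge.
Variables (R : realType) (n : nat) (k : nat).
Local Notation V := 'rV[R]_n.
Variable J : (V -> R) -> (V -> R) -> R.
Hypothesis lJ : lfun k J.
Implicit Types f g z phi : V -> R.

Lemma lf_addphi f phi psi : convexf f -> testfun phi -> testfun psi ->
  J f (fun x => phi x + psi x) = J f phi + J f psi.
Proof.
move=> cf tp tq; have [m0 [m1 [l0 l1 h]]] := lf_rep lJ cf.
by rewrite !h ?rintD//; [ring|exact: testfunD].
Qed.

Lemma lf_scalephi f phi c : convexf f -> testfun phi ->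
  J f (fun x => c * phi x) = c * J f phi.
Proof.
move=> cf tp; have [m0 [m1 [l0 l1 h]]] := lf_rep lJ cf.
by rewrite !h ?rintZ//; [ring|exact: testfunZ].
Qed.

Lemma lf_local_aff f g y c (U : set V) phi : open U -> convexf f -> convexf g ->
  (forall x, U x -> f x = g x + (dotp y x + c)) -> testfun phi ->
  (forall x, phi x != 0 -> U x) -> J f phi = J g phi.
Proof.
move=> oU cf cg e tp hU; rewrite -(lf_aff lJ y c cg tp); apply: (lf_loc lJ oU) => //.
by apply: convexfD => //; exact: convexf_aff.
Qed.

Definition hinge (v : V) (c : R) (x : V) : R := Num.max 0 (dotp v x - c).

Lemma convexf_hinge v c : convexf (hinge v c).
Proof.
apply: convexf_max; first exact: convexf_cst.
exact: (convexf_aff v (- c)).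
Qed.

Lemma hinge_convexD f v c a : convexf f -> 0 <= a -> convexf (fun x => f x + a * hinge v c x).
Proof. by move=> cf a0; apply: convexfD => //; apply: convexfZ => //; exact: convexf_hinge. Qed.

(* The hinges break along two disjoint hyperplanes, so on each of two covering
   half-spaces one of them is affine. *)
Lemma hinge_add_lt f v c1 c2 a b phi : convexf f -> testfun phi -> 0 <= a -> 0 <= b -> c1 < c2 ->
  J (fun x => f x + a * hinge v c1 x + b * hinge v c2 x) phi + J f phi =
  J (fun x => f x + a * hinge v c1 x) phi + J (fun x => f x + b * hinge v c2 x) phi.
Proof.
move=> cf tp a0 b0 c12.
pose chi (x : V) : R := Num.min 1 (Num.max 0 ((c2 - c1)^-1 * (c2 - dotp v x))).
have cchi : continuous chi.
  apply: cont_min; first exact: cont_cst.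
  apply: cont_max; first exact: cont_cst.
  by apply: contZ; apply: contB; [exact: cont_cst|exact: dotp_continuous].
pose p1 x := phi x * chi x; pose p2 x := phi x * (1 - chi x).
have tp1 : testfun p1 by exact: testfunM.
have tp2 : testfun p2 by apply: testfunM => //; apply: contB => //; exact: cont_cst.
have d0 : 0 < (c2 - c1)^-1 by rewrite invr_gt0 subr_gt0.
pose U1 := [set x | dotp v x < c2]; pose U2 := [set x | c1 < dotp v x].
have oU1 : open U1.
  by apply: (@open_comp _ _ (dotp v) [set y | y < c2]); [move=> x _; exact: dotp_continuous|exact: open_lt].
have oU2 : open U2.
  by apply: (@open_comp _ _ (dotp v) [set y | c1 < y]); [move=> x _; exact: dotp_continuous|exact: open_gt].
have pU1 x : p1 x != 0 -> U1 x.
  rewrite /U1 /= ltNge; apply: contra => h; rewrite /p1 /chi.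
  by rewrite max_l ?min_r ?mulr0// pmulr_rle0// subr_le0.
have pU2 x : p2 x != 0 -> U2 x.
  rewrite /U2 /= ltNge; apply: contra => h; rewrite /p2 /chi.
  have h1 : 1 <= (c2 - c1)^-1 * (c2 - dotp v x).
    by rewrite mulrC ler_pdivlMr ?subr_gt0// mul1r lerD2l lerN2.
  by rewrite max_r ?(le_trans ler01 h1)// min_l// subrr mulr0.
have E g : convexf g -> J g phi = J g p1 + J g p2.
  move=> cg; rewrite -lf_addphi//; congr (J g _); apply/funext => x.
  by rewrite /p1 /p2 -mulrDr addrC subrK mulr1.
have c12f := hinge_convexD v c2 (hinge_convexD v c1 cf a0) b0.
have c1f := hinge_convexD v c1 cf a0; have c2f := hinge_convexD v c2 cf b0.
have e1 : J (fun x => f x + a * hinge v c1 x + b * hinge v c2 x) p1 = J (fun x => f x + a * hinge v c1 x) p1.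
  apply: (lf_loc lJ oU1) => // x /ltW h; rewrite /hinge [in X in b * X]max_l ?mulr0 ?addr0//.
  by rewrite subr_le0.
have e2 : J (fun x => f x + b * hinge v c2 x) p1 = J f p1.
  apply: (lf_loc lJ oU1) => // x /ltW h; rewrite /hinge max_l ?mulr0 ?addr0//.
  by rewrite subr_le0.
have e3 : J (fun x => f x + a * hinge v c1 x + b * hinge v c2 x) p2 = J (fun x => f x + b * hinge v c2 x) p2.
  apply: (@lf_local_aff _ _ (a *: v) (- (a * c1)) U2) => // x /ltW h.
  rewrite [in X in a * X]/hinge max_r ?subr_ge0// dotpZl; ring.
have e4 : J (fun x => f x + a * hinge v c1 x) p2 = J f p2.
  apply: (@lf_local_aff _ _ (a *: v) (- (a * c1)) U2) => // x /ltW h.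
  rewrite [in X in a * X]/hinge max_r ?subr_ge0// dotpZl; ring.
by rewrite !E// e1 e2 e3 e4; ring.
Qed.

Lemma hinge_lip v c c' x : `|hinge v c' x - hinge v c x| <= `|c' - c|.
Proof.
rewrite /hinge /Num.max -[`|c' - c|]distrC.
have h1 := ler_norm (c - c'); have h2 := ler_norm (c' - c); rewrite distrC in h2.
by case: ltrP => ?; case: ltrP => ?; rewrite ler_norml; apply/andP; split; lra.
Qed.

Lemma lu_hinge v c : lu_cvg (fun j => hinge v (c + j.+1%:R^-1)) (hinge v c).
Proof.
apply: lu_cvg_rate => r; exists 1, 0%N => j _ x _.
by rewrite (le_trans (hinge_lip _ _ _ _))// addrAC subrr add0r ger0_norm// div1r.
Qed.

Lemma lu_scale (f_ : nat -> V -> R) f a : lu_cvg f_ f -> lu_cvg (fun j x => a * f_ j x) (fun x => a * f x).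
Proof.
move=> h r e e0; have e1 : 0 < e / (`|a| + 1) by rewrite divr_gt0// ltr_pwDr.
have [N hN] := h r _ e1; exists N => j /hN hj x /hj hx.
rewrite -mulrBr normrM; apply: (@le_lt_trans _ _ ((`|a| + 1) * `|f_ j x - f x|)).
  by rewrite ler_wpM2r// lerDl.
by rewrite mulrC -ltr_pdivlMr// ltr_pwDr.
Qed.

(** Different break points may be ordered; equal ones are separated by [1 / (j + 1)] and continuity
    gives the limit. *)
Lemma hinge_add f v c1 c2 a b phi : convexf f -> testfun phi -> 0 <= a -> 0 <= b ->
  J (fun x => f x + a * hinge v c1 x + b * hinge v c2 x) phi + J f phi =
  J (fun x => f x + a * hinge v c1 x) phi + J (fun x => f x + b * hinge v c2 x) phi.
Proof.
move=> cf tp a0 b0; have [c12|c21|<-] := ltgtP c1 c2; first exact: hinge_add_lt.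
  rewrite [RHS]addrC -hinge_add_lt//; congr (J _ _ + _); apply/funext => x; ring.
have c1f := hinge_convexD v c1 cf a0.
have cj j := hinge_convexD v (c1 + j.+1%:R^-1) cf b0.
have cj2 j := hinge_convexD v (c1 + j.+1%:R^-1) c1f b0.
have l1 := lf_cont lJ cj2 (hinge_convexD v c1 c1f b0)
  (lu_cvgD (@lu_cst _ _ (fun x => f x + a * hinge v c1 x)) (lu_scale b (lu_hinge v c1))) tp.
have l2 := lf_cont lJ cj (hinge_convexD v c1 cf b0)
  (lu_cvgD (@lu_cst _ _ f) (lu_scale b (lu_hinge v c1))) tp.
have l3 := seq_cvgD l1 (seq_cvg_cst (J f phi)).
have l4 := seq_cvgD (seq_cvg_cst (J (fun x => f x + a * hinge v c1 x) phi)) l2.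
apply: (seq_lim_eq l3 l4) => j; apply: hinge_add_lt => //.
by rewrite ltrDl invr_gt0.
Qed.

Definition hsum (v : V) (l : seq (R * R)) (x : V) : R := \sum_(q <- l) q.1 * hinge v q.2 x.

Lemma hsum_rcons v l q x : hsum v (rcons l q) x = hsum v l x + q.1 * hinge v q.2 x.
Proof. by rewrite /hsum -cats1 big_cat big_seq1. Qed.

Lemma convexf_hsum v l : all (fun q => 0 <= q.1) l -> convexf (hsum v l).
Proof.
elim/last_ind: l => [|l q IH]; first by move=> _; rewrite (_ : hsum v [::] = fun _ => 0);
  [exact: convexf_cst|apply/funext => x; rewrite /hsum big_nil].
rewrite all_rcons => /andP[q0 /IH cl]; rewrite (_ : hsum v _ = fun x => hsum v l x + q.1 * hinge v q.2 x).
  exact: hinge_convexD.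
by apply/funext => x; rewrite hsum_rcons.
Qed.

Lemma hsum_hinge_add f v l c b phi : convexf f -> testfun phi -> all (fun q => 0 <= q.1) l -> 0 <= b ->
  J (fun x => f x + hsum v l x + b * hinge v c x) phi + J f phi =
  J (fun x => f x + hsum v l x) phi + J (fun x => f x + b * hinge v c x) phi.
Proof.
move=> cf tp; elim/last_ind: l => [|l q IH].
  move=> _ b0; rewrite addrC; congr (J _ _ + J _ _); apply/funext => x; rewrite /hsum big_nil; ring.
rewrite all_rcons => /andP[q0 l0] b0; have {}IH := IH l0 b0.
have cl : convexf (fun x => f x + hsum v l x) by apply: convexfD => //; exact: convexf_hsum.
have := hinge_add v q.2 c cl tp q0 b0.
have E : (fun x => f x + hsum v (rcons l q) x) = fun x => f x + hsum v l x + q.1 * hinge v q.2 x.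
  by apply/funext => x; rewrite hsum_rcons addrA.
have E' : (fun x => f x + hsum v (rcons l q) x + b * hinge v c x) =
    fun x => f x + hsum v l x + q.1 * hinge v q.2 x + b * hinge v c x.
  by apply/funext => x; rewrite hsum_rcons addrA.
by rewrite E E'; lra.
Qed.

Lemma hsum_add f v l l' phi : convexf f -> testfun phi ->
  all (fun q => 0 <= q.1) l -> all (fun q => 0 <= q.1) l' ->
  J (fun x => f x + hsum v l x + hsum v l' x) phi + J f phi =
  J (fun x => f x + hsum v l x) phi + J (fun x => f x + hsum v l' x) phi.
Proof.
move=> cf tp l0; elim/last_ind: l' => [|l' q IH].
  by move=> _; congr (J _ _ + J _ _); apply/funext => x; rewrite /hsum !big_nil addr0.
rewrite all_rcons => /andP[q0 l0']; have {}IH := IH l0'.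
have cl : convexf (fun x => f x + hsum v l x) by apply: convexfD => //; exact: convexf_hsum.
have h1 := hsum_hinge_add v q.2 cl tp l0' q0.
have h2 := hsum_hinge_add v q.2 cf tp l0' q0.
have h3 := hsum_hinge_add v q.2 cf tp l0 q0.
have E : (fun x => f x + hsum v (rcons l' q) x) = fun x => f x + hsum v l' x + q.1 * hinge v q.2 x.
  by apply/funext => x; rewrite hsum_rcons addrA.
have E' : (fun x => f x + hsum v l x + hsum v (rcons l' q) x) =
    fun x => f x + hsum v l x + hsum v l' x + q.1 * hinge v q.2 x.
  by apply/funext => x; rewrite hsum_rcons addrA.
by rewrite E E'; lra.
Qed.

Lemma pl_hsum a b l v x : pl a b l (dotp v x) = hsum v l x + (dotp (a *: v) x + b).
Proof. by rewrite /pl dotpZl addrC. Qed.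

(** Both profiles are limits of [pl] functions, whose affine part is invisible to [J] and whose
    remainder is a hinge sum. *)
Lemma ridge_add f v p q phi : convexf f -> testfun phi -> conv1 p -> conv1 q ->
  J (fun x => f x + p (dotp v x) + q (dotp v x)) phi + J f phi =
  J (fun x => f x + p (dotp v x)) phi + J (fun x => f x + q (dotp v x)) phi.
Proof.
move=> cf tp cp cq.
have [a [b [l [l0 lup]]]] := conv1_pl cp; have [a' [b' [l' [l0' luq]]]] := conv1_pl cq.
have cr p' : conv1 p' -> convexf (fun x => f x + p' (dotp v x)).
  by move=> cp'; apply: convexfD => //; exact: convexf_ridge.
have ch j : convexf (fun x => f x + hsum v (l j) x) by apply: convexfD => //; exact: convexf_hsum.
have ch' j : convexf (fun x => f x + hsum v (l' j) x) by apply: convexfD => //; exact: convexf_hsum.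
have chh j : convexf (fun x => f x + hsum v (l j) x + hsum v (l' j) x).
  by apply: convexfD => //; exact: convexf_hsum.
have cpl j : convexf (fun x => f x + pl (a j) (b j) (l j) (dotp v x)).
  rewrite (_ : (fun x => _) = fun x => f x + hsum v (l j) x + (dotp (a j *: v) x + b j)).
    by apply: convexfD => //; exact: convexf_aff.
  by apply/funext => x; rewrite pl_hsum addrA.
have cpl' j : convexf (fun x => f x + pl (a' j) (b' j) (l' j) (dotp v x)).
  rewrite (_ : (fun x => _) = fun x => f x + hsum v (l' j) x + (dotp (a' j *: v) x + b' j)).
    by apply: convexfD => //; exact: convexf_aff.
  by apply/funext => x; rewrite pl_hsum addrA.
have Epq j : (fun x => f x + pl (a j) (b j) (l j) (dotp v x) + pl (a' j) (b' j) (l' j) (dotp v x)) =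
   (fun x => f x + hsum v (l j) x + hsum v (l' j) x + (dotp (a j *: v + a' j *: v) x + (b j + b' j))).
  by apply/funext => x; rewrite !pl_hsum dotpDl; ring.
have cplpl j : convexf (fun x => f x + pl (a j) (b j) (l j) (dotp v x) + pl (a' j) (b' j) (l' j) (dotp v x)).
  by rewrite Epq; apply: convexfD => //; exact: convexf_aff.
have cpq : convexf (fun x => f x + p (dotp v x) + q (dotp v x)).
  by apply: convexfD; [exact: cr|exact: convexf_ridge].
have l1 := lf_cont lJ cplpl cpq (lu_cvgD (lu_cvgD (@lu_cst _ _ f) (lu_ridge v lup)) (lu_ridge v luq)) tp.
have l2 := lf_cont lJ cpl (cr _ cp) (lu_cvgD (@lu_cst _ _ f) (lu_ridge v lup)) tp.
have l3 := lf_cont lJ cpl' (cr _ cq) (lu_cvgD (@lu_cst _ _ f) (lu_ridge v luq)) tp.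
have l4 := seq_cvgD l1 (seq_cvg_cst (J f phi)); have l5 := seq_cvgD l2 l3.
apply: (seq_lim_eq l4 l5) => j; rewrite Epq.
rewrite (lf_aff lJ)//.
have -> : (fun x => f x + pl (a j) (b j) (l j) (dotp v x)) =
    fun x => f x + hsum v (l j) x + (dotp (a j *: v) x + b j).
  by apply/funext => x; rewrite pl_hsum addrA.
have -> : (fun x => f x + pl (a' j) (b' j) (l' j) (dotp v x)) =
    fun x => f x + hsum v (l' j) x + (dotp (a' j *: v) x + b' j).
  by apply/funext => x; rewrite pl_hsum addrA.
by rewrite !(lf_aff lJ)//; exact: hsum_add.
Qed.

(** Affine directions. Quantifying over every base function [f] lets one summand of a sum move while
    the others stay fixed. *)
Definition adir z : Prop := convexf z /\ forall f phi t, convexf f -> testfun phi -> 0 <= t ->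
  J (fun x => f x + t * z x) phi = J f phi + t * (J (fun x => f x + z x) phi - J f phi).

(** [ridge_add] is Jensen's equation in the coefficient of the ridge, so [cauchy_nonneg] applies. *)
Lemma adir_ridge v p : conv1 p -> adir (fun x => p (dotp v x)).
Proof.
move=> cp; have cz := convexf_ridge v cp; split => // f phi t cf tp t0.
have cs a : 0 <= a -> conv1 (fun s => a * p s).
  by move=> a0 s u w w01; have := cp s u w w01; nra.
have cfs a : 0 <= a -> convexf (fun x => f x + a * p (dotp v x)).
  by move=> a0; apply: convexfD => //; exact: convexfZ.
(* [Num.max 0 a] makes [g] total without leaving the convex functions. *)
pose g a := J (fun x => f x + Num.max 0 a * p (dotp v x)) phi.
have m0 a : 0 <= a -> Num.max 0 a = a by move=> ?; exact: max_r.
have g0 : g 0 = J f phi.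
  by rewrite /g m0//; congr (J _ _); apply/funext => x; rewrite mul0r addr0.
have g1 : g 1 = J (fun x => f x + p (dotp v x)) phi.
  by rewrite /g m0//; congr (J _ _); apply/funext => x; rewrite mul1r.
have gt : g t = J (fun x => f x + t * p (dotp v x)) phi by rewrite /g m0.
rewrite -gt -g0 -g1; apply: cauchy_nonneg => //.
  move=> a b a0 b0; rewrite g0 /g !m0 ?addr_ge0// -(ridge_add v cf tp (cs _ a0) (cs _ b0)).
  by congr (J _ _ + _); apply/funext => x; ring.
move=> t_ u h0 hl; apply: (lf_cont lJ) => //.
- by move=> j; apply: cfs; rewrite le_max lexx.
- by apply: cfs; rewrite le_max lexx.
- apply: lu_cvgD; first exact: lu_cst.
  apply: lu_cvgZ; first exact: convexf_continuous.
  rewrite max_r; last exact: seq_lim_ge hl h0.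
  by under eq_fun do rewrite max_r//.
Qed.

Lemma adir_scale z c : 0 <= c -> adir z -> adir (fun x => c * z x).
Proof.
move=> c0 [cz h]; split; first exact: convexfZ.
move=> f phi t cf tp t0; rewrite (h f phi c)//.
have -> : (fun x => f x + t * (c * z x)) = fun x => f x + (t * c) * z x by apply/funext => x; rewrite mulrA.
by rewrite h ?mulr_ge0//; ring.
Qed.

End Hinge.

(** * Sums of ridge functions: multi-affinity against homogeneity *)

Section Upd.
Variables (R : realType) (I : finType).
Definition upd (a : I -> R) (i : I) (t : R) : I -> R := fun j => if j == i then t else a j.
Lemma upd_same a i t : upd a i t i = t. Proof. by rewrite /upd eqxx. Qed.
Lemma upd_ge0 a i t : (forall j, 0 <= a j) -> 0 <= t -> forall j, 0 <= upd a i t j.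
Proof. by move=> a0 t0 j; rewrite /upd; case: eqP. Qed.
Lemma upd_upd a i s t : upd (upd a i s) i t = upd a i t.
Proof. by apply/funext => j; rewrite /upd; case: eqP. Qed.
End Upd.

(** Doubling the coordinates of the all-ones point one by one multiplies [G] by [2 ^ m], doubling
    them together by [2 ^ k]. [b j] has the first [j] coordinates doubled. *)
Lemma multi_affine_vanish (R : realType) (m k : nat) (G : ('I_m -> R) -> R) :
  (forall a i, (forall j, 0 <= a j) -> a i = 0 -> G a = 0) ->
  (forall a i t, (forall j, 0 <= a j) -> a i = 0 -> 0 <= t ->
     G (upd a i t) = G a + t * (G (upd a i 1) - G a)) ->
  (forall a t, (forall j, 0 <= a j) -> 0 <= t -> G (fun j => t * a j) = t ^+ k * G a) ->
  m != k -> G (fun _ => 1) = 0.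
Proof.
move=> face aff hom mk.
pose b (j : nat) (i : 'I_m) : R := if (i < j)%N then 2 else 1.
have b0 j i : 0 <= b j i by rewrite /b; case: ifP.
(* [G] vanishes where coordinate [j] is 0, so it is linear in that coordinate. *)
have step (j : 'I_m) : G (b j.+1) = 2 * G (b j).
  pose a := upd (b j) j 0.
  have a0 : forall i, 0 <= a i by exact: upd_ge0.
  have aj : a j = 0 by exact: upd_same.
  have e (t : R) : upd a j t = upd (b j) j t by rewrite /a upd_upd.
  have e1 : b j.+1 = upd a j 2.
    rewrite e; apply/funext => i; rewrite /b /upd -val_eqE /= ltnS leq_eqVlt.
    by case: eqP => [->|].
  have e2 : b j = upd a j 1.
    by rewrite e; apply/funext => i; rewrite /b /upd -val_eqE /=; case: eqP => [->|]; rewrite ?ltnn.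
  by rewrite {1}e1 e2 (aff a j 2)// (face a j)//; lra.
have pow j : (j <= m)%N -> G (b j) = 2 ^+ j * G (b 0%N).
  elim: j => [|j IH] jm; first by rewrite mul1r.
  by rewrite (step (Ordinal jm)) IH ?(ltnW jm)// exprS mulrA.
have e0 : b 0%N = fun=> 1 by apply/funext => i.
have := pow m (leqnn m).
have -> : b m = fun j => 2 * (fun=> 1) j by apply/funext => i; rewrite /b ltn_ord mulr1.
rewrite hom// e0 => /eqP; rewrite -subr_eq0 -mulrBl mulf_eq0 subr_eq0 => /orP[|/eqP//].
rewrite -!natrX eqr_nat => /eqP/(congr1 (logn 2)); rewrite !pfactorK// => e.
by rewrite e eqxx in mk.
Qed.

Section Ridges.
Variables (R : realType) (n : nat) (k : nat).
Local Notation V := 'rV[R]_n.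
Variable J : (V -> R) -> (V -> R) -> R.
Hypothesis lJ : lfun k J.
Local Notation adir := (adir J).

Lemma convexf_sumz (I : Type) (r : seq I) (z : I -> V -> R) (a : I -> R) : (forall i, convexf (z i)) ->
  (forall i, 0 <= a i) -> convexf (fun x => \sum_(i <- r) a i * z i x).
Proof. by move=> cz a0; apply: convexf_sum => i; exact: convexfZ. Qed.

Lemma sum_upd m (z : 'I_m -> V -> R) (a : 'I_m -> R) i t x : a i = 0 ->
  \sum_j upd a i t j * z j x = \sum_j a j * z j x + t * z i x.
Proof.
move=> ai; rewrite (bigD1 i)//= upd_same [in RHS](bigD1 i)//= ai mul0r add0r addrC.
by congr (_ + _); apply: eq_bigr => j /negbTE ji; rewrite /upd ji.
Qed.

Lemma ridges_vanish m (z : 'I_m -> V -> R) phi : testfun phi -> (forall i, adir (z i)) ->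
  (forall (a : 'I_m -> R) i, (forall j, 0 <= a j) -> a i = 0 -> J (fun x => \sum_j a j * z j x) phi = 0) ->
  m != k -> J (fun x => \sum_j z j x) phi = 0.
Proof.
move=> tp az face mk.
have E : (fun x => \sum_j z j x) = fun x => \sum_j (fun _ => 1) j * z j x.
  by apply/funext => x; apply: eq_bigr => j _; rewrite mul1r.
rewrite E; apply: (@multi_affine_vanish R m k (fun a => J (fun x => \sum_j a j * z j x) phi)) => //.
- move=> a i t a0 ai t0.
  have E1 t' : (fun x => \sum_j upd a i t' j * z j x) = fun x => \sum_j a j * z j x + t' * z i x.
    by apply/funext => x; rewrite sum_upd.
  have E2 : (fun x => \sum_j a j * z j x + 1 * z i x) = fun x => \sum_j a j * z j x + z i x.
    by apply/funext => x; rewrite mul1r.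
  rewrite !E1 E2; have [_ h] := az i; apply: h => //; apply: convexf_sumz => // j; by case: (az j).
- move=> a t a0 t0; rewrite -(lf_hom lJ)//.
    by congr (J _ _); apply/funext => x; rewrite mulr_sumr; apply: eq_bigr => j _; rewrite mulrA.
  by apply: convexf_sumz => // j; case: (az j).
Qed.

Lemma sum_face m (z : 'I_m.+1 -> V -> R) (a : 'I_m.+1 -> R) i : a i = 0 ->
  (fun x => \sum_j a j * z j x) = fun x => \sum_j (fun x => a (lift i j) * z (lift i j) x) x.
Proof. by move=> ai; apply/funext => x; rewrite (bigD1_ord i)//= ai mul0r add0r. Qed.

(** Faces are shorter sums, covered by induction; the empty sum is killed by homogeneity at [t = 0],
    as [k > 0]. *)
Lemma ridges_lt m (z : 'I_m -> V -> R) phi : testfun phi -> (forall i, adir (z i)) -> (m < k)%N ->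
  J (fun x => \sum_j z j x) phi = 0.
Proof.
move=> tp; elim: m z => [|m IH] z az mk.
  have := lf_hom lJ (@convexf_cst _ _ 0) (lexx 0) tp.
  under eq_fun do rewrite mul0r; under [in X in _ -> X]eq_fun do rewrite big_ord0.
  by rewrite expr0n gtn_eqF// mul0r.
apply: ridges_vanish => // [a i a0 ai|]; last by rewrite ltn_eqF.
rewrite (sum_face z ai); apply: IH => [j|]; last exact: ltnW.
exact: adir_scale.
Qed.

(** Beyond [k] summands, vanishing of the shorter sums again forces vanishing. The class [Z] is
    stable under scaling because faces carry coefficients. *)
Lemma ridges_gt (Z : (V -> R) -> Prop) phi : testfun phi ->
  (forall z, Z z -> adir z) -> (forall z a, 0 <= a -> Z z -> Z (fun x => a * z x)) ->
  (forall z : 'I_k -> V -> R, (forall i, Z (z i)) -> J (fun x => \sum_j z j x) phi = 0) ->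
  forall m (z : 'I_m -> V -> R), (forall i, Z (z i)) -> J (fun x => \sum_j z j x) phi = 0.
Proof.
move=> tp Za Zs Zk; have Zk' m' : m' = k -> forall z : 'I_m' -> V -> R,
    (forall i, Z (z i)) -> J (fun x => \sum_j z j x) phi = 0.
  by move=> e; rewrite e.
elim=> [|m IH] z Zz.
  have [k0|k0] := eqVneq 0%N k; first exact: Zk'.
  by apply: ridges_lt; rewrite // ?lt0n 1?eq_sym// => i; exact: Za.
have [mk|mk] := eqVneq m.+1 k; first exact: Zk'.
apply: ridges_vanish => // [i|a i a0 ai]; first exact: Za.
by rewrite (sum_face z ai); apply: IH => j; exact: Zs.
Qed.

Lemma cvg_inv_succ : (fun j : nat => j.+1%:R^-1 : R) @ \oo --> (0 : R).
Proof. exact: cvg_harmonic. Qed.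

(* One-sided Gateaux derivative at [f] in the direction of the sum: it is
   additive over the summands, whatever they are. *)
Lemma gateaux (I : Type) (r : seq I) (z : I -> V -> R) f phi : testfun phi -> convexf f ->
  (forall i, adir (z i)) ->
  (fun j => j.+1%:R * (J (fun x => f x + j.+1%:R^-1 * \sum_(i <- r) z i x) phi - J f phi)) @ \oo -->
  \sum_(i <- r) (J (fun x => f x + z i x) phi - J f phi).
Proof.
move=> tp cf az; have cz i : convexf (z i) by case: (az i).
elim: r => [|i r IH].
  rewrite big_nil (_ : (fun j : nat => _) = fun _ => 0); first exact: cvg_cst.
  apply/funext => j; rewrite (_ : (fun x => _) = f) ?subrr ?mulr0//.
  by apply/funext => x; rewrite big_nil mulr0 addr0.
rewrite big_cons.
pose S x := \sum_(i <- r) z i x.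
have cS : convexf S by exact: convexf_sum.
have t0 j : 0 <= (j.+1%:R^-1 : R) by [].
have cfj j : convexf (fun x => f x + j.+1%:R^-1 * S x) by apply: convexfD => //; exact: convexfZ.
have lfj : lu_cvg (fun j x => f x + j.+1%:R^-1 * S x) f.
  apply: (lu_ext _ _ (lu_cvgD (@lu_cst _ _ f) (lu_cvgZ (convexf_continuous cS) cvg_inv_succ))) => // x.
  by rewrite mul0r addr0.
have E j : j.+1%:R * (J (fun x => f x + j.+1%:R^-1 * \sum_(i <- i :: r) z i x) phi - J f phi) =
   (J (fun x => f x + j.+1%:R^-1 * S x + z i x) phi - J (fun x => f x + j.+1%:R^-1 * S x) phi) +
   j.+1%:R * (J (fun x => f x + j.+1%:R^-1 * S x) phi - J f phi).
  have [_ h] := az i; have := h _ phi j.+1%:R^-1 (cfj j) tp (t0 j).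
  have -> : (fun x => f x + j.+1%:R^-1 * S x + j.+1%:R^-1 * z i x) =
     (fun x => f x + j.+1%:R^-1 * \sum_(i <- i :: r) z i x).
    by apply/funext => x; rewrite big_cons /S; ring.
  by move=> ->; field; rewrite addrC natr1 pnatr_eq0.
under eq_fun do rewrite E.
apply: seq_cvgD IH; apply: seq_cvgD.
  apply: (lf_cont lJ) => // [j||]; [exact: convexfD|exact: convexfD|].
  by apply: lu_cvgD lfj _; exact: lu_cst.
rewrite -[X in _ --> X]mulN1r; under eq_fun do rewrite -mulN1r.
by apply: seq_cvgM; [exact: seq_cvg_cst|exact: (lf_cont lJ)].
Qed.

(** Two decompositions of the same function are compared through the Gateaux derivative, which
    depends on the function only. *)
Lemma gateaux_eq (I I' : Type) (r : seq I) (r' : seq I') (z : I -> V -> R) (z' : I' -> V -> R) f phi :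
  testfun phi -> convexf f -> (forall i, adir (z i)) -> (forall i, adir (z' i)) ->
  (forall x, \sum_(i <- r) z i x = \sum_(i <- r') z' i x) ->
  \sum_(i <- r) (J (fun x => f x + z i x) phi - J f phi) =
  \sum_(i <- r') (J (fun x => f x + z' i x) phi - J f phi).
Proof.
move=> tp cf az az' e; have l1 := @gateaux _ r z f phi tp cf az; have l2 := @gateaux _ r' z' f phi tp cf az'.
apply: (seq_lim_eq l1 l2) => j.
by congr (_ * (J _ _ - _)); apply/funext => x; rewrite e.
Qed.

Definition sq (v : V) (x : V) : R := dotp v x ^+ 2.

Lemma conv1_sq : conv1 (fun s : R => s ^+ 2).
Proof.
move=> s t u /andP[u0 u1]; rewrite -subr_ge0.
have -> : u * s ^+ 2 + (1 - u) * t ^+ 2 - (u * s + (1 - u) * t) ^+ 2 = u * (1 - u) * (s - t) ^+ 2 by ring.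
by rewrite mulr_ge0 ?sqr_ge0// mulr_ge0// subr_ge0.
Qed.

Lemma adir_sq v : adir (sq v).
Proof. exact: (adir_ridge lJ v conv1_sq). Qed.

Lemma convexf_sq v : convexf (sq v).
Proof. exact: (convexf_ridge v conv1_sq). Qed.

Definition qm m (M : 'M[R]_(m, n)) (x : V) : R := \sum_(i < m) sq (row i M) x.

Lemma convexf_qm m (M : 'M[R]_(m, n)) : convexf (qm M).
Proof. by apply: convexf_sum => i; exact: convexf_sq. Qed.

Definition setrow m (M : 'M[R]_(m, n)) i (v : V) : 'M[R]_(m, n) :=
  \matrix_(a, b) if a == i then v ord0 b else M a b.

Lemma row_setrow m (M : 'M[R]_(m, n)) i v j :
  row j (setrow M i v) = if j == i then v else row j M.
Proof. by apply/rowP => b; rewrite !mxE; case: ifP => // _; rewrite mxE. Qed.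

Lemma qm_setrow m (M : 'M[R]_(m, n)) i v x :
  qm (setrow M i v) x = \sum_(j < m | j != i) sq (row j M) x + sq v x.
Proof.
rewrite /qm (bigD1 i)//= row_setrow eqxx addrC; congr (_ + _).
by apply: eq_bigr => j /negbTE ji; rewrite row_setrow ji.
Qed.

Lemma sq_expand (v : V) x : sq v x = \sum_a \sum_b v ord0 a * v ord0 b * (x ord0 a * x ord0 b).
Proof.
rewrite /sq expr2 /dotp mulr_suml; apply: eq_bigr => a _.
by rewrite mulr_sumr; apply: eq_bigr => b _; ring.
Qed.

Lemma sq_polar a b (x : V) : x ord0 a * x ord0 b =
  2^-1 * (sq (delta_mx ord0 a + delta_mx ord0 b) x - sq (delta_mx ord0 a) x - sq (delta_mx ord0 b) x).
Proof. by rewrite /sq dotpDl !dotp_delta; field. Qed.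

Definition polar (q : V -> R) (v w : V) : R := 2^-1 * (q (v + w) - q v - q w).

(** With [c = v_a v_b / 2], [sq v] is a signed combination of [sq (e_a + e_b)], [sq e_a] and
    [sq e_b]. Moving negative weights to the other side leaves two nonnegative ridge sums of one
    function, and [gateaux_eq] transfers the identity to [G]. *)
Lemma Q_quad f phi : testfun phi -> convexf f ->
  let G v := J (fun x => f x + sq v x) phi - J f phi in
  forall v, G v = \sum_a \sum_b v ord0 a * v ord0 b * polar G (delta_mx ord0 a) (delta_mx ord0 b).
Proof.
move=> tp cf G v.
pose p (c : R) := Num.max c 0.
have p0 c : 0 <= p c by rewrite le_max lexx orbT.
have pE c : c = p c - p (- c).
  by rewrite /p /Num.max; case: ltrP => h1; case: ltrP => h2; lra.
pose c (ab : 'I_n * 'I_n) := 2^-1 * (v ord0 ab.1 * v ord0 ab.2).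
pose e (a : 'I_n) : V := delta_mx ord0 a.
have Gc w a : 0 <= a -> J (fun x => f x + a * sq w x) phi - J f phi = a * G w.
  by move=> a0; have [_ h] := adir_sq w; rewrite h// /G; ring.
pose s : seq ('I_n * 'I_n) := index_enum _.
(* Weighted vectors: [w0] on [v], [A c] on [e_a + e_b], [B c] on [e_a] and on [e_b]. The two sides
   are [mk pm p 1] and [mk p pm 0], with [p] and [pm] the positive and negative parts. *)
pose mk (A B : R -> R) (w0 : R) : seq (R * V) := (w0, v) :: [seq (A (c ab), e ab.1 + e ab.2) | ab <- s] ++
  [seq (B (c ab), e ab.1) | ab <- s] ++ [seq (B (c ab), e ab.2) | ab <- s].
pose pm (c : R) := p (- c).
have mkG A B w0 (X : V -> R) : \sum_(q <- mk A B w0) q.1 * X q.2 =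
    w0 * X v + \sum_(ab <- s) (A (c ab) * X (e ab.1 + e ab.2) + B (c ab) * (X (e ab.1) + X (e ab.2))).
  rewrite /mk big_cons !big_cat !big_map /=; congr (_ + _).
  by rewrite -!big_split /=; apply: eq_bigr => ab _; ring.
(* Writing [p q.1] makes every pair [q] an affine direction, as [gateaux_eq] asks; on the lists used
   it leaves the weights unchanged. *)
have ad (q : R * V) : adir (fun x => p q.1 * sq q.2 x) by apply: adir_scale => //; exact: adir_sq.
have pp x : p (p x) = p x by rewrite /p max_l// le_max lexx orbT.
have p1 : p 1 = 1 by rewrite /p max_l.
have p00 : p 0 = 0 by rewrite /p maxxx.
have comp A B w0 (X : V -> R) : p w0 = w0 -> (forall y, p (A y) = A y) -> (forall y, p (B y) = B y) ->
    \sum_(q <- mk A B w0) p q.1 * X q.2 = \sum_(q <- mk A B w0) q.1 * X q.2.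
  move=> hw hA hB; rewrite /mk !big_cons !big_cat !big_map /= hw.
  by congr (_ + (_ + (_ + _))); apply: eq_bigr => ab _; rewrite ?hA ?hB.
have ppm y : p (pm y) = pm y by rewrite /pm pp.
have := @gateaux_eq _ _ (mk pm p 1) (mk p pm 0) (fun q x => p q.1 * sq q.2 x) (fun q x => p q.1 * sq q.2 x)
  f phi tp cf ad ad.
have GE l : \sum_(q <- l) (J (fun x => f x + p q.1 * sq q.2 x) phi - J f phi) =
    \sum_(q <- l) p q.1 * G q.2.
  by apply: eq_bigr => q _; rewrite Gc.
rewrite !GE.
rewrite (comp pm p 1 G)// (comp p pm 0 G)// !mkG mul1r mul0r add0r => H.
have sE (X : V -> R) : \sum_(ab <- s) (p (c ab) * X (e ab.1 + e ab.2) + pm (c ab) * (X (e ab.1) + X (e ab.2)))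
   - \sum_(ab <- s) (pm (c ab) * X (e ab.1 + e ab.2) + p (c ab) * (X (e ab.1) + X (e ab.2)))
   = \sum_a \sum_b v ord0 a * v ord0 b * polar X (e a) (e b).
  rewrite -sumrB pair_bigA /=; apply: eq_bigr => ab _; rewrite /polar.
  have := pE (c ab); rewrite -/(pm (c ab)) => h.
  have -> : v ord0 ab.1 * v ord0 ab.2 = 2 * (p (c ab) - pm (c ab)) by rewrite -h /c; field.
  by field.
have {}H := H _; rewrite -sE; apply/eqP; rewrite eq_sym subr_eq eq_sym; apply/eqP; apply: H => x.
rewrite (comp pm p 1 (fun w => sq w x))// (comp p pm 0 (fun w => sq w x))//.
rewrite (mkG _ _ _ (fun w => sq w x)) (mkG _ _ _ (fun w => sq w x)) mul1r mul0r add0r.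
have := sE (fun w => sq w x); have -> : \sum_a \sum_b v ord0 a * v ord0 b * polar (fun w => sq w x) (e a) (e b) = sq v x.
  by rewrite sq_expand; apply: eq_bigr => a _; apply: eq_bigr => b _; rewrite (sq_polar a b x).
by move=> /eqP; rewrite subr_eq => /eqP ->.
Qed.

End Ridges.

(** * Quadratic forms on rows of matrices *)

Section QForms.
Variables (R : realType) (k n : nat).
Implicit Types (Q : 'M[R]_(k, n) -> R) (M : 'M[R]_(k, n)).

(** [qa_rot] is an unnormalized rotation by 45 degrees in the plane of two rows: the factor [sqrt 2]
    on each of the two rows enters squared, whence 4. *)
Record Qax Q : Prop := QAx {
  qa_quad : forall M i, exists b : 'I_n -> 'I_n -> R, forall v,
    Q (setrow M i v) = \sum_a \sum_c v ord0 a * v ord0 c * b a c;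
  qa_rot : forall M i j v w, i != j ->
    Q (setrow (setrow M i (v + w)) j (v - w)) = 4 * Q (setrow (setrow M i v) j w);
  qa_perm : forall M s, Q (row_perm s M) = Q M }.

Lemma setrow_id M i : setrow M i (row i M) = M.
Proof. by apply/matrixP => a b; rewrite !mxE; case: eqP => [->|]. Qed.

Lemma setrowC M i j v w : i != j -> setrow (setrow M i v) j w = setrow (setrow M j w) i v.
Proof.
move=> ij; apply/matrixP => a b; rewrite !mxE; case: eqP => [->|//].
by rewrite eq_sym (negbTE ij).
Qed.

Lemma Q_scale Q M i c v : Qax Q -> Q (setrow M i (c *: v)) = c ^+ 2 * Q (setrow M i v).
Proof.
move=> qx; have [b h] := qa_quad qx M i; rewrite !h mulr_sumr; apply: eq_bigr => a _.
by rewrite mulr_sumr; apply: eq_bigr => d _; rewrite !mxE; ring.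
Qed.

Lemma Q_row0 Q M i : Qax Q -> Q (setrow M i 0) = 0.
Proof. by move=> qx; rewrite -(scale0r 0) Q_scale// expr0n mul0r. Qed.

Lemma Q_line Q M i v w c : Qax Q -> Q (setrow M i (v + c *: w)) =
  Q (setrow M i v) + c * (Q (setrow M i (v + w)) - Q (setrow M i v) - Q (setrow M i w))
  + c ^+ 2 * Q (setrow M i w).
Proof.
move=> qx; have [b h] := qa_quad qx M i.
have e (u : 'rV[R]_n) : Q (setrow M i u) = \sum_a u ord0 a * \sum_d u ord0 d * b a d.
  by rewrite h; apply: eq_bigr => a _; rewrite mulr_sumr; apply: eq_bigr => d _; rewrite mulrA.
rewrite !h -!sumrB mulr_sumr [X in _ = _ + X]mulr_sumr -!big_split /=; apply: eq_bigr => a _.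
rewrite -!sumrB mulr_sumr [X in _ = _ + X]mulr_sumr -!big_split /=; apply: eq_bigr => d _.
by rewrite !mxE; ring.
Qed.

(** The rows [(v, v)] arise by rotating [(v, 0)]. *)
Lemma Q_same Q M i j v : Qax Q -> i != j -> Q (setrow (setrow M i v) j v) = 0.
Proof.
move=> qx ij; have := qa_rot qx M v 0 ij.
by rewrite addr0 subr0 Q_row0// mulr0.
Qed.

Lemma Q_swap Q M i j v w : Qax Q -> i != j ->
  Q (setrow (setrow M i v) j w) = Q (setrow (setrow M i w) j v).
Proof.
move=> qx ij; rewrite -[LHS](qa_perm qx _ (tperm i j)); congr Q; apply/matrixP => a b; rewrite !mxE.
case: tpermP => [->|->|/eqP/negbTE ai /eqP/negbTE aj].
- by rewrite eqxx (negbTE ij) eqxx.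
- by rewrite (negbTE ij) !eqxx.
- by rewrite ai aj.
Qed.

(** By [Q_same], [F (a + s b) b] has no quadratic term in [s]; let [g a b] be the linear
    coefficient. Rotating the pair [(a + b, a)] into [(2 a + b, b)] gives [g a b = 2 g b a];
    exchanging the roles, [g = 4 g = 0]. *)
Lemma Q_shear Q M i j v c : Qax Q -> i != j -> 
  Q (setrow M i (v + c *: row j M)) = Q (setrow M i v).
Proof.
move=> qx ij; have ji : j != i by rewrite eq_sym.
pose F a b := Q (setrow (setrow M i a) j b).
pose g a b := F (a + b) b - F a b.
have Fl a b (s : R) : F (a + s *: b) b = F a b + s * g a b.
  rewrite /F !(setrowC _ _ _ ij) Q_line// -!(setrowC _ _ _ ij) (Q_same M b qx ij) mulr0 addr0 subr0.
  by rewrite /g /F.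
have Fs a b : F a b = F b a by exact: Q_swap.
have Fz (s : R) a b : F (s *: a) b = s ^+ 2 * F a b.
  by rewrite /F !(setrowC _ _ _ ij) Q_scale.
have g2 a b : g a b = 2 * g b a.
  have := qa_rot qx M (a + b) a ij; rewrite -/(F _ _) -/(F _ _).
  have -> : a + b + a = 2 *: (a + 2^-1 *: b).
    by apply/rowP => l; rewrite !mxE; field.
  rewrite addrAC subrr add0r Fz Fl [in RHS]addrC.
  have := Fl b a 1; rewrite scale1r => ->.
  by rewrite (Fs b a); lra.
have g0 a b : g a b = 0 by have := g2 a b; have := g2 b a; lra.
have := Fl v (row j M) c; rewrite g0 mulr0 addr0 /F !(setrowC _ _ _ ij).
by rewrite setrow_id.
Qed.

Lemma Q_shear_seq Q M i v (c : 'I_k -> R) (r : seq 'I_k) : Qax Q -> i \notin r ->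
  Q (setrow M i (v + \sum_(j <- r) c j *: row j M)) = Q (setrow M i v).
Proof.
move=> qx; elim: r v => [|j r IH] v; first by rewrite big_nil addr0.
rewrite inE negb_or => /andP[ij ir]; rewrite big_cons addrA IH//.
exact: Q_shear.
Qed.

(** Row operations: only the coefficient of the replaced row itself is felt, quadratically. *)
Lemma Q_replace Q M i (d : R) (c : 'I_k -> R) : Qax Q ->
  Q (setrow M i (d *: row i M + \sum_(j | j != i) c j *: row j M)) = d ^+ 2 * Q M.
Proof.
move=> qx; rewrite -big_filter Q_shear_seq//; last by rewrite mem_filter eqxx.
by rewrite Q_scale// setrow_id.
Qed.

(** A linear relation with nonzero coefficient at [i] turns row [i] into 0 by [Q_replace]. *)
Lemma Q_not_free Q M : Qax Q -> ~~ row_free M -> Q M = 0.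
Proof.
move=> qx; rewrite -kermx_eq0 => /rowV0Pn[x /sub_kermxP xM x0].
have [i xi] : exists i, x ord0 i != 0.
  by apply/existsP; apply: contraNT x0; rewrite negb_exists => /forallP h;
    apply/eqP/rowP => i; have := h i; rewrite negbK mxE => /eqP.
have := Q_replace M i (x ord0 i) (fun j => x ord0 j) qx.
have -> : x ord0 i *: row i M + \sum_(j | j != i) x ord0 j *: row j M = 0.
  by have := mulmx_sum_row x M; rewrite xM (bigD1 i)//= => <-.
rewrite Q_row0// => /esym/eqP; rewrite mulf_eq0 expf_eq0/= (negbTE xi) => /eqP //.
Qed.

End QForms.

Section QDet.
Variable R : realType.

Lemma setrow_mul k n (H : 'M[R]_k) i v (M : 'M[R]_(k, n)) :
  setrow H i v *m M = setrow (H *m M) i (v *m M).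
Proof.
apply/matrixP => a b; rewrite !mxE; case: eqP => ai; last first.
  by apply: eq_bigr => j _; rewrite mxE; case: eqP ai.
by apply: eq_bigr => j _; rewrite mxE ai eqxx.
Qed.

Lemma Qax_mul k n (Q : 'M[R]_(k, n) -> R) (M : 'M[R]_(k, n)) : Qax Q ->
  Qax (fun H : 'M[R]_k => Q (H *m M)).
Proof.
move=> qx; split.
- move=> H i; have [b h] := qa_quad qx (H *m M) i.
  exists (fun p q => \sum_a \sum_c M p a * M q c * b a c) => v.
  rewrite setrow_mul h.
  transitivity (\sum_a \sum_c \sum_p \sum_q v ord0 p * v ord0 q * (M p a * M q c * b a c)).
    apply: eq_bigr => a _; apply: eq_bigr => c _; rewrite !mxE !mulr_suml; apply: eq_bigr => p _.
    by rewrite mulr_sumr mulr_suml; apply: eq_bigr => q _; ring.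
  under eq_bigr do rewrite exchange_big.
  rewrite exchange_big; apply: eq_bigr => p _.
  under eq_bigr do rewrite exchange_big.
  rewrite exchange_big; apply: eq_bigr => q _.
  by rewrite mulr_sumr; apply: eq_bigr => a _; rewrite mulr_sumr.
- by move=> H i j v w ij; rewrite !setrow_mul mulmxDl mulmxBl (qa_rot qx).
- by move=> H s; rewrite row_permE -mulmxA -row_permE (qa_perm qx).
Qed.

Definition mixrow k n (A B : 'M[R]_(k, n)) (t : nat) : 'M[R]_(k, n) :=
  \matrix_(i, j) if (i < t)%N then A i j else B i j.

Lemma mixrow0 k n (A B : 'M[R]_(k, n)) : mixrow A B 0 = B.
Proof. by apply/matrixP => i j; rewrite mxE. Qed.
Lemma mixrow_max k n (A B : 'M[R]_(k, n)) : mixrow A B k = A.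
Proof. by apply/matrixP => i j; rewrite mxE ltn_ord. Qed.
Lemma mixrowS k n (A B : 'M[R]_(k, n)) (t : 'I_k) : mixrow A B t.+1 = setrow (mixrow A B t) t (row t A).
Proof.
apply/matrixP => i j; rewrite !mxE ltnS leq_eqVlt -val_eqE /=.
by case: eqP => [/val_inj ->|].
Qed.
Lemma mixrowS' k n (A B : 'M[R]_(k, n)) (t : 'I_k) : mixrow A B t = setrow (mixrow A B t.+1) t (row t B).
Proof.
apply/matrixP => i j; rewrite !mxE ltnS -val_eqE /=.
by case: ltngtP => // /val_inj ->.
Qed.

(** Rows of the identity are replaced from the top: when row [t] is treated the rows below are still
    unit vectors, and row [t] of [U] has no entries at earlier indices. *)
Lemma Q_upper k (F : 'M[R]_k -> R) (U : 'M[R]_k) : Qax F ->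
  (forall i j : 'I_k, (j < i)%N -> U i j = 0) -> F U = (\prod_i U i i) ^+ 2 * F 1%:M.
Proof.
move=> qx hU.
have step t : (t <= k)%N -> F (mixrow U 1%:M t) = (\prod_(i < k | (i < t)%N) U i i) ^+ 2 * F 1%:M.
  elim: t => [|t IH] tk; first by rewrite mixrow0 big_pred0 ?expr1n ?mul1r.
  have := Q_replace (mixrow U 1%:M t) (Ordinal tk) (U (Ordinal tk) (Ordinal tk)) (U (Ordinal tk)) qx.
  have pE : \prod_(i < k | (i < t.+1)%N) U i i =
      U (Ordinal tk) (Ordinal tk) * \prod_(i < k | (i < t)%N) U i i.
    rewrite (bigD1 (Ordinal tk)) /= ?ltnS//; congr (_ * _); apply: eq_bigl => i.
    by rewrite ltnS -val_eqE /=; case: ltngtP.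
  rewrite (IH (ltnW tk)) pE exprMn -mulrA => e.
  rewrite (mixrowS _ _ (Ordinal tk)) [X in setrow _ _ X](_ : _ =
     U (Ordinal tk) (Ordinal tk) *: row (Ordinal tk) (mixrow U 1%:M t) +
     \sum_(j | j != Ordinal tk) U (Ordinal tk) j *: row j (mixrow U 1%:M t)).
    by rewrite e; ring.
  rewrite [RHS](_ : _ = \sum_j U (Ordinal tk) j *: row j (mixrow U 1%:M t)); last by rewrite [RHS](bigD1 (Ordinal tk)).
  apply/rowP => l; rewrite summxE mxE.
  transitivity (\sum_j U (Ordinal tk) j * (1%:M : 'M[R]_k) j l).
    by rewrite -[LHS]/(U _ l) -{1}[U]mulmx1 mxE.
  apply: eq_bigr => j _; rewrite !mxE; case: ltnP => // jt.
  by rewrite hU ?mul0r.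
by rewrite -{1}(mixrow_max U 1%:M) step//; congr (_ ^+ 2 * _); apply: eq_bigl => i; rewrite ltn_ord.
Qed.

(** Rows of [U] are replaced from the bottom: row [i] of [L *m U] is row [i] of [U] plus a
    combination of the rows above it, which are still intact. *)
Lemma Q_lower k (F : 'M[R]_k -> R) (L U : 'M[R]_k) : Qax F ->
  (forall i j : 'I_k, (i <= j)%N -> L i j = (i == j)%:R) -> F (L *m U) = F U.
Proof.
move=> qx hL.
have step t : (t <= k)%N -> F (mixrow U (L *m U) (k - t)) = F U.
  elim: t => [|t IH] tk; first by rewrite subn0 mixrow_max.
  have tk' : (k - t.+1 < k)%N by rewrite ltn_subrL (leq_trans _ tk).
  have e1 : (k - t = (Ordinal tk').+1)%N by rewrite /= subnSK.
  rewrite e1 in IH; rewrite -(IH (ltnW tk)) -[(k - t.+1)%N]/(Ordinal tk' : nat) mixrowS'.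
  set i := Ordinal tk'; set M := mixrow U _ i.+1.
  have := Q_replace M i 1 (L i) qx; rewrite expr1n mul1r => <-.
  congr (F (setrow _ _ _)).
  have -> : 1 *: row i M = L i i *: row i M by rewrite hL// eqxx.
  rewrite [RHS](_ : _ = \sum_j L i j *: row j M); last by rewrite [RHS](bigD1 i).
  apply/rowP => l; rewrite summxE !mxE; apply: eq_bigr => j _; rewrite !mxE; case: ltnP => // ij.
  by rewrite hL 1?ltnW// -val_eqE ltn_eqF//= !mul0r.
by rewrite -(step k (leqnn k)) subnn mixrow0.
Qed.

(** LUP decomposition: the permutation changes neither [Q] nor the squared determinant, [L] is
    unipotent, and [U] contributes the square of its diagonal product. *)
Lemma Q_det k n (Q : 'M[R]_(k, n) -> R) (H : 'M[R]_k) (M : 'M[R]_(k, n)) : Qax Q ->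
  Q (H *m M) = \det H ^+ 2 * Q M.
Proof.
move=> qx; case: k Q H M qx => [|k] Q H M qx.
  by rewrite det_mx00 expr1n mul1r; congr Q; apply/matrixP => -[].
have px := Qax_mul M qx; pose F (H : 'M[R]_k.+1) := Q (H *m M).
rewrite -/(F H); have -> : Q M = F 1%:M by rewrite /F mul1mx.
have := cormen_lup_correct H; have := cormen_lup_perm H; have := cormen_lup_detL H.
have := @cormen_lup_lower R k H; have := @cormen_lup_upper R k H.
case: (cormen_lup H) => [[P L] U] /= hU hL dL /is_perm_mxP[s ->] e.
have e1 : F H = F (L *m U) by rewrite -[L *m U]/(L * U) -e -[perm_mx s * H]/(perm_mx s *m H) -row_permE /F -[LHS](qa_perm px H s).
have dH : \det H ^+ 2 = (\prod_i U i i) ^+ 2.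
  have := congr1 determinant e; rewrite !det_mulmx dL mul1r det_perm => e2.
  have -> : \prod_i U i i = \det U.
    by rewrite -det_tr det_trig; [apply: eq_bigr => i _; rewrite mxE|apply/is_trig_mxP => i j ij; rewrite mxE hU].
  by rewrite -e2 exprMn sqrr_sign mul1r.
by rewrite e1 Q_lower// Q_upper// dH.
Qed.

(** Each of the [k] rows contributes degree 2; the rows are set in motion one at a time by
    [Q_line]. *)
Lemma Q_poly k n (Q : 'M[R]_(k, n) -> R) (M N : 'M[R]_(k, n)) : Qax Q ->
  exists2 p : {poly R}, (size p <= (k.*2).+1)%N & forall s, p.[s] = Q (M + s *: N).
Proof.
move=> qx.
have step t : (t <= k)%N -> forall A, exists2 p : {poly R}, (size p <= (t.*2).+1)%N &
    forall s, p.[s] = Q (mixrow (M + s *: N) A t).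
  elim: t => [|t IH] tk A.
    exists (Q A)%:P; first exact: size_polyC_leq1.
    by move=> s; rewrite hornerC mixrow0.
  pose i := Ordinal tk.
  have [p1 s1 h1] := IH (ltnW tk) (setrow A i (row i M)).
  have [p2 s2 h2] := IH (ltnW tk) (setrow A i (row i N)).
  have [p3 s3 h3] := IH (ltnW tk) (setrow A i (row i M + row i N)).
  have mE s v : mixrow (M + s *: N) (setrow A i v) t = setrow (mixrow (M + s *: N) A t) i v.
    apply/matrixP => a b; rewrite !mxE -val_eqE /=; case: ltnP => // at'.
    by rewrite ltn_eqF.
  exists (p1 + 'X * (p3 - p1 - p2) + 'X ^+ 2 * p2).
    rewrite doubleS; apply: leq_trans (size_polyD _ _) _; rewrite geq_max.
    rewrite (leq_trans (size_polyD _ _)) ?geq_max ?(leq_trans s1) ?(leq_trans (size_polyMleq _ _)) ?size_polyX//=.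
    + by rewrite size_polyXn /= !ltnS.
    + rewrite ltnS (leq_trans (size_polyD _ _))// geq_max size_polyN (leq_trans s2)// andbT.
      by rewrite (leq_trans (size_polyD _ _))// geq_max size_polyN (leq_trans s3)// (leq_trans s1).
    + exact: leq_trans (leqnSn _) (leqnSn _).
  move=> s; rewrite (mixrowS _ _ i) !hornerE h1 h2 h3 !mE /=.
  have -> : row i (M + s *: N) = row i M + s *: row i N by apply/rowP => b; rewrite !mxE.
  by rewrite Q_line//; ring.
have [p sp hp] := step k (leqnn k) M; exists p => // s; by rewrite hp mixrow_max.
Qed.

(** Lagrange extrapolation to 0 from the nodes [1, ..., N], through the inverse of a Vandermonde
    matrix; the coefficients do not depend on [p]. *)
Lemma interpolate0 (N : nat) : exists c : 'I_N -> R, forall p : {poly R}, (size p <= N)%N ->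
  p.[0] = \sum_(i < N) c i * p.[i.+1%:R].
Proof.
pose a : 'rV[R]_N := \row_j j.+1%:R.
have uV : Vandermonde N a \in unitmx.
  rewrite unitmxE det_Vandermonde unitfE; apply/prodf_neq0 => i _; apply/prodf_neq0 => j ij.
  by rewrite !mxE subr_eq0 eqr_nat eqSS gtn_eqF.
pose e : 'cV[R]_N := \col_i (i == 0%N :> nat)%:R.
exists (fun i => (invmx (Vandermonde N a) *m e) i ord0) => p sp.
have H (m : 'I_N) : \sum_i (invmx (Vandermonde N a) *m e) i ord0 * i.+1%:R ^+ m = (m == 0%N :> nat)%:R.
  have := congr1 (fun A : 'cV[R]_N => A m ord0) (mulKVmx uV e); rewrite /= [in X in _ = X -> _]mxE => <-.
  by rewrite [RHS]mxE; apply: eq_bigr => i _; rewrite !mxE mulrC.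
have pE x : p.[x] = \sum_(m < N) p`_m * x ^+ m by rewrite (horner_coef_wide _ sp).
under eq_bigr do rewrite pE mulr_sumr.
rewrite exchange_big /= pE; apply: eq_bigr => m _.
rewrite -[X in p`_m * X](_ : \sum_i (invmx (Vandermonde N a) *m e) i ord0 * i.+1%:R ^+ m = _).
  by rewrite mulr_sumr; apply: eq_bigr => i _; ring.
by rewrite H expr0n.
Qed.

End QDet.

(** * Polarization and the reproducing kernel of squared minors *)

Section Kernel.
Variables (R : realType) (k : nat).

(* [pol Q x y] is the full polarization of [Q]: the polar form is taken in each
   row separately; rho selects, row by row, one of [x + y], [x], [y]. *)
Definition polw (j : 'I_3) : R := if j == 0%N :> nat then 2^-1 else - 2^-1.
Definition polc n (x y : 'M[R]_(k, n)) (rho : {ffun 'I_k -> 'I_3}) : 'M[R]_(k, n) :=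
  \matrix_(i, l) match val (rho i) with 0%N => x i l + y i l | 1%N => x i l | _ => y i l end.
Definition pol n (Q : 'M[R]_(k, n) -> R) (x y : 'M[R]_(k, n)) : R :=
  \sum_(rho : {ffun 'I_k -> 'I_3}) (\prod_i polw (rho i)) * Q (polc x y rho).

Definition mono n (U W M : 'M[R]_(k, n)) : R :=
  \prod_i (dotp (row i U) (row i M) * dotp (row i W) (row i M)).

(** Both the polar form of [x -> dotp u x * dotp w x] and the inner product of the symmetric tensors
    [u w] and [x y], which explains [pair_symC]. *)
Definition pair_sym n (u w x y : 'rV[R]_n) : R :=
  2^-1 * (dotp u x * dotp w y + dotp u y * dotp w x).

Lemma pair_symC n (u w x y : 'rV[R]_n) : pair_sym u w x y = pair_sym x y u w.
Proof. by rewrite /pair_sym !(dotpC u) !(dotpC w); ring. Qed.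

Lemma row_polc n (x y : 'M[R]_(k, n)) rho i : row i (polc x y rho) =
  match val (rho i) with 0%N => row i x + row i y | 1%N => row i x | _ => row i y end.
Proof. by apply/rowP => l; rewrite !mxE; case: (rho i) => -[|[|]] /= *; rewrite !mxE. Qed.

(** On a monomial the sum over [rho] factors over the rows by distributivity, and each factor is a
    polar form. *)
Lemma pol_mono n (I : Type) (r : seq I) (c : I -> R) (U W : I -> 'M[R]_(k, n))
  (Q : 'M[R]_(k, n) -> R) : (forall M, Q M = \sum_(t <- r) c t * mono (U t) (W t) M) ->
  forall x y, pol Q x y =
    \sum_(t <- r) c t * \prod_i pair_sym (row i (U t)) (row i (W t)) (row i x) (row i y).
Proof.
move=> hQ x y; rewrite /pol; under eq_bigr do rewrite hQ mulr_sumr.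
rewrite exchange_big; apply: eq_bigr => t _ /=.
under eq_bigr do rewrite mulrCA; rewrite -mulr_sumr; congr (_ * _).
pose F (i : 'I_k) (j : 'I_3) : R := polw j *
  (let v := match val j with 0%N => row i x + row i y | 1%N => row i x | _ => row i y end in
   dotp (row i (U t)) v * dotp (row i (W t)) v).
rewrite (eq_bigr (fun rho : {ffun 'I_k -> 'I_3} => \prod_i F i (rho i))); last first.
  by move=> rho _; rewrite /mono -big_split /=; apply: eq_bigr => i _; rewrite row_polc.
rewrite -bigA_distr_bigA; apply: eq_bigr => i _.
by rewrite !big_ord_recl big_ord0 /F /polw /= !dotpDr /pair_sym; field.
Qed.

(** Symmetrizing [b] leaves [q] unchanged, and the symmetrized coefficients are the polar values at
    unit vectors. *)
Lemma quad_polar n (q : 'rV[R]_n -> R) (b : 'I_n -> 'I_n -> R) :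
  (forall v, q v = \sum_a \sum_c v ord0 a * v ord0 c * b a c) ->
  forall v, q v = \sum_a \sum_c v ord0 a * v ord0 c * polar q (delta_mx ord0 a) (delta_mx ord0 c).
Proof.
move=> h v; pose e (a : 'I_n) : 'rV[R]_n := delta_mx ord0 a.
pose X (v w : 'rV[R]_n) := \sum_a \sum_d v ord0 a * w ord0 d * (2^-1 * (b a d + b d a)).
have Xs w w' : X w w' = X w' w.
  rewrite /X exchange_big; apply: eq_bigr => a' _; apply: eq_bigr => d' _.
  by rewrite (mulrC (w _ _)) (addrC (b a' d')).
have XD w w' w'' : X w (w' + w'') = X w w' + X w w''.
  rewrite /X -big_split; apply: eq_bigr => a' _; rewrite -big_split; apply: eq_bigr => d' _ /=.
  by rewrite mxE; ring.
have Xe a' d' : X (e a') (e d') = 2^-1 * (b a' d' + b d' a').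
  rewrite /X (bigD1 a')//= [X in _ + X]big1 ?addr0; last first.
    by move=> l /negbTE la; rewrite big1// => m _; rewrite !mxE /= la !mul0r.
  rewrite (bigD1 d')//= big1 ?addr0; last by move=> l /negbTE ld; rewrite !mxE /= ld mulr0 mul0r.
  by rewrite !mxE !eqxx !mul1r.
have qX w : q w = X w w.
  rewrite h; set S := LHS; have S2 : S = \sum_a \sum_c w ord0 a * w ord0 c * b c a.
    by rewrite /S exchange_big; apply: eq_bigr => a _; apply: eq_bigr => d _; rewrite (mulrC (w _ a)).
  transitivity (2^-1 * (S + S)); first by field.
  rewrite {1}/S S2 -big_split mulr_sumr; apply: eq_bigr => a _.
  by rewrite -big_split mulr_sumr; apply: eq_bigr => d _ /=; ring.
rewrite qX; apply: eq_bigr => a _; apply: eq_bigr => d _; congr (_ * _).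
rewrite -/(e a) -/(e d) -Xe /polar !qX XD !(Xs (e a + e d)) !XD (Xs (e d)); by field.
Qed.

(** The dependence on each row is expanded in polar values at unit vectors. After [t] steps the
    first [t] rows of the argument of [Q] are constants and the others still come from [M]. *)
Lemma Q_mono n (Q : 'M[R]_(k, n) -> R) : Qax Q ->
  exists T : seq (R * ('M[R]_(k, n) * 'M[R]_(k, n))),
    forall M, Q M = \sum_(t <- T) t.1 * mono t.2.1 t.2.2 M.
Proof.
move=> qx; pose e (a : 'I_n) : 'rV[R]_n := delta_mx ord0 a.
have step t : (t <= k)%N -> exists T : seq (R * ('M[R]_(k, n) * 'M[R]_(k, n)) * 'M[R]_(k, n)),
  forall M, Q M = \sum_(z <- T) z.1.1 *
    (\prod_(i < k | (i < t)%N) (dotp (row i z.1.2.1) (row i M) * dotp (row i z.1.2.2) (row i M))) *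
    Q (mixrow z.2 M t).
  elim: t => [|t IH] tk.
    exists [:: ((1, (0, 0)), 0)] => M.
    by rewrite big_seq1 mixrow0 big_pred0// !mul1r.
  have [T hT] := IH (ltnW tk); pose i := Ordinal tk.
  pose mk (z : R * ('M[R]_(k, n) * 'M[R]_(k, n)) * 'M[R]_(k, n)) (ab : 'I_n * 'I_n) (s : R) v :=
    ((s * z.1.1, (setrow z.1.2.1 i (e ab.1), setrow z.1.2.2 i (e ab.2))), setrow z.2 i v).
  exists (flatten [seq flatten [seq [:: mk z ab 2^-1 (e ab.1 + e ab.2); mk z ab (- 2^-1) (e ab.1);
      mk z ab (- 2^-1) (e ab.2)] | ab <- index_enum _] | z <- T]) => M.
  rewrite big_flatten big_map hT; apply: eq_bigr => z _.
  rewrite big_flatten big_map /=.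
  have [b hb] := qa_quad qx (mixrow z.2 M t) i.
  have E v : setrow (mixrow z.2 M t) i v = mixrow (setrow z.2 i v) M t.+1.
    apply/matrixP => a c; rewrite !mxE ltnS -val_eqE /=.
    by case: ltngtP => // at'; rewrite mxE -val_eqE /= ?at' ?eqxx// ltn_eqF.
  have r0 : row i (mixrow z.2 M t) = row i M by apply/rowP => c; rewrite !mxE ltnn.
  have := quad_polar hb (row i M); rewrite -{1}r0 setrow_id => ->.
  rewrite pair_bigA mulr_sumr; apply: eq_bigr => ab _ /=.
  rewrite !big_cons big_nil addr0 /mk /= -!E.
  have pE : \prod_(j < k | (j < t.+1)%N) (dotp (row j (setrow z.1.2.1 i (e ab.1))) (row j M) *
       dotp (row j (setrow z.1.2.2 i (e ab.2))) (row j M)) =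
     M i ab.1 * M i ab.2 *
     \prod_(j < k | (j < t)%N) (dotp (row j z.1.2.1) (row j M) * dotp (row j z.1.2.2) (row j M)).
    rewrite (bigD1 i) /= ?ltnS// !row_setrow eqxx !dotp_delta !mxE; congr (_ * _).
    apply: eq_big => [j|j]; first by rewrite ltnS -val_eqE /=; case: ltngtP.
    by rewrite ltnS => /andP[_ /negbTE ji]; rewrite !row_setrow ji.
  by rewrite !pE !mxE /polar; ring.
have [T hT] := step k (leqnn k).
exists [seq (z.1.1 * Q z.2, z.1.2) | z <- T] => M; rewrite big_map hT; apply: eq_bigr => z _ /=.
rewrite mixrow_max mulrAC; congr (_ * _); apply: eq_bigl => i; by rewrite ltn_ord.
Qed.

(** The squared inner product of the exterior products of the rows of [N] and of [V]. *)
Definition Dk n (N V : 'M[R]_(k, n)) : R := \det (V *m N^T) ^+ 2.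

Lemma Dk_mono n (N V : 'M[R]_(k, n)) : Dk N V =
  \sum_(t <- index_enum ('S_k * 'S_k)%type) ((-1) ^+ t.1 * (-1) ^+ t.2) *
     mono (row_perm t.1 N) (row_perm t.2 N) V.
Proof.
rewrite /Dk expr2 /determinant mulr_suml; under eq_bigr do rewrite mulr_sumr.
rewrite pair_bigA /=; apply: eq_bigr => -[s u] _ /=.
rewrite mulrACA; congr (_ * _); rewrite /mono -big_split /=; apply: eq_bigr => i _.
by rewrite !mxE; congr (_ * _); apply: eq_bigr => j _; rewrite !mxE mulrC.
Qed.

(** The squared norm of [Dk 1%:M] for the contravariant form, with one factor expanded by
    Leibniz. *)
Definition cker : R := \sum_(t <- index_enum ('S_k * 'S_k)%type) ((-1) ^+ t.1 * (-1) ^+ t.2) *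
  pol (Dk (1%:M : 'M[R]_k)) (perm_mx t.1) (perm_mx t.2).

(** Writing [pair_sym] as an inner product over index pairs turns [cker] into a sum of squares
    indexed by [om]; the choice [om0] of diagonal pairs contributes [Dk 1 1 = 1]. *)
Lemma cker_gt0 : 0 < cker.
Proof.
pose T := index_enum ('S_k * 'S_k)%type.
pose g (t : 'S_k * 'S_k) : R := (-1) ^+ t.1 * (-1) ^+ t.2.
pose f (t : 'S_k * 'S_k) (i : 'I_k) (pq : 'I_k * 'I_k) : R :=
  2^-1 * ((perm_mx t.1) i pq.1 * (perm_mx t.2) i pq.2 + (perm_mx t.1) i pq.2 * (perm_mx t.2) i pq.1).
have sE (u w x y : 'rV[R]_k) : pair_sym u w x y = \sum_(pq : 'I_k * 'I_k)
   2^-1 * (u ord0 pq.1 * w ord0 pq.2 + u ord0 pq.2 * w ord0 pq.1) *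
   (2^-1 * (x ord0 pq.1 * y ord0 pq.2 + x ord0 pq.2 * y ord0 pq.1)).
  have d2 (a b c d : 'rV[R]_k) : dotp a b * dotp c d =
      \sum_(pq : 'I_k * 'I_k) a ord0 pq.1 * b ord0 pq.1 * (c ord0 pq.2 * d ord0 pq.2).
    by rewrite /dotp mulr_suml; under eq_bigr do rewrite mulr_sumr; rewrite pair_bigA.
  have d2' (a b c d : 'rV[R]_k) : dotp a b * dotp c d =
      \sum_(pq : 'I_k * 'I_k) a ord0 pq.2 * b ord0 pq.2 * (c ord0 pq.1 * d ord0 pq.1).
    by rewrite mulrC d2; apply: eq_bigr => pq _; rewrite mulrC.
  transitivity (4^-1 * (dotp u x * dotp w y + dotp u x * dotp w y + dotp u y * dotp w x + dotp u y * dotp w x)).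
    by rewrite /pair_sym; field.
  rewrite {1}(d2 u x) (d2' u x) {1}(d2 u y) (d2' u y) -!big_split mulr_sumr /=.
  by apply: eq_bigr => pq _; field.
have -> : cker = \sum_(om : {ffun 'I_k -> 'I_k * 'I_k}) (\sum_(t <- T) g t * \prod_i f t i (om i)) ^+ 2.
  rewrite /cker; under eq_bigr => t _ do rewrite (pol_mono (@Dk_mono k 1%:M)) -/(g t).
  transitivity (\sum_(t <- T) \sum_(t' <- T) g t * g t' * \sum_(om : {ffun 'I_k -> 'I_k * 'I_k})
      \prod_i (f t i (om i) * f t' i (om i))).
    apply: eq_bigr => t _; rewrite mulr_sumr; apply: eq_bigr => t' _.
    rewrite -/(g t') mulrA; congr (_ * _); rewrite -(bigA_distr_bigA (fun i pq => f t i pq * f t' i pq)); apply: eq_bigr => i _.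
    rewrite pair_symC sE; apply: eq_bigr => pq _; rewrite /f.
    by rewrite !row_permE !mulmx1 !mxE.
  under eq_bigr do under eq_bigr do rewrite mulr_sumr.
  under eq_bigr do rewrite exchange_big; rewrite exchange_big; apply: eq_bigr => om _ /=.
  rewrite expr2 mulr_suml; apply: eq_bigr => t _; rewrite mulr_sumr; apply: eq_bigr => t' _.
  by rewrite big_split /=; ring.
pose om0 : {ffun 'I_k -> 'I_k * 'I_k} := [ffun i => (i, i)].
rewrite (bigD1 om0)//=; apply: ltr_pwDl; last by apply: sumr_ge0 => om _; exact: sqr_ge0.
suff -> : \sum_(t <- T) g t * \prod_i f t i (om0 i) = 1 by rewrite expr1n.
transitivity (Dk (1%:M : 'M[R]_k) 1%:M); last by rewrite /Dk trmx1 mulmx1 det1 expr1n.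
rewrite Dk_mono; apply: eq_bigr => t _; congr (_ * _); apply: eq_bigr => i _.
rewrite /f /om0 ffunE /= !row1 !(dotpC _ (delta_mx _ _)) !dotp_delta !mxE.
by field.
Qed.

Lemma polc_mul n (x y : 'M[R]_k) (M : 'M[R]_(k, n)) rho :
  polc (x *m M) (y *m M) rho = polc x y rho *m M.
Proof. by apply/row_matrixP => i; rewrite row_mul !row_polc; case: (val (rho i)) => [|[|m]]; rewrite ?mulmxDl !row_mul. Qed.

(* Reproducing formula: the squares of the k-minors form a reproducing kernel
   for the contravariant bilinear form on the forms satisfying [Qax]. *)
Lemma Q_reproducing n (Q : 'M[R]_(k, n) -> R) : Qax Q ->
  exists L : seq (R * 'M[R]_(k, n)), forall M, Q M = \sum_(z <- L) z.1 * Dk z.2 M.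
Proof.
move=> qx; have [T hT] := Q_mono qx.
have DkC (N M : 'M[R]_(k, n)) : Dk N M = Dk M N.
  by rewrite /Dk -det_tr trmx_mul trmxK.
(* Pairing [Q] with [Dk M]: the Leibniz expansion of [Dk M] evaluates the polarized [Q] at row
   permutations of [M], and [Q_det] extracts the factor [Q M]. *)
have H M : \sum_(t <- T) t.1 * pol (Dk M) t.2.1 t.2.2 = cker * Q M.
  under eq_bigr => t _ do rewrite (pol_mono (@Dk_mono n M)) mulr_sumr.
  rewrite exchange_big /cker mulr_suml; apply: eq_bigr => -[s u] _ /=.
  transitivity (((-1) ^+ s * (-1) ^+ u) * pol Q (row_perm s M) (row_perm u M)).
    rewrite (pol_mono hT) mulr_sumr; apply: eq_bigr => t _; rewrite mulrCA; congr (_ * (_ * _)).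
    by apply: eq_bigr => i _; rewrite pair_symC.
  rewrite -[RHS]mulrA; congr (_ * _); rewrite /pol mulr_suml; apply: eq_bigr => rho _.
  rewrite !row_permE polc_mul (Q_det _ _ qx) mulrA; congr (_ * _ * _).
  by rewrite /Dk trmx1 mulmx1.
exists (flatten [seq [seq (cker^-1 * (t.1 * \prod_i polw (rho i)), polc t.2.1 t.2.2 rho)
   | rho : {ffun 'I_k -> 'I_3} <- index_enum _] | t <- T]) => M.
rewrite big_flatten big_map.
have -> : Q M = cker^-1 * (cker * Q M) by rewrite mulKf// gt_eqF// cker_gt0.
rewrite -H mulr_sumr; apply: eq_bigr => t _; rewrite big_map /pol !mulr_sumr; apply: eq_bigr => rho _ /=.
by rewrite DkC; ring.
Qed.

End Kernel.

(** * Lebesgue measure on row vectors *)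

Section BorelMaps.
Variables (R : realType) (d : measure_display) (T : measurableType d).

(** An open set is a countable union of open cubes with rational centre and half-side, and preimages
    of cubes are finite intersections of coordinate conditions. *)
Lemma measurable_rV n (f : T -> 'rV[R]_n) :
  (forall i, measurable_fun setT (fun t => f t ord0 i)) ->
  measurable_fun setT (f : T -> Borel R n).
Proof.
move=> mf _ A mA; rewrite setTI.
have : <<s @open 'rV[R]_n >> `<=` [set B | measurable (f @^-1` B)].
  apply: smallest_sub => /=.
    split => /=; first by rewrite preimage_set0.
      by move=> B mB; rewrite setTD -preimage_setC; exact: measurableC.
    by move=> F mF; rewrite preimage_bigcup; exact: bigcupT_measurable.
  move=> U oU /=.
  pose B (q : 'rV[rat]_n * rat) := [set x : 'rV[R]_n | forall i, `|x ord0 i - ratr (q.1 ord0 i)| < ratr q.2].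
  (* The second factor is everything or nothing: it discards the cubes not contained in [U]. *)
  have -> : U = \bigcup_q (B q `&` [set _ | B q `<=` U]).
    apply/seteqP; split=> [x Ux|x [q _ [Bx BU]]]; last exact: BU.
    have [e /= e0 eU] := (nbhs_ballP _ _).1 (open_nbhs_nbhs (conj oU Ux)).
    have [s /itvP s2] := rat_in_itvoo (divr_gt0 e0 (ltr0n R 2)).
    have s0 : 0 < ratr s :> R by rewrite s2.
    have se : ratr s < e / 2%:R :> R by rewrite s2.
    have qP i : {q : rat | `|x ord0 i - ratr q| < ratr s}.
      apply: cid; have [q /andP[q2 q3]] := @rat_in_itvoo R (x ord0 i - ratr s) (x ord0 i + ratr s) ltac:(lra).
      by exists q; rewrite ltr_norml; apply/andP; split; move: q2 q3; rewrite !bnd_simp; lra.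
    exists (\row_i projT1 (qP i), s) => //; split=> [i|y By] /=.
      by rewrite mxE; exact: (projT2 (qP i)).
    apply: eU; split=> // i j; rewrite /ball/= (ord1 i).
    have := By j; rewrite /= mxE; have := projT2 (qP j).
    rewrite !ltr_norml => /andP[? ?] /andP[? ?]; apply/andP; split; lra.
  rewrite preimage_bigcup; apply: countable_bigcupT_measurable => // q.
  have [BU|BU] := pselect (B q `<=` U); last first.
    rewrite (_ : _ @^-1` _ = set0)//; apply/seteqP; split => // t [_ /=] //.
  rewrite (_ : _ @^-1` _ = \bigcap_(i in setT) (fun t => f t ord0 i) @^-1` [set s : R | `|s - ratr (q.1 ord0 i)| < ratr q.2]); last first.
    by apply/seteqP; split=> [t [Bt _] i _|t Bt]; [exact: Bt|split => // i; exact: Bt].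
  apply: fin_bigcap_measurable => [|i _]; first exact: finite_finset.
  rewrite -[_ @^-1` _]setTI; apply: mf => //.
  apply: open_measurable; have := @ball_open R R^o (ratr (q.1 ord0 i)) (ratr q.2).
  by under [X in open X -> _]eq_set do rewrite /ball/= distrC.
by apply.
Qed.

End BorelMaps.

Section Lebesgue.
Variable R : realType.
Implicit Types n : nat.

Lemma measurable_coord n (i : 'I_n) : measurable_fun setT (fun x : Borel R n => (x : 'rV_n) ord0 i).
Proof.
have -> : (fun x : Borel R n => (x : 'rV_n) ord0 i) = dotp (delta_mx ord0 i).
  by apply/funext => x; rewrite dotp_delta.
by apply: continuous_borel; exact: dotp_continuous.
Qed.

Definition consv n (p : R * 'rV[R]_n) : 'rV[R]_n.+1 :=
  \row_i (if unlift ord0 i is Some j then p.2 ord0 j else p.1).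

Lemma consv0 n (p : R * 'rV[R]_n) : consv p ord0 ord0 = p.1.
Proof. by rewrite mxE unlift_none. Qed.

Lemma consvS n (p : R * 'rV[R]_n) j : consv p ord0 (lift ord0 j) = p.2 ord0 j.
Proof. by rewrite mxE liftK. Qed.

Lemma measurable_consv n : measurable_fun setT (@consv n : R * Borel R n -> Borel R n.+1).
Proof.
apply: measurable_rV => i; case: (unliftP ord0 i) => [j|] ->.
  under eq_fun do rewrite consvS.
  exact: (measurableT_comp (@measurable_coord n j) measurable_snd).
by under eq_fun do rewrite consv0; exact: measurable_fst.
Qed.

Section SigmaFinite.
Variables (n : nat) (m : {measure set Borel R n -> \bar R}) (lm : locfin m).

Lemma locfin_sigma_finite : sigma_finite setT m.
Proof.
exists (fun j => [set x : 'rV_n | `|x| <= j%:R]).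
  apply/seteqP; split => // x _.
  by exists (Num.truncn `|x|).+1 => //=; rewrite ltW// truncnS_gt.
by move=> j; split; [exact: cball_borel|exact: lm].
Qed.

(** An alias of [m] indexed by the proof of local finiteness, so that it can carry the sigma-finite
    structure. *)
Definition sfun_of (_ : locfin m) : set (Borel R n) -> \bar R := m.

HB.instance Definition _ := Measure.copy (sfun_of lm) m.
HB.instance Definition _ := @Measure_isSigmaFinite.Build _ (Borel R n) R (sfun_of lm)
  locfin_sigma_finite.

Definition sfin_of : {sigma_finite_measure set Borel R n -> \bar R} := sfun_of lm.

End SigmaFinite.

Local Notation leb1 := (@lebesgue_measure R).

Definition lebS n (m : {measure set Borel R n -> \bar R}) (lm : locfin m) :
    {measure set Borel R n.+1 -> \bar R} :=
  pushm (leb1 \x sfin_of lm)%E (@measurable_consv n).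

Lemma lebSE n m (lm : locfin m) A :
  lebS lm A = (\int[leb1]_s m [set v : 'rV[R]_n | A (consv (s, v))])%E.
Proof.
rewrite /lebS pushmE /product_measure1; apply: eq_integral => s _ /=.
by congr (m _); apply/seteqP; split=> v; rewrite /xsection/= inE.
Qed.

Lemma lebS_cball n m (lm : locfin m) (r : R) : 0 <= r ->
  @lebS n m lm [set x : 'rV_n.+1 | `|x| <= r] = ((r + r)%:E * m [set x : 'rV_n | (`|x| <= r)%R])%E.
Proof.
move=> r0; rewrite pushmE (_ : _ @^-1` _ = `[- r, r]%classic `*` [set x : 'rV_n | `|x| <= r]); last first.
  apply/seteqP; split=> -[s v] /=.
    move=> h; split.
      rewrite in_itv/= -ler_norml (le_trans _ h)//.
      by have := norm_coord (consv (s, v)) ord0; rewrite consv0.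
    by apply: norm_le_coord => // i; rewrite -(consvS (s, v)) (le_trans _ h)// norm_coord.
  rewrite in_itv/= -ler_norml => -[sr vr]; apply: norm_le_coord => // i.
  case: (unliftP ord0 i) => [j|] ->; last by rewrite consv0.
  by rewrite consvS (le_trans _ vr)// norm_coord.
rewrite [LHS]product_measure1E//; last exact: cball_borel.
congr (_ * _)%E; rewrite [LHS]lebesgue_measure_itv/= lte_fin.
case: ifPn => [|]; first by rewrite opprK.
by rewrite -leNgt => ?; congr EFin; lra.
Qed.

Lemma lebS_locfin n m (lm : locfin m) : locfin (@lebS n m lm).
Proof.
move=> r; have [r0|r0] := leP 0 r; last first.
  rewrite (_ : [set _ | _] = set0) ?measure0//; apply/seteqP; split => // x /= xr.
  by have := le_lt_trans xr r0; rewrite ltNge normr_ge0.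
by rewrite lebS_cball// lte_mul_pinfty// ?lee_fin ?addr_ge0//; exact: lm.
Qed.

Lemma dirac_locfin n : locfin (\d_(0 : Borel R n)).
Proof. by move=> r; rewrite /= diracE ltry. Qed.

(** The measure and its local finiteness are built together, since each product step uses
    sigma-finiteness of the previous one; [R^0] carries the unit mass. *)
Fixpoint lebp n : {m : {measure set Borel R n -> \bar R} | locfin m} :=
  if n is n'.+1 then exist _ (lebS (projT2 (lebp n'))) (lebS_locfin (projT2 (lebp n')))
  else exist _ (\d_(0 : Borel R 0) : {measure set _ -> \bar R}) (dirac_locfin 0).

Definition leb n : {measure set Borel R n -> \bar R} := projT1 (lebp n).

Lemma leb_locfin n : locfin (leb n). Proof. exact: (projT2 (lebp n)). Qed.

Lemma leb0E (A : set 'rV[R]_0) : leb 0 A = (\1_A 0)%:E.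
Proof. by []. Qed.

Lemma lebSint n (A : set 'rV[R]_n.+1) :
  leb n.+1 A = (\int[leb1]_s leb n [set v : 'rV[R]_n | A (consv (s, v))])%E.
Proof. exact: lebSE. Qed.

(** Tonelli in the opposite order, by uniqueness of the product measure. *)
Lemma lebSint2 n (A : set 'rV[R]_n.+1) : measurable (A : set (Borel R n.+1)) ->
  leb n.+1 A = (\int[leb n]_v leb1 [set s | A (consv (s, v))])%E.
Proof.
move=> mA; pose l := sfin_of (@leb_locfin n).
have mA' : measurable ((@consv n : R * Borel R n -> _) @^-1` A).
  by rewrite -[_ @^-1` _]setTI; exact: measurable_consv.
transitivity ((leb1 \x l)%E ((@consv n : R * Borel R n -> _) @^-1` A)) => //.
transitivity ((leb1 \x^ l)%E ((@consv n : R * Borel R n -> _) @^-1` A)).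
  by apply: product_measure_unique => // B C mB mC; rewrite [LHS]product_measure2E.
rewrite /product_measure2; apply: eq_integral => v _ /=.
by congr (leb1 _); apply/seteqP; split=> s; rewrite /ysection/= inE.
Qed.

Lemma measurable_consv_section n (A : set 'rV[R]_n.+1) s :
  measurable (A : set (Borel R n.+1)) -> measurable ([set v | A (consv (s, v))] : set (Borel R n)).
Proof.
move=> mA; have -> : [set v | A (consv (s, v))] = xsection ((@consv n : R * Borel R n -> _) @^-1` A) s.
  by apply/seteqP; split=> v; rewrite /xsection/= inE.
apply: measurable_xsection; by rewrite -[_ @^-1` _]setTI; exact: measurable_consv.
Qed.

Lemma measurable_leb_section n (A : set 'rV[R]_n.+1) :
  measurable (A : set (Borel R n.+1)) ->
  measurable_fun setT (fun s : R => leb n [set v | A (consv (s, v))]).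
Proof.
move=> mA; pose l := sfin_of (@leb_locfin n).
rewrite (_ : (fun _ => _) = (l \o xsection ((@consv n : R * Borel R n -> _) @^-1` A))).
  apply: measurable_fun_xsection.
  by rewrite -[_ @^-1` _]setTI; exact: measurable_consv.
apply/funext => s /=; congr (leb n _).
by apply/seteqP; split=> v; rewrite /xsection/= inE.
Qed.

Definition updv n (x : 'rV[R]_n) i s : 'rV[R]_n := \row_j (if j == i then s else x ord0 j).

Lemma updv_consv0 n (v : 'rV[R]_n) s t : updv (consv (s, v)) ord0 t = consv (t, v).
Proof.
apply/rowP => i; rewrite !mxE; case: (unliftP ord0 i) => [j|] ->; last by rewrite eqxx.
by case: eqP => // /(congr1 val); rewrite /= /bump.
Qed.

Lemma updv_consvS n (v : 'rV[R]_n) s t j :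
  updv (consv (s, v)) (lift ord0 j) t = consv (s, updv v j t).
Proof.
apply/rowP => i; rewrite !mxE; case: (unliftP ord0 i) => [l|] ->; rewrite ?liftK ?unlift_none//=.
  by rewrite mxE (inj_eq lift_inj).
Qed.

(** Tonelli with coordinate [i] innermost: directly by [lebSint2] for the first coordinate, by
    induction on slices for the others. *)
Lemma leb_null_lines n (A : set 'rV[R]_n) i : measurable (A : set (Borel R n)) ->
  (forall x : 'rV[R]_n, leb1 [set s | A (updv x i s)] = 0%E) -> leb n A = 0%E.
Proof.
elim: n => [|n IH] in A i *; first by case: i.
move=> mA h; case: (unliftP ord0 i) => [j ij|i0]; subst i.
  rewrite lebSint integral0_eq// => s _; apply: (IH _ j).
    exact: measurable_consv_section.
  move=> v; rewrite -[RHS](h (consv (s, v))); congr (leb1 _).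
  by apply/seteqP; split => t /=; rewrite updv_consvS.
rewrite lebSint2// integral0_eq// => v _; rewrite -[RHS](h (consv (0, v))); congr (leb1 _).
by apply/seteqP; split => t /=; rewrite updv_consv0.
Qed.

(** [c] times the image of Lebesgue measure under [s -> c s + h] agrees with Lebesgue measure on
    intervals. *)
Lemma lebesgue_affine (c h : R) (f : R -> \bar R) : 0 < c -> measurable_fun setT f ->
  (forall s, 0 <= f s)%E ->
  (\int[leb1]_s f (c * s + h)%R = c^-1%:E * \int[leb1]_s f s)%E.
Proof.
move=> c0 mf f0.
have ma : measurable_fun setT ((fun s : R => c * s + h) : measurableTypeR R -> measurableTypeR R).
  by apply: measurable_funD => //; apply: measurable_funM.
pose mu := mscale (NngNum (ltW c0)) (pushm leb1 ma).
have muE A : mu A = (c%:E * leb1 ((fun s : R => c * s + h)%R @^-1` A))%E by [].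
have mu1 A : measurable A -> leb1 A = mu A.
  apply: lebesgue_measure_unique => _ [[a b] _ <-].
  rewrite [RHS]muE lebesgue_measure_itv/= lte_fin.
  rewrite (_ : _ @^-1` _ = `](a - h) / c, (b - h) / c]%classic); last first.
    by apply/seteqP; split => s /=; rewrite !in_itv/= ltr_pdivrMr// ler_pdivlMr// ltrBlDr lerBrDr [s * c]mulrC.
  rewrite lebesgue_measure_itv/= lte_fin ltr_pM2r ?invr_gt0// ltrD2r.
  case: ifP => _; last by rewrite mule0.
  by rewrite -!EFinB -EFinM; congr EFin; field; rewrite gt_eqF.
rewrite [in RHS](eq_measure_integral mu); last by move=> A mA _; exact: mu1.
rewrite ge0_integral_mscale// ge0_integral_pushforward// muleA -EFinM mulVf ?gt_eqF// mul1e.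
by rewrite preimage_setT.
Qed.

Definition affv n (c h x : 'rV[R]_n) : 'rV[R]_n := \row_i (c ord0 i * x ord0 i + h ord0 i).

Lemma measurable_affv n (c h : 'rV[R]_n) : measurable_fun setT (affv c h : Borel R n -> Borel R n).
Proof.
apply: measurable_rV => i; under eq_fun do rewrite mxE.
by apply: measurable_funD => //; apply: measurable_funM => //; exact: measurable_coord.
Qed.

Lemma leb_affine n (c h : 'rV[R]_n) (A : set 'rV[R]_n) : (forall i, 0 < c ord0 i) ->
  measurable (A : set (Borel R n)) ->
  leb n A = ((\prod_i c ord0 i)%:E * leb n (affv c h @^-1` A))%E.
Proof.
elim: n => [|n IH] in c h A *.
  move=> _ _; rewrite big_ord0 mul1e !leb0E !indicE; congr (_%:R%:E).
  have a0 : affv c h 0 = 0 by apply/rowP => -[].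
  by rewrite /in_mem/= /in_set/= a0.
move=> c0 mA; rewrite !lebSint big_ord_recl.
pose c' := \row_i c ord0 (lift ord0 i); pose h' := \row_i h ord0 (lift ord0 i).
have E s : leb n [set v | A (consv (c ord0 ord0 * s + h ord0 ord0, v))] =
   ((\prod_i c' ord0 i)%:E * leb n [set v | (affv c h @^-1` A) (consv (s, v))])%E.
  rewrite (IH c' h'); last 2 first.
  - by move=> i; rewrite mxE.
  - exact: measurable_consv_section.
  congr (_ * leb n _)%E; apply/seteqP; split => v /=.
    suff -> : affv c h (consv (s, v)) = consv (c ord0 ord0 * s + h ord0 ord0, affv c' h' v) by [].
    by apply/rowP => i; case: (unliftP ord0 i) => [j|] ->; rewrite ?mxE ?consv0 ?consvS ?liftK ?unlift_none ?mxE.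
  suff -> : affv c h (consv (s, v)) = consv (c ord0 ord0 * s + h ord0 ord0, affv c' h' v) by [].
  by apply/rowP => i; case: (unliftP ord0 i) => [j|] ->; rewrite ?mxE ?consv0 ?consvS ?liftK ?unlift_none ?mxE.
have := lebesgue_affine (h ord0 ord0) (c0 ord0) (measurable_leb_section mA) (fun _ => measure_ge0 _ _).
under eq_integral do rewrite E.
rewrite ge0_integralZl//; last 2 first.
- apply: (measurable_leb_section (A := affv c h @^-1` A)).
  by rewrite -[_ @^-1` _]setTI; exact: measurable_affv.
- by rewrite lee_fin prodr_ge0// => i _; rewrite mxE ltW.
rewrite (eq_bigr (fun i => c ord0 (lift ord0 i))); last by move=> i _; rewrite mxE.
by move=> e; rewrite EFinM -muleA [X in (_ * X)%E]e muleA -EFinM mulfV ?gt_eqF// mul1e.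
Qed.

Lemma leb_cball n (r : R) : 0 <= r -> leb n [set x : 'rV_n | `|x| <= r] = ((r + r) ^+ n)%:E.
Proof.
move=> r0; elim: n => [|n IH].
  rewrite leb0E expr0 indicE mem_set//=; apply: norm_le_coord => // -[].
  done.
by rewrite [LHS]lebS_cball// [X in (_ * X)%E]IH -EFinM exprS.
Qed.

Lemma leb_shift n (h : 'rV[R]_n) (A : set 'rV[R]_n) :
  measurable (A : set (Borel R n)) -> leb n ((fun x => x + h) @^-1` A) = leb n A.
Proof.
move=> mA; rewrite [RHS](@leb_affine _ (const_mx 1) h)//; last by move=> i; rewrite mxE.
rewrite big1 ?mul1e; last by move=> i _; rewrite mxE.
by rewrite (_ : affv _ _ = (fun x => x + h))//; apply/funext => x; apply/rowP => i; rewrite !mxE mul1r.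
Qed.

Lemma leb_shift_int n (h : 'rV[R]_n) (phi : 'rV[R]_n -> R) : testfun phi ->
  int_real (leb n) (fun x => phi (x + h)) = int_real (leb n) phi.
Proof.
move=> tphi; pose mh := continuous_borel_map (@shift_continuous R n h).
transitivity (int_real (pushm (leb n) mh) phi).
  rewrite /int_real; congr fine; apply/esym.
  apply: (@integral_pushm _ _ _ _ _ (leb n) _ _ (EFin \o (phi : Borel R n -> R))).
    by apply/measurable_EFinP; apply: continuous_borel; exact: testfun_continuous.
  apply: (@testfun_integrable _ _ _ (fun x => phi (x + h))); first exact: leb_locfin.
  apply: (@testfun_comp _ _ _ (fun x => x - h)) => //; first exact: shift_continuous.
    by apply: shift_continuous.
  by move=> x; rewrite addrK.
rewrite /int_real; congr fine; apply: eq_measure_integral => A mA _; exact: leb_shift.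
Qed.

End Lebesgue.

(** * Translation-invariant functionals are multiples of Lebesgue measure *)

Section BoundedFubini.
Variables (R : realType) (n : nat).
Local Notation V := 'rV[R]_n.
Local Notation BV := (Borel R n).
Local Notation meas := {measure set BV -> \bar R}.

Lemma bounded_integrable d (T : measurableType d) (m : {measure set T -> \bar R})
  (D : set T) (g : T -> R) (M : R) : measurable D -> (m D < +oo)%E -> measurable_fun setT g ->
  (forall x, `|g x| <= M) -> (forall x, ~ D x -> g x = 0) -> m.-integrable setT (EFin \o g).
Proof.
move=> mD fD mg gM g0.
apply: (le_integrable _ _ _ (_ : m.-integrable setT (fun x => (M%:E * (\1_D x)%:E)%E))) => //.
- exact/measurable_EFinP.
- move=> x _ /=; rewrite lee_fin indicE.
  have [Dx|Dx] := pselect (D x); last by rewrite g0// normr0.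
  by rewrite mem_set//= mulr1 (le_trans (gM x))// ler_norm.
- by apply: integrableZl => //; exact: integrable_indic_fin.
Qed.

Lemma bounded_fubini (m l : meas) (h : V -> V -> R) (M r : R) : locfin m -> locfin l ->
  measurable_fun setT ((fun p => h p.2 p.1) : BV * BV -> R) ->
  (forall x y, `|h x y| <= M) -> (forall x y, r < `|x| \/ r < `|y| -> h x y = 0) ->
  l.-integrable setT (EFin \o ((fun y => int_real m (h^~ y)) : BV -> R)) /\
  int_real m (fun x => int_real l (h x)) = int_real l (fun y => int_real m (h^~ y)).
Proof.
move=> lm ll mh hM h0.
pose B : set BV := [set x : V | `|x| <= r].
have mB : measurable B by exact: cball_borel.
pose sm := sfin_of lm; pose sl := sfin_of ll.
have Ih : (sl \x sm)%E.-integrable setT (EFin \o (fun p : BV * BV => h p.2 p.1)).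
  apply: (@bounded_integrable _ _ _ (B `*` B) _ M) => //.
  - exact: measurableX.
  - by rewrite [ltLHS]product_measure1E// lte_mul_pinfty//; [|exact: lm]; rewrite ge0_fin_numE//; exact: ll.
  - by move=> [x y] /= /not_andP[] /negP; rewrite -ltNge => hr; apply: h0; [right|left].
have F1 x : (\int[l]_(y in setT) (h x y)%:E)%E = (int_real l (h x))%:E.
  rewrite /int_real fineK//; apply: integrable_fin_num => //.
  apply: (@bounded_integrable _ _ _ B _ M) => //; first exact: ll.
    exact: (@measurable_fun_pair1 _ _ _ _ _ _ (fun p : BV * BV => h p.2 p.1) x mh).
  by move=> y /negP; rewrite -ltNge => yr; apply: h0; right.
have F2 y : (\int[m]_(x in setT) (h x y)%:E)%E = (int_real m (h^~ y))%:E.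
  rewrite /int_real fineK//; apply: integrable_fin_num => //.
  apply: (@bounded_integrable _ _ _ B _ M) => //; first exact: lm.
    exact: (@measurable_fun_pair2 _ _ _ _ _ _ (fun p : BV * BV => h p.2 p.1) y mh).
  by move=> x /negP; rewrite -ltNge => xr; apply: h0; left.
have IG := integrable_fubini_F Ih.
split.
  rewrite (_ : EFin \o _ = fubini_F sm (EFin \o (fun p : BV * BV => h p.2 p.1)))//.
  by apply/funext => y; rewrite /= -F2.
have := Fubini Ih; rewrite /=.
under eq_integral do rewrite F2.
under [in X in _ = X -> _]eq_integral do rewrite F1.
by move=> /(congr1 fine)/esym.
Qed.

Lemma measurable_shear (phi phi0 : V -> R) (e : R) : continuous phi -> continuous phi0 ->
  measurable_fun setT ((fun p => phi p.2 * phi0 (e *: p.2 + p.1)) : BV * BV -> R).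
Proof.
move=> c c0; apply: measurable_funM.
  exact: (measurableT_comp (continuous_borel c) measurable_snd).
apply: (measurableT_comp (continuous_borel c0)) => /=.
apply: measurable_rV => i; under eq_fun do rewrite !mxE.
apply: measurable_funD; first apply: measurable_funM => //.
  exact: (measurableT_comp (@measurable_coord R n i) measurable_snd).
exact: (measurableT_comp (@measurable_coord R n i) measurable_fst).
Qed.

Lemma int_real_add4 (m : meas) (a b c d : V -> R) :
  m.-integrable setT (EFin \o (a : BV -> R)) -> m.-integrable setT (EFin \o (b : BV -> R)) ->
  m.-integrable setT (EFin \o (c : BV -> R)) -> m.-integrable setT (EFin \o (d : BV -> R)) ->
  (forall x, a x - b x = c x - d x) ->
  int_real m a - int_real m b = int_real m c - int_real m d.
Proof.
have D f g : m.-integrable setT (EFin \o (f : BV -> R)) -> m.-integrable setT (EFin \o (g : BV -> R)) ->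
    int_real m (fun x => f x + g x) = int_real m f + int_real m g.
  move=> If Ig; rewrite /int_real (integralD_EFin _ If Ig)// fineD//; exact: integrable_fin_num.
move=> Ia Ib Ic Id e; have : int_real m (fun x => a x + d x) = int_real m (fun x => c x + b x).
  by apply: eq_rint => x; have := e x; lra.
by rewrite !D// => ?; lra.
Qed.

Lemma testfunN (phi : V -> R) : testfun phi -> testfun (fun x => phi (- x)).
Proof.
move=> [c [r hr]]; split; last by exists r => x xr; apply: hr; rewrite normrN.
apply: (@cont_comp _ _ _ (fun x : V => - x)) => // x; apply: (@cvgN _ _ _ (nbhs x)); exact: cvg_id.
Qed.

Lemma testfun_shift (phi : V -> R) h : testfun phi -> testfun (fun x => phi (x + h)).
Proof.
by apply: (@testfun_comp _ _ _ (fun x => x - h));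
  [exact: shift_continuous|exact: shift_continuous|move=> x; rewrite addrK].
Qed.

(* Integrate phi(x) phi0(x + y) against nu(dx) L(dy) in both orders. *)
Lemma invariant_proportional (nu : (V -> R) -> R) (m0 m1 : meas) (phi phi0 : V -> R) :
  locfin m0 -> locfin m1 ->
  (forall psi, testfun psi -> nu psi = int_real m0 psi - int_real m1 psi) ->
  (forall psi h, testfun psi -> nu (fun x => psi (x + h)) = nu psi) ->
  testfun phi -> testfun phi0 ->
  nu phi * int_real (leb R n) phi0 = nu phi0 * int_real (leb R n) (fun y => phi (- y)).
Proof.
move=> l0 l1 rep inv tp tp0; have lL := @leb_locfin R n; set L := leb R n.
have [r r0 hr] := testfun_radius tp; have [s s0 hs] := testfun_radius tp0.
have [M M0 hM] := testfun_bounded tp; have [N N0 hN] := testfun_bounded tp0.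
(* Used with [e = 1] and [e = -1] for the two sides; the shift of [y] by [e *: x] disappears by
   invariance of Lebesgue measure. *)
have S (m : meas) a b e : locfin m -> `|e| = 1 -> testfun a -> testfun b ->
    L.-integrable setT (EFin \o ((fun y => int_real m (fun x => a x * b (e *: x + y))) : BV -> R)) /\
    int_real m a * int_real L b = int_real L (fun y => int_real m (fun x => a x * b (e *: x + y))).
  move=> lm e1 ta tb.
  have [ra ra0 ha] := testfun_radius ta; have [rb rb0 hb] := testfun_radius tb.
  have [A A0 hA] := testfun_bounded ta; have [B B0 hB] := testfun_bounded tb.
  have [|||I1 I2] := @bounded_fubini m L (fun x y => a x * b (e *: x + y)) (A * B) (ra + rb) lm lL.
  - by apply: measurable_shear; exact: testfun_continuous.
  - by move=> x y; rewrite normrM ler_pM.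
  - move=> x y H; have [xr|xr] := ltP ra `|x|; first by rewrite ha// mul0r.
    rewrite [b _]hb ?mulr0//; case: H => [|yr]; first by lra.
    have := lerB_normD y (e *: x); rewrite [y + _]addrC normrZ e1 mul1r; lra.
  split=> //; rewrite -I2.
  rewrite mulrC -rintZ//; apply: eq_rint => x; rewrite mulrC -[X in _ * X = _](leb_shift_int (e *: x) tb).
  rewrite -rintZ//; last exact: testfun_shift.
  by apply: eq_rint => y; rewrite addrC.
have tN := testfunN tp.
have [e1 e2] : `|1 : R| = 1 /\ `|-1 : R| = 1 by rewrite normrN normr1.
have [Ia Ea] := S m0 _ _ 1 l0 e1 tp tp0; have [Ib Eb] := S m1 _ _ 1 l1 e1 tp tp0.
have [Ic Ec] := S m0 _ _ (-1) l0 e2 tp0 tN; have [Id Ed] := S m1 _ _ (-1) l1 e2 tp0 tN.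
rewrite !rep// !mulrBl Ea Eb Ec Ed; apply: int_real_add4 => // y.
have c1 : continuous (fun x : V => phi0 (1 *: x + y)).
  under eq_fun do rewrite scale1r; exact: (testfun_continuous (testfun_shift y tp0)).
(* For fixed [y] the two inner integrands are translates of each other by [y], so [nu] takes the
   same value on them. *)
have E2 : (fun x => phi0 x * phi (- (-1 *: x + y))) = (fun x => phi (x - y) * phi0 x).
  by apply/funext => x; rewrite scaleN1r opprD opprK mulrC.
have c2 : testfun (fun x => phi (x - y) * phi0 x).
  apply: testfunM; [exact: testfun_shift|exact: testfun_continuous].
rewrite -rep ?E2 -?rep//; last exact: testfunM.
rewrite -(inv _ y c2); congr (nu _); apply/funext => x; by rewrite addrK scale1r.
Qed.

End BoundedFubini.

(** * The quadratic part of a valuation *)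

Section QuadraticForms.
Variables (R : realType) (n k : nat).
Local Notation V := 'rV[R]_n.
Variable J : (V -> R) -> (V -> R) -> R.
Hypothesis lJ : lfun k J.

Definition bump (x : V) : R := Num.max 0 (1 - `|x|).

Lemma testfun_bump : testfun bump.
Proof.
split; last by exists 1 => x x1; rewrite /bump max_l// subr_le0 ltW.
apply: cont_max; first exact: cont_cst.
by apply: contB; [exact: cont_cst|move=> x; exact: norm_continuous].
Qed.

Lemma bump_ge0 x : 0 <= bump x. Proof. by rewrite le_max lexx. Qed.

(** Near 0 the integrand is at least [1 / 2], on a ball of positive volume. *)
Lemma leb_bump_comp (h : V -> V) : h 0 = 0 -> continuous h -> testfun (fun x => bump (h x)) ->
  0 < int_real (leb R n) (fun x => bump (h x)).
Proof.
move=> h0 ch tb.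
have [r r0 hr] : exists2 r : R, 0 < r & forall x, `|x| <= r -> `|h x| <= 2^-1.
  have /(@cvgrPdist_lt _ _ _ (nbhs (0 : V)))/(_ 2^-1) := ch 0; rewrite invr_gt0 ltr0n => /(_ isT)/nbhs_ballP[e /= e0 he].
  exists (e / 2) => [|x xe]; first by rewrite divr_gt0.
  have := he x; rewrite /= h0 sub0r normrN => hx; apply/ltW/hx.
  rewrite -ball_normE /= sub0r normrN (le_lt_trans xe)// ltr_pdivrMr// ltr_pMr// ltr1n//.
have lL := @leb_locfin R n.
pose D := [set x : V | `|x| <= r].
have mD : measurable (D : set (Borel R n)) by exact: cball_borel.
have : (0 < 2^-1%:E * leb R n D)%E.
  by rewrite leb_cball ?ltW// -EFinM lte_fin mulr_gt0 ?invr_gt0// exprn_gt0// addr_gt0.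
move=> H; rewrite /int_real -lte_fin fineK; last first.
  by apply: integrable_fin_num => //; exact: (testfun_integrable lL tb).
apply: (lt_le_trans H).
have -> : leb R n D = (\int[leb R n]_(x in setT) (\1_D x)%:E)%E by rewrite integral_indic// setIT.
rewrite -ge0_integralZl//; last first.
  by apply/measurable_EFinP.
apply: ge0_le_integral => //.
- by apply: measurable_funeM; apply/measurable_EFinP.
- by apply/measurable_EFinP; apply: continuous_borel; exact: testfun_continuous.
move=> x _; rewrite -EFinM lee_fin indicE.
have [Dx|Dx] := pselect (D x); last by rewrite memNset// mulr0 bump_ge0.
rewrite mem_set//= mulr1 /bump le_max; apply/orP; right; have := hr x Dx; lra.
Qed.

Lemma bump_int_gt0 : 0 < int_real (leb R n) bump.
Proof. by apply: (@leb_bump_comp id) => //; [move=> x; exact: cvg_id|exact: testfun_bump]. Qed.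

Lemma qm_shift m (M : 'M[R]_(m, n)) y : exists v c, forall x, qm M (x + y) = qm M x + (dotp v x + c).
Proof.
exists (\sum_i (2 * dotp (row i M) y) *: row i M); exists (qm M y) => x.
have -> : dotp (\sum_i (2 * dotp (row i M) y) *: row i M) x = \sum_i 2 * dotp (row i M) y * dotp (row i M) x.
  elim/big_ind2 : _ => [|? ? ? ? <- <-|i _]; [exact: dotp0l|by rewrite dotpDl|by rewrite dotpZl].
rewrite /qm -!big_split; apply: eq_bigr => i _ /=; rewrite /sq dotpDr; ring.
Qed.

(** Translating [qm M] changes it by an affine function, so its pairing is translation invariant and
    [invariant_proportional] applies. *)
Lemma J_qm m (M : 'M[R]_(m, n)) phi : testfun phi ->
  J (qm M) phi = J (qm M) bump / int_real (leb R n) bump * int_real (leb R n) (fun y => phi (- y)).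
Proof.
move=> tp; have cq := convexf_qm M.
have [m0 [m1 [l0 l1 rep]]] := lf_rep lJ cq.
have := invariant_proportional l0 l1 rep _ tp testfun_bump.
rewrite mulrAC => <-; first by rewrite mulfK// gt_eqF// bump_int_gt0.
move=> psi h tpsi; have [v [c e]] := qm_shift M (- h).
have := lf_trans lJ (- h) cq tpsi; rewrite opprK => <-.
under eq_fun do rewrite e.
exact: (lf_aff lJ).
Qed.

Lemma sq0l (x : V) : sq 0 x = 0.
Proof. by rewrite /sq dotp0l expr0n. Qed.

Lemma J_qm_face m (M : 'M[R]_(m, n)) i phi : testfun phi -> (m <= k)%N ->
  J (fun x => \sum_(j < m | j != i) sq (row j M) x) phi = 0.
Proof.
case: m M i => [|m] M i tp mk; first by case: i.
have -> : (fun x => \sum_(j < m.+1 | j != i) sq (row j M) x) =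
    (fun x => \sum_(j < m.+1) (j != i)%:R * sq (row j M) x).
  by apply/funext => x; rewrite big_mkcond; apply: eq_bigr => j _; case: ifP; rewrite ?mul1r ?mul0r.
rewrite (@sum_face _ _ _ _ _ i); last by rewrite eqxx.
apply: (ridges_lt lJ) => // j; apply: adir_scale => //; exact: (adir_sq lJ).
Qed.

(** Quadraticity is [Q_quad], whose base value vanishes by [J_qm_face]. For the rotation, the rows
    [v + w], [v - w] and the rows [sqrt 2 v], [sqrt 2 w] have the same sum of squares. *)
Lemma Qax_J : Qax (fun M : 'M[R]_(k, n) => J (qm M) bump).
Proof.
have tb := testfun_bump.
have quad (M : 'M[R]_(k, n)) i : exists b : 'I_n -> 'I_n -> R, forall v,
    J (qm (setrow M i v)) bump = \sum_a \sum_c v ord0 a * v ord0 c * b a c.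
  pose f x := \sum_(j < k | j != i) sq (row j M) x.
  have cf : convexf f.
    rewrite (_ : f = qm (setrow M i 0)); first exact: convexf_qm.
    by apply/funext => x; rewrite qm_setrow [X in _ + X]sq0l addr0.
  pose G v := J (fun x => f x + sq v x) bump - J f bump.
  exists (fun a b => polar G (delta_mx ord0 a) (delta_mx ord0 b)) => v.
  rewrite -(Q_quad lJ tb cf) J_qm_face// subr0; congr (J _ _).
  by apply/funext => x; rewrite qm_setrow.
have scale2 (M : 'M[R]_(k, n)) i (s : R) v : J (qm (setrow M i (s *: v))) bump = s ^+ 2 * J (qm (setrow M i v)) bump.
  have [b hb] := quad M i; rewrite !hb mulr_sumr; apply: eq_bigr => a _; rewrite mulr_sumr.
  by apply: eq_bigr => c _; rewrite !mxE; ring.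
split; first exact: quad.
- move=> M i j v w ij; pose s : R := Num.sqrt 2.
  rewrite (_ : qm _ = qm (setrow (setrow M i (s *: v)) j (s *: w))).
    have S : s ^+ 2 = 2 by rewrite sqr_sqrtr.
    have ji : j != i by rewrite eq_sym.
    by rewrite scale2 setrowC// scale2 setrowC// S; ring.
  apply/funext => x; rewrite !qm_setrow (bigD1 i)//= [in RHS](bigD1 i)//= !row_setrow eqxx.
  have S : s ^+ 2 = 2 by rewrite sqr_sqrtr.
  rewrite addrAC [in RHS]addrAC; congr (_ + _); last first.
    by apply: eq_bigr => l /andP[_ /negbTE li]; rewrite !row_setrow li.
  rewrite /sq !dotpZl dotpDl dotpBl !exprMn S; ring.
- move=> M s; congr (J _ _); apply/funext => x; rewrite /qm [RHS](reindex_inj (@perm_inj _ s)).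
  apply: eq_bigr => i _; congr (sq _ x); by apply/rowP => b; rewrite !mxE.
Qed.

End QuadraticForms.

(** * From squares to hinges *)

Section HingeFromSquare.
Variables (R : realType) (n k : nat).
Local Notation V := 'rV[R]_n.

(** Only [x] is confined to the ball: compactness is used for [x], against a displacement [z] near
    0. *)
Lemma continuous_unif_ball (g : V -> R) (r e : R) : continuous g -> 0 < e ->
  exists2 d, 0 < d & forall x y, `|x| <= r -> `|y - x| < d -> `|g y - g x| < e.
Proof.
move=> cg e0; have /compact_near_coveringP K := @cball_compact R n r.
have [|d /= d0 hd] := (nbhs_ballP _ _).1 (K _ (nbhs (0 : V)) (fun z x => `|g (x + z) - g x| < e) _ _).
  move=> x _; have e2 : 0 < e / 2 by rewrite divr_gt0.
  have /(@cvgrPdist_lt _ _ _ (nbhs x))/(_ _ e2)/nbhs_ballP[d /= d0 hd] := cg x.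
  have d2 : 0 < d / 2 by rewrite divr_gt0.
  exists (ball x (d / 2), ball (0 : V) (d / 2)) => /=; first by split; exact: nbhsx_ballx.
  move=> [y z] /= [xy z0].
  have h1 : `|g x - g y| < e / 2.
    by apply: hd; apply: le_ball xy; rewrite ler_pdivrMr// ler_pMr// ler1n.
  have h2 : `|g x - g (y + z)| < e / 2.
    apply: hd; rewrite -ball_normE /=; move: xy z0; rewrite -!ball_normE /= sub0r normrN => xy z0.
    rewrite opprD addrA (le_lt_trans (ler_normB _ _))//; lra.
  rewrite (_ : _ - _ = (g x - g y) - (g x - g (y + z))); last by ring.
  rewrite (le_lt_trans (ler_normB _ _))//; lra.
exists d => // x y xr yx; have := hd (y - x) _ x xr; rewrite [x + _]addrC subrK; apply.
by rewrite -ball_normE /= sub0r normrN.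
Qed.

Lemma rint_bound (m : {measure set Borel R n -> \bar R}) (r : R) : locfin m ->
  exists2 K, 0 <= K & forall h B, testfun h -> 0 <= B -> (forall x, `|h x| <= B) ->
    (forall x, r < `|x| -> h x = 0) -> `|int_real m h| <= K * B.
Proof.
move=> lm; pose D : set (Borel R n) := [set x : V | `|x| <= r].
exists (fine (m D)); first exact: fine_ge0.
move=> h B th B0 hB h0; have mD : measurable D by exact: cball_borel.
have fD : m D \is a fin_num by rewrite ge0_fin_numE//; exact: lm.
have Ih := testfun_integrable lm th.
have le : (`|\int[m]_x (h x)%:E| <= m D * B%:E)%E.
  apply: (le_trans (le_abse_integral _ _ _)) => //; first exact: (measurable_int _ Ih).
  have -> : (m D * B%:E = \int[m]_(x in setT) (B%:E * (\1_D x)%:E))%E.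
    rewrite ge0_integralZl//; last exact/measurable_EFinP.
    by rewrite integral_indic// setIT muleC.
  apply: ge0_le_integral => //.
  - by apply: measurableT_comp => //; exact: (measurable_int _ Ih).
  - by apply: measurable_funeM; exact/measurable_EFinP.
  move=> x _; rewrite /= -EFinM lee_fin indicE.
  have [Dx|/negP] := pselect (D x); first by rewrite mem_set//= mulr1.
  by rewrite -ltNge => /h0 ->; rewrite normr0 mulr_ge0.
rewrite /int_real; have fI : (\int[m]_x (h x)%:E)%E \is a fin_num by exact: integrable_fin_num.
move: le; rewrite -{1}(fineK fI) -(fineK fD) /=; first by rewrite -EFinM lee_fin.
Qed.

Lemma continuous_rV (T : topologicalType) m (h : T -> 'rV[R]_m) :
  (forall i, continuous (fun t => h t ord0 i)) -> continuous h.
Proof.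
move=> ch t; apply/(@cvg_ballP _ _ _ (nbhs t)) => e e0.
have H : \forall t' \near t, forall i, ball (h t ord0 i) e (h t' ord0 i).
  apply: filter_forall => i; exact: (cvg_ball (ch i t) e0).
apply: filterS H => t' ht'; split => // i j; rewrite (ord1 i); exact: ht'.
Qed.

Lemma lu1_pointwise (p_ : nat -> R -> R) p s : lu1 p_ p -> (fun j => p_ j s) @ \oo --> p s.
Proof.
move=> h; apply/cvgrPdist_lt => e e0; have [N hN] := h `|s| e e0.
by exists N => // j /= Nj; rewrite distrC; apply: hN.
Qed.

Variable J : (V -> R) -> (V -> R) -> R.
Hypothesis lJ : lfun k J.
Implicit Types (f g phi : V -> R) (v : V) (c : R).

Lemma lf_bound f r : convexf f -> exists2 K, 0 <= K & forall h B, testfun h -> 0 <= B ->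
  (forall x, `|h x| <= B) -> (forall x, r < `|x| -> h x = 0) -> `|J f h| <= K * B.
Proof.
move=> cf; have [m0 [m1 [l0 l1 rep]]] := lf_rep lJ cf.
have [K0 K00 h0] := rint_bound r l0; have [K1 K10 h1] := rint_bound r l1.
exists (K0 + K1); first exact: addr_ge0.
move=> h B th B0 hB hr; rewrite rep// (le_trans (ler_normB _ _))// mulrDl lerD//; [exact: h0|exact: h1].
Qed.

Definition dJ f v c phi := J (fun x => f x + hinge v c x) phi - J f phi.

Lemma convexf_add_hinge f v c : convexf f -> convexf (fun x => f x + hinge v c x).
Proof. by move=> cf; apply: convexfD => //; exact: convexf_hinge. Qed.

Lemma dJ_add f v c g h : convexf f -> testfun g -> testfun h ->
  dJ f v c (fun x => g x + h x) = dJ f v c g + dJ f v c h.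
Proof.
move=> cf tg th; have cfh := @convexf_add_hinge f v c cf.
by rewrite /dJ !(lf_addphi lJ)//; ring.
Qed.

Lemma dJ_scale f v c a g : convexf f -> testfun g -> dJ f v c (fun x => a * g x) = a * dJ f v c g.
Proof.
move=> cf tg; have cfh := @convexf_add_hinge f v c cf.
by rewrite /dJ !(lf_scalephi lJ)//; ring.
Qed.

Definition ramp (s : R) : R := Num.min 1 (Num.max 0 s).

Lemma ramp01 s : 0 <= ramp s <= 1.
Proof. by rewrite /ramp le_min ler01 le_max lexx /= ge_min lexx. Qed.

Lemma ramp_ge1 s : 1 <= s -> ramp s = 1.
Proof. by move=> s1; rewrite /ramp min_l// le_max s1 orbT. Qed.

Lemma ramp_le0 s : s <= 0 -> ramp s = 0.
Proof. by move=> s1; rewrite /ramp max_l// min_r. Qed.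

Lemma cont_ramp_dotp v a b : continuous (fun x : V => ramp (a * (dotp v x - b))).
Proof.
apply: cont_min; first exact: cont_cst.
apply: cont_max; first exact: cont_cst.
by apply: contZ; apply: contB; [exact: dotp_continuous|exact: cont_cst].
Qed.

(* The difference measure lives on the hyperplane where the hinge breaks. *)
Lemma dJ_hyperplane f v c g : convexf f -> testfun g ->
  (forall e, 0 < e -> exists2 d, 0 < d & forall x, `|dotp v x - c| < d -> `|g x| <= e) ->
  dJ f v c g = 0.
Proof.
move=> cf tg gs; have [r r0 hr] := testfun_radius tg.
have cfh := @convexf_add_hinge f v c cf.
have [K0 K00 h0] := lf_bound r cf; have [K1 K10 h1] := lf_bound r cfh.
apply/eqP; rewrite -normr_le0; apply/ler_addgt0Pl => e e0; rewrite addr0.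
pose e' := e / (K1 + K0 + 1).
have K1p : 0 < K1 + K0 + 1 by lra.
have e'0 : 0 < e' by rewrite divr_gt0.
have [d d0 hd] := gs e' e'0.
(* [tp] and [tm] isolate the two sides of the hyperplane, where the hinge is affine or zero; the
   remainder [g3] lives in the slab of half-width [d], where [g] is small. *)
pose tp x := ramp (d^-1 * (dotp v x - c)); pose tm x := ramp (- d^-1 * (dotp v x - c)).
have cp : continuous tp by exact: cont_ramp_dotp.
have cm : continuous tm by exact: cont_ramp_dotp.
pose g3 x := g x * (1 - tp x - tm x).
have t1 : testfun (fun x => g x * tp x) by exact: testfunM.
have t2 : testfun (fun x => g x * tm x) by exact: testfunM.
have t3 : testfun g3 by apply: testfunM => //; apply: contB => //; apply: contB => //; exact: cont_cst.
have -> : g = (fun x => (g x * tp x + g x * tm x) + g3 x) by apply/funext => x; rewrite /g3; ring.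
rewrite dJ_add//; last exact: testfunD.
rewrite dJ_add//.
have -> : dJ f v c (fun x => g x * tp x) = 0.
  apply/eqP; rewrite subr_eq0; apply/eqP.
  apply: (lf_local_aff lJ (y := v) (c := - c) (U := [set x | c < dotp v x])) => //.
  - have := open_comp (fun x _ => @dotp_continuous R n v x) (@open_gt R c); exact.
  - by move=> x /= cx; rewrite /hinge max_r// subr_ge0 ltW.
  - move=> x; rewrite /= ltNge; apply: contra => xc; apply/eqP.
    by rewrite /tp ramp_le0 ?mulr0// mulr_ge0_le0 ?subr_le0 ?invr_ge0 ?(ltW d0).
have -> : dJ f v c (fun x => g x * tm x) = 0.
  apply/eqP; rewrite subr_eq0; apply/eqP.
  apply: (lf_loc lJ (U := [set x | dotp v x < c])) => //.
  - have := open_comp (fun x _ => @dotp_continuous R n v x) (@open_lt R c); exact.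
  - by move=> x /= cx; rewrite /hinge max_l ?addr0// subr_le0 ltW.
  - move=> x; rewrite /= ltNge; apply: contra => xc; apply/eqP.
    by rewrite /tm ramp_le0 ?mulr0// mulNr oppr_le0 mulr_ge0 ?subr_ge0 ?invr_ge0 ?(ltW d0).
rewrite !add0r.
have g3e x : `|g3 x| <= e'.
  rewrite /g3; have [xd|xd] := ltP `|dotp v x - c| d.
    rewrite normrM -[e']mulr1 ler_pM//; first exact: hd.
    have := ramp01 (d^-1 * (dotp v x - c)); have := ramp01 (- d^-1 * (dotp v x - c)).
    rewrite -/(tp x) -/(tm x) => /andP[a1 a2] /andP[b1 b2].
    rewrite ler_norml; apply/andP; split; lra.
  suff -> : 1 - tp x - tm x = 0 by rewrite mulr0 normr0 ltW.
  move: xd; rewrite ler_normr => /orP[xd|xd].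
    rewrite /tp ramp_ge1; last by rewrite mulrC ler_pdivlMr// mul1r.
    rewrite /tm ramp_le0 ?subrr ?subr0//; rewrite mulNr oppr_le0 mulr_ge0 ?invr_ge0 ?(ltW d0)//; lra.
  rewrite /tm ramp_ge1; last by rewrite mulNr -mulrN mulrC ler_pdivlMr// mul1r.
  rewrite /tp ramp_le0 ?subr0 ?subrr//; rewrite mulr_ge0_le0 ?invr_ge0 ?(ltW d0)//; lra.
have g3r x : r < `|x| -> g3 x = 0 by move=> /hr gx; rewrite /g3 gx mul0r.
have := h0 _ _ t3 (ltW e'0) g3e g3r; have := h1 _ _ t3 (ltW e'0) g3e g3r => a1 a2.
rewrite /dJ (le_trans (ler_normB _ _))// (le_trans (lerD a1 a2))//.
rewrite -mulrDl /e' mulrCA ler_piMr ?ltW//; rewrite ltr_pdivrMr//; lra.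
Qed.

Lemma dJ_eq f v c g h : convexf f -> testfun g -> testfun h ->
  (forall e, 0 < e -> exists2 d, 0 < d & forall x, `|dotp v x - c| < d -> `|g x - h x| <= e) ->
  dJ f v c g = dJ f v c h.
Proof.
move=> cf tg th gh; have thN : testfun (fun x => -1 * h x) by exact: testfunZ.
have : dJ f v c (fun x => g x + -1 * h x) = 0.
  apply: dJ_hyperplane => //; first exact: testfunD.
  by move=> e /gh[d d0 hd]; exists d => // x xd; rewrite mulN1r; exact: hd.
by rewrite dJ_add// dJ_scale// => ?; lra.
Qed.

(** [f] is constant along [w], so a translation by [c *: w] moves only the break point. *)
Lemma dJ_shift f v w c phi : convexf f -> dotp v w = 1 -> (forall x t, f (x + t *: w) = f x) ->
  testfun phi -> dJ f v c phi = dJ f v 0 (fun x => phi (x + c *: w)).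
Proof.
move=> cf vw fw tp; rewrite /dJ; have T h : convexf h -> J h (fun x => phi (x + c *: w)) = J (fun z => h (z - c *: w)) phi.
  by move=> ch; rewrite (lf_trans lJ)//; congr (J _ _); apply/funext => x; rewrite opprK.
rewrite !T//; last exact: convexf_add_hinge.
congr (J _ _ - J _ _); apply/funext => x; rewrite -scaleNr fw//.
by rewrite /hinge dotpDr dotpZr vw mulr1 subr0.
Qed.

Definition tent (s : R) : R := Num.max 0 (1 - `|s|).

Lemma tent_lip s t : `|tent s - tent t| <= `|s - t|.
Proof.
apply: le_trans (ler_dist_dist s t); rewrite /tent ler_norml.
have := ler_norm (`|s| - `|t|); have := lerNnormlW (lexx `| `|s| - `|t| |).
by case: (leP (1 - `|s|) 0) => ?; case: (leP (1 - `|t|) 0) => ?; rewrite ?max_l ?max_r//; try lra;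
  move=> ? ?; apply/andP; split; lra.
Qed.

Lemma tent_ge0 s : 0 <= tent s. Proof. by rewrite le_max lexx. Qed.
Lemma tent_le1 s : tent s <= 1. Proof. by rewrite ge_max ler01/= lerBlDr lerDl. Qed.
Lemma tent0 : tent 0 = 1. Proof. by rewrite /tent normr0 subr0 max_r. Qed.

(** The second difference of a hinge at -1, 0, 1, as a function of its break point, is the tent
    function; the affine part cancels. *)
Lemma tent_second_difference a b (l : seq (R * R)) :
  \sum_(q <- l) q.1 * tent q.2 = pl a b l 1 + pl a b l (- 1) - 2 * pl a b l 0.
Proof.
rewrite /pl [RHS](_ : _ = \sum_(q <- l) q.1 * Num.max 0 (1 - q.2) +
  \sum_(q <- l) q.1 * Num.max 0 (- 1 - q.2) - 2 * \sum_(q <- l) q.1 * Num.max 0 (0 - q.2)); last by ring.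
rewrite mulr_sumr -big_split -sumrB; apply: eq_bigr => q _ /=.
rewrite mulrCA -mulrDr -mulrBr; congr (_ * _); rewrite /tent /Num.max.
case: (lerP 0 q.2) => h; first rewrite ger0_norm//; last rewrite ltr0_norm//;
  repeat case: ltrP => ?; lra.
Qed.

Lemma conv1_hinge c : conv1 (fun s : R => Num.max 0 (s - c)).
Proof.
move=> s t u /andP[u0 u1]; rewrite ge_max; apply/andP; split.
  by rewrite addr_ge0// mulr_ge0// ?subr_ge0// le_max lexx.
have h1 : u * (s - c) <= u * Num.max 0 (s - c) by rewrite ler_wpM2l// le_max lexx orbT.
have h2 : (1 - u) * (t - c) <= (1 - u) * Num.max 0 (t - c) by rewrite ler_wpM2l ?subr_ge0// le_max lexx orbT.
lra.
Qed.

Lemma dJ_hsum f v l phi : convexf f -> testfun phi -> all (fun q : R * R => 0 <= q.1) l ->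
  J (fun x => f x + hsum v l x) phi - J f phi = \sum_(q <- l) q.1 * dJ f v q.2 phi.
Proof.
move=> cf tp; elim/last_ind: l => [|l q IH].
  move=> _; rewrite big_nil; apply/eqP; rewrite subr_eq0; apply/eqP; congr (J _ _).
  by apply/funext => x; rewrite /hsum big_nil addr0.
rewrite all_rcons => /andP[q0 al]; rewrite -cats1 big_cat big_seq1 -IH//= cats1.
have [_ h] := adir_ridge lJ v (conv1_hinge q.2); have := h f phi q.1 cf tp q0.
have := hsum_hinge_add lJ v q.2 cf tp al q0.
have -> : (fun x => f x + hsum v (rcons l q) x) = (fun x => f x + hsum v l x + q.1 * hinge v q.2 x).
  by apply/funext => x; rewrite hsum_rcons addrA.
rewrite /dJ /hinge; lra.
Qed.

(** The square is a limit of hinge sums with nonnegative weights. Tested against [psi], a hinge with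
    break point [c] has [tent c] times the effect of the one with break point 0, and these weights
    add up to a second difference tending to 2. So the effect at break point 0 vanishes, and by
    translation along [w] at every break point. *)
Lemma hinge_from_sq f v w : convexf f -> dotp v w = 1 -> (forall x t, f (x + t *: w) = f x) ->
  (forall phi, testfun phi -> J (fun x => f x + sq v x) phi = J f phi) ->
  forall c phi, testfun phi -> J (fun x => f x + hinge v c x) phi = J f phi.
Proof.
move=> cf vw fw fs.
suff H0 phi : testfun phi -> dJ f v 0 phi = 0.
  move=> c phi tp; apply/eqP; rewrite -subr_eq0 -/(dJ f v c phi) (dJ_shift c cf vw fw tp) H0//.
  exact: testfun_shift.
(* Projection along [w] onto the hyperplane where [v] vanishes. *)
move=> tp; pose P x := x - dotp v x *: w.
have Pc : continuous P.
  apply: continuous_rV => i; under eq_fun do rewrite !mxE.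
  apply: contB; last by apply: contM; [exact: dotp_continuous|exact: cont_cst].
  by rewrite (_ : (fun _ => _) = dotp (delta_mx ord0 i)); [exact: dotp_continuous|apply/funext => x; rewrite dotp_delta].
have PE x : `|P x - x| = `|dotp v x| * `|w| by rewrite /P addrAC subrr sub0r normrN normrZ.
have [r r0 hr] := testfun_radius tp; have [M M0 hM] := testfun_bounded tp.
have tentc : continuous (fun x : V => tent (dotp v x)).
  apply: cont_max; first exact: cont_cst.
  by apply: contB; [exact: cont_cst|apply: cont_abs; exact: dotp_continuous].
have far x : r + `|w| < `|x| -> `|dotp v x| < 1 -> phi (P x) = 0.
  move=> rx x1; apply: hr; have := ler_distD 0 (P x) x; rewrite subr0 sub0r normrN.
  have := lerB_dist x (P x); rewrite distrC PE => h1 _.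
  have : `|dotp v x| * `|w| <= `|w| by rewrite ler_piMl// ltW.
  lra.
(* [psi] agrees with [phi] on that hyperplane and is a product in the splitting along [w], so moving
   the hyperplane to height [c] multiplies it by [tent c]. *)
pose psi x := phi (P x) * tent (dotp v x).
have tpsi : testfun psi.
  split; first by apply: contM => //; apply: cont_comp => //; exact: testfun_continuous.
  exists (r + `|w|) => x rx; rewrite /psi; have [x1|x1] := ltP `|dotp v x| 1; first by rewrite far ?mul0r.
  by rewrite /tent max_l ?mulr0// subr_le0.
have Pw x c : P (x + c *: w) = P x.
  by rewrite /P dotpDr dotpZr vw mulr1 scalerDl opprD addrACA subrr addr0.
have E : dJ f v 0 phi = dJ f v 0 psi.
  apply: dJ_eq => // e e0; have e2 : 0 < e / 2 by rewrite divr_gt0.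
  have [d d0 hd] := continuous_unif_ball (r + `|w|) (testfun_continuous tp) e2.
  exists (Num.min 1 (Num.min (d / (`|w| + 1)) (e / 2 / (M + 1)))).
    by rewrite !lt_min ltr01 !divr_gt0// ltr_pwDr.
  move=> x; rewrite subr0 !lt_min => /and3P[x1]; rewrite !ltr_pdivlMr ?ltr_pwDr// => xd xM.
  have [xr|xr] := ltP (r + `|w|) `|x|.
    rewrite /psi far// mul0r subr0 hr ?normr0 ?ltW//.
    by apply: le_lt_trans xr; rewrite lerDl.
  have tb : `|1 - tent (dotp v x)| <= `|dotp v x|.
    by have := tent_lip 0 (dotp v x); rewrite tent0 sub0r normrN.
  rewrite (_ : _ - _ = - (phi (P x) - phi x) + phi (P x) * (1 - tent (dotp v x))); last by rewrite /psi; ring.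
  apply: (le_trans (ler_normD _ _)); rewrite normrN normrM.
  have h1 : `|phi (P x) - phi x| < e / 2.
    by apply: hd => //; rewrite PE; apply: le_lt_trans xd; rewrite mulrDr mulr1 lerDl.
  have h2 : `|phi (P x)| * `|1 - tent (dotp v x)| <= M * `|dotp v x| by exact: ler_pM.
  have h3 : `|dotp v x| * (M + 1) = M * `|dotp v x| + `|dotp v x| by ring.
  have := normr_ge0 (dotp v x); lra.
have Ec c : dJ f v c psi = tent c * dJ f v 0 psi.
  rewrite (dJ_shift c cf vw fw tpsi) -dJ_scale//; apply: dJ_eq => //.
  - exact: testfun_shift.
  - exact: testfunZ.
  move=> e e0; exists (e / (2 * M + 1)); first by rewrite divr_gt0// ltr_pwDr// mulr_ge0.
  move=> x; rewrite subr0 ltr_pdivlMr ?ltr_pwDr ?mulr_ge0// => xd.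
  rewrite /psi Pw dotpDr dotpZr vw mulr1; set s := dotp v x in xd *.
  rewrite (_ : _ - _ = phi (P x) * ((tent (s + c) - tent c) + tent c * (tent 0 - tent s))); last by rewrite tent0; ring.
  have h1 := tent_lip (s + c) c; have h2 := tent_lip 0 s; rewrite addrK in h1; rewrite sub0r normrN in h2.
  have h3 : `|tent c * (tent 0 - tent s)| <= `|s|.
    by rewrite normrM ger0_norm ?tent_ge0// (le_trans _ h2)// ler_piMl// tent_le1.
  have h4 : `|(tent (s + c) - tent c) + tent c * (tent 0 - tent s)| <= 2 * `|s|.
    by apply: (le_trans (ler_normD _ _)); lra.
  rewrite normrM; have := ler_pM (normr_ge0 _) (normr_ge0 _) (hM (P x)) h4.
  have := normr_ge0 s; nra.
have [a [b [l [al hl]]]] := conv1_pl (@conv1_sq R).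
have L1 : (fun j => J (fun x => f x + pl (a j) (b j) (l j) (dotp v x)) psi - J f psi) @ \oo --> (0 : R).
  have -> : (0 : R) = J (fun x => f x + sq v x) psi + - J f psi by rewrite fs// subrr.
  apply: seq_cvgD; last exact: seq_cvg_cst.
  apply: (lf_cont lJ) => //.
  - move=> j; apply: convexfD => //; under [X in convexf X]eq_fun do rewrite pl_hsum.
    by apply: convexfD; [exact: convexf_hsum|exact: convexf_aff].
  - by apply: convexfD => //; exact: convexf_sq.
  - exact: (lu_cvgD (@lu_cst _ _ f) (lu_ridge v hl)).
(* The second difference of [s ^ 2] at -1, 0, 1 is 2. *)
have L2 : (fun j => (pl (a j) (b j) (l j) 1 + pl (a j) (b j) (l j) (- 1) - 2 * pl (a j) (b j) (l j) 0) * dJ f v 0 psi) @ \oo --> (2 * dJ f v 0 psi : R).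
  have h1 := lu1_pointwise (s := 1 : R) hl; have h2 := lu1_pointwise (s := - 1 : R) hl.
  have h3 := lu1_pointwise (s := 0 : R) hl; rewrite /= in h1 h2 h3.
  rewrite [X in _ --> X](_ : _ = ((1 ^+ 2 + (- 1) ^+ 2) + - 2 * 0 ^+ 2) * dJ f v 0 psi); last by ring.
  apply: seq_cvgM; last exact: seq_cvg_cst.
  under eq_fun do rewrite -mulNr.
  by apply: seq_cvgD; [apply: seq_cvgD|apply: seq_cvgM => //; exact: seq_cvg_cst].
rewrite E; suff : 0 = 2 * dJ f v 0 psi by lra.
apply: (seq_lim_eq L1 L2) => j; rewrite -tent_second_difference mulr_suml.
have <- : J (fun x => f x + hsum v (l j) x) psi = J (fun x => f x + pl (a j) (b j) (l j) (dotp v x)) psi.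
  rewrite -[LHS](lf_aff lJ (a j *: v) (b j))//; last by apply: convexfD => //; exact: convexf_hsum.
  by congr (J _ _); apply/funext => x; rewrite pl_hsum !addrA.
by rewrite dJ_hsum//; apply: eq_bigr => q _; rewrite Ec mulrA.
Qed.

End HingeFromSquare.

(** In rank normal form the perturbation adds [e > 0] to the [k] diagonal entries, each 0 or 1. *)
Lemma row_free_perturb (R : realType) k n (M : 'M[R]_(k, n)) : (k <= n)%N ->
  exists N : 'M[R]_(k, n), forall e, 0 < e -> row_free (M + e *: N).
Proof.
move=> kn; pose L := col_ebase M; pose U := row_ebase M; pose r := \rank M.
exists (L *m pid_mx k *m U) => e e0.
pose D : 'rV[R]_k := \row_i ((i < r)%:R + e).
have -> : M + e *: (L *m pid_mx k *m U) = L *m diag_mx D *m pid_mx k *m U.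
  rewrite -[X in X + _](mulmx_ebase M) -/L -/U -/r scalemxAl -mulmxDl; congr (_ *m U).
  rewrite scalemxAr -mulmxDr -mulmxA; congr (_ *m _); apply/matrixP => i j.
  rewrite mul_diag_mx !mxE.
  by rewrite mulrDl -!natrM !mulnb ltn_ord andbT [in LHS](andbC (val i == val j)) [e * _]mulrC mulrC.
apply/row_freeP; exists (invmx U *m pid_mx k *m invmx (L *m diag_mx D)).
have uD : diag_mx D \in unitmx.
  rewrite unitmxE det_diag unitfE; apply/prodf_neq0 => i _; rewrite mxE gt_eqF//.
  by rewrite ltr_wpDl// ler0n.
have uLD : L *m diag_mx D \in unitmx by rewrite unitmx_mul col_ebase_unit.
rewrite -!mulmxA (mulmxA U) mulmxV ?row_ebase_unit// mul1mx (mulmxA (pid_mx k)) pid_mx_id//.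
by rewrite pid_mx_1 mul1mx mulmxA mulmxV.
Qed.

(** * From hinges to sums of ridge functions *)

Section HingeTuples.
Variables (R : realType) (n k : nat).
Local Notation V := 'rV[R]_n.
Variable J : (V -> R) -> (V -> R) -> R.
Hypothesis lJ : lfun k J.
Implicit Types v : V.
Hypothesis kn : (k <= n)%N.
Hypothesis J0 : forall (M : 'M[R]_(k, n)) phi, testfun phi -> J (qm M) phi = 0.

Lemma ridges_face m (z : 'I_m -> V -> R) i phi : testfun phi -> (m <= k)%N ->
  (forall j, adir J (z j)) -> J (fun x => \sum_(j < m | j != i) z j x) phi = 0.
Proof.
case: m z i => [|m] z i tp mk az; first by case: i.
have -> : (fun x => \sum_(j < m.+1 | j != i) z j x) =
    (fun x => \sum_(j < m.+1) (j != i)%:R * z j x).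
  by apply/funext => x; rewrite big_mkcond; apply: eq_bigr => j _; case: ifP; rewrite ?mul1r ?mul0r.
rewrite (@sum_face _ _ _ _ _ i); last by rewrite eqxx.
by apply: (ridges_lt lJ) => // j; apply: adir_scale.
Qed.

Lemma adir_hinge v c : adir J (hinge v c).
Proof. exact: (adir_ridge lJ v (conv1_hinge c)). Qed.

(** Squares are exchanged for hinges one row at a time. A right inverse of [M] supplies [w] dual to
    row [t], along which all other summands are constant, as [hinge_from_sq] asks. *)
Lemma J_hinges_free (M : 'M[R]_(k, n)) c phi : row_free M -> testfun phi ->
  J (fun x => \sum_(i < k) hinge (row i M) (c i) x) phi = 0.
Proof.
move=> /row_freeP[W MW] tp.
pose z (m : nat) (i : 'I_k) : V -> R := if (i < m)%N then hinge (row i M) (c i) else sq (row i M).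
have az m i : adir J (z m i) by rewrite /z; case: ifP => _; [exact: adir_hinge|exact: (adir_sq lJ)].
suff H m : (m <= k)%N -> forall phi, testfun phi -> J (fun x => \sum_i z m i x) phi = 0.
  have := H k (leqnn k) phi tp; congr (J _ _ = 0); apply/funext => x.
  by apply: eq_bigr => i _; rewrite /z ltn_ord.
elim: m => [|m IH] mk {tp}phi tp; first exact: J0.
pose t := Ordinal mk; pose f x := \sum_(j < k | j != t) z m j x.
have zS j : j != t -> z m.+1 j = z m j.
  by move=> jt; rewrite /z ltnS leq_eqVlt; case: eqP => // e; case/eqP: jt; exact: val_inj.
have cf : convexf f.
  rewrite (_ : f = fun x => \sum_(j < k) (j != t)%:R * z m j x).
    by apply: convexf_sum => j; apply: convexfZ => //; case: (az m j).
  by apply/funext => x; rewrite /f big_mkcond; apply: eq_bigr => j _; case: ifP; rewrite ?mul1r ?mul0r.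
have f0 psi : testfun psi -> J f psi = 0 by move=> tpsi; apply: ridges_face.
pose w : V := (col t W)^T.
have dw j : dotp (row j M) w = (j == t)%:R.
  have := congr1 (fun A : 'M[R]_k => A j t) MW; rewrite !mxE => <-.
  by apply: eq_bigr => l _; rewrite !mxE.
have zt1 : z m.+1 t = hinge (row t M) (c t) by rewrite /z /= ltnSn.
have zt0 : z m t = sq (row t M) by rewrite /z /= ltnn.
have -> : (fun x => \sum_i z m.+1 i x) = fun x => f x + hinge (row t M) (c t) x.
  apply/funext => x; rewrite (bigD1 t)//= addrC zt1; congr (_ + _).
  by apply: eq_bigr => j jt; rewrite zS.
rewrite (hinge_from_sq lJ cf (w := w)) ?f0//; first by rewrite dw eqxx.
  move=> x s; apply: eq_bigr => j jt; rewrite /z; case: ifP => _.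
    by rewrite /hinge dotpDr dotpZr dw (negbTE jt) mulr0 addr0.
  by rewrite /sq dotpDr dotpZr dw (negbTE jt) mulr0 addr0.
move=> psi tpsi; rewrite f0// -(IH (ltnW mk) psi tpsi); congr (J _ _); apply/funext => x.
by rewrite [RHS](bigD1 t)//= addrC zt0.
Qed.

Lemma hinge_dir_lip v v' c x : `|hinge v' c x - hinge v c x| <= `|dotp (v' - v) x|.
Proof.
rewrite dotpBl /hinge ler_norml.
have := ler_norm (dotp v' x - dotp v x); have := lerNnormlW (lexx `|dotp v' x - dotp v x|).
by case: (leP (dotp v x - c) 0) => ?; case: (leP (dotp v' x - c) 0) => ?; rewrite ?max_l ?max_r//; try lra;
  move=> ? ?; apply/andP; split; lra.
Qed.

(** Dependent directions are limits of independent ones; this is where [k <= n] enters. *)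
Lemma J_hinges (v : 'I_k -> V) c phi : testfun phi ->
  J (fun x => \sum_(i < k) hinge (v i) (c i) x) phi = 0.
Proof.
move=> tp; pose M : 'M[R]_(k, n) := \matrix_(i, j) v i ord0 j.
have rM i : row i M = v i by apply/rowP => j; rewrite !mxE.
have [N hN] := row_free_perturb M kn.
pose h (j : nat) : R := j.+1%:R^-1.
have h0 j : 0 < h j by rewrite invr_gt0.
have L : (fun j => J (fun x => \sum_(i < k) hinge (row i (M + h j *: N)) (c i) x) phi) @ \oo -->
   J (fun x => \sum_(i < k) hinge (v i) (c i) x) phi.
  apply: (lf_cont lJ) => //.
  - by move=> j; apply: convexf_sum => i; exact: convexf_hinge.
  - by apply: convexf_sum => i; exact: convexf_hinge.
  apply: lu_cvg_sum => i; apply: lu_cvg_rate => r; exists (dotn (row i N) * r), 0%N => j _ x xr.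
  apply: (le_trans (hinge_dir_lip _ _ _ _)).
  rewrite linearD linearZ /= rM addrC addKr dotpZl normrM (ger0_norm (ltW (h0 j))) mulrC -/(h j) ler_pM2r//.
  by rewrite (le_trans (dotp_le _ _))// ler_wpM2l// dotn_ge0.
apply: (seq_lim_eq L (seq_cvg_cst 0)) => j; apply: J_hinges_free => //; exact: hN.
Qed.

(** Nonnegative multiples of hinges are hinges, so [ridges_gt] applies to this class. *)
Lemma J_hinge_sums m (v : 'I_m -> V) c phi : testfun phi ->
  J (fun x => \sum_(i < m) hinge (v i) (c i) x) phi = 0.
Proof.
move=> tp; pose Z (z : V -> R) := exists v c, z = hinge v c.
apply: (ridges_gt lJ (Z := Z)) => //; last by move=> i; exists (v i), (c i).
- by move=> z [v' [c' ->]]; exact: adir_hinge.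
- move=> z a a0 [v' [c' ->]]; exists (a *: v'), (a * c'); apply/funext => x.
  by rewrite /hinge dotpZl -mulrBr maxr_pMr// mulr0.
- move=> z Zz; have /choice[vc hvc] : forall i, exists q : V * R, z i = hinge q.1 q.2.
    by move=> i; have [v' [c' ->]] := Zz i; exists (v', c').
  rewrite (_ : (fun x => _) = fun x => \sum_(i < k) hinge (vc i).1 (vc i).2 x); first exact: J_hinges.
  by apply/funext => x; apply: eq_bigr => i _; rewrite hvc.
Qed.

(** The profiles are approximated by [pl] functions and the resulting hinge sums flattened into one
    list, each coefficient being absorbed into its hinge. *)
Lemma J_ridges m (p : 'I_m -> R -> R) (v : 'I_m -> V) phi : testfun phi -> (forall i, conv1 (p i)) ->
  J (fun x => \sum_(i < m) p i (dotp (v i) x)) phi = 0.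
Proof.
move=> tp cp.
have /choice[A hA] : forall i, exists q : (nat -> R) * (nat -> R) * (nat -> seq (R * R)),
    (forall j, all (fun q => 0 <= q.1) (q.2 j)) /\ lu1 (fun j => pl (q.1.1 j) (q.1.2 j) (q.2 j)) (p i).
  by move=> i; have [a [b [l h]]] := conv1_pl (cp i); exists (a, b, l).
have cpl j i : convexf (fun x => pl ((A i).1.1 j) ((A i).1.2 j) ((A i).2 j) (dotp (v i) x)).
  under [X in convexf X]eq_fun do rewrite pl_hsum.
  by apply: convexfD; [apply: convexf_hsum; case: (hA i)|exact: convexf_aff].
have L : (fun j => J (fun x => \sum_(i < m) pl ((A i).1.1 j) ((A i).1.2 j) ((A i).2 j) (dotp (v i) x)) phi) @ \oo -->
   J (fun x => \sum_(i < m) p i (dotp (v i) x)) phi.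
  apply: (lf_cont lJ) => //.
  - by move=> j; apply: convexf_sum.
  - by apply: convexf_sum => i; exact: convexf_ridge.
  apply: lu_cvg_sum => i; have [_ h] := hA i; exact: (lu_ridge (v i) h).
apply: (seq_lim_eq L (seq_cvg_cst 0)) => j.
pose hs x := \sum_(i < m) hsum (v i) ((A i).2 j) x.
have chs : convexf hs by apply: convexf_sum => i; apply: convexf_hsum; case: (hA i).
have -> : (fun x => \sum_(i < m) pl ((A i).1.1 j) ((A i).1.2 j) ((A i).2 j) (dotp (v i) x)) =
   fun x => hs x + (dotp (\sum_i (A i).1.1 j *: v i) x + \sum_i (A i).1.2 j).
  apply/funext => x; under eq_bigr do rewrite pl_hsum.
  rewrite !big_split; congr (_ + (_ + _)).
  by elim/big_ind2 : _ => [|? ? ? ? -> ->|//]; [rewrite dotp0l|rewrite dotpDl].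
rewrite (lf_aff lJ)//.
pose L' := [seq (i, q) | i <- enum 'I_m, q <- (A i).2 j].
have -> : hs = fun x => \sum_(t < size L') hinge ((tnth (in_tuple L') t).2.1 *: v (tnth (in_tuple L') t).1)
    ((tnth (in_tuple L') t).2.1 * (tnth (in_tuple L') t).2.2) x.
  apply/funext => x; rewrite /hs -(big_tuple _ _ (in_tuple L') predT (fun u => hinge (u.2.1 *: v u.1) (u.2.1 * u.2.2) x)).
  rewrite big_allpairs_dep /= big_enum; apply: eq_bigr => i _; rewrite /hsum !big_seq.
  apply: eq_bigr => q qA; rewrite /hinge dotpZl -mulrBr maxr_pMr ?mulr0//.
  by have [/(_ j)/allP/(_ _ qA)] := hA i.
exact: J_hinge_sums.
Qed.

End HingeTuples.

(** * Vanishing of valuations with zero quadratic part *)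

Section Mollifier.
Variables (R : realType) (n : nat).
Local Notation V := 'rV[R]_n.
Implicit Types (T : seq (R * V)) (x y : V).

Definition expsum T y : R := \sum_(q <- T) q.1 * expR (dotp q.2 y).

Lemma expsum_mul T T' : exists T2, forall y, expsum T y * expsum T' y = expsum T2 y.
Proof.
exists [seq (q.1 * q'.1, q.2 + q'.2) | q <- T, q' <- T'] => y.
rewrite /expsum big_allpairs_dep mulr_suml; apply: eq_bigr => q _.
rewrite mulr_sumr; apply: eq_bigr => q' _ /=; rewrite dotpDl expRD; ring.
Qed.

Lemma expsum_pow T N : exists T2, forall y, expsum T y ^+ N = expsum T2 y.
Proof.
elim: N => [|N [T2 IH]].
  by exists [:: (1, 0)] => y; rewrite /expsum big_seq1 dotp0l expR0 mulr1.
have [T3 h] := expsum_mul T T2; exists T3 => y; by rewrite exprS IH h.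
Qed.

(** This is [2 cosh s - 2]. *)
Definition hyp (s : R) : R := expR s + expR (- s) - 2.

Lemma hypE s : hyp s = expR `|s| + (expR `|s|)^-1 - 2.
Proof.
rewrite /hyp -expRN; congr (_ - _); have [s0|s0] := leP 0 s; first by rewrite ger0_norm.
by rewrite ltr0_norm// opprK addrC.
Qed.

(** [u + 1 / u] increases for [u >= 1], and [exp |s| >= 1 + d]. *)
Lemma hyp_lower s d : 0 < d -> d <= `|s| -> (1 + d) + (1 + d)^-1 - 2 <= hyp s.
Proof.
move=> d0 ds; rewrite hypE; have h := expR_ge1Dx `|s|; set u := expR _ in h *.
have a0 : 0 < 1 + d by lra. have u0 : 0 < u by exact: expR_gt0.
rewrite lerD2r -subr_ge0.
have -> : u + u^-1 - (1 + d + (1 + d)^-1) = (u - (1 + d)) * (u * (1 + d) - 1) / (u * (1 + d)).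
  by field; rewrite !gt_eqF.
apply: divr_ge0; last by rewrite mulr_ge0 ?ltW.
apply: mulr_ge0; [lra|nra].
Qed.

Lemma hyp_ge0 s : 0 <= hyp s.
Proof.
rewrite hypE; set u := expR _; have u0 : 0 < u by exact: expR_gt0.
rewrite (_ : _ - 2 = (u - 1) ^+ 2 / u); first by rewrite divr_ge0 ?sqr_ge0// ltW.
by field; rewrite gt_eqF.
Qed.

Lemma hyp_upper s r : `|s| <= r -> hyp s <= expR r.
Proof.
move=> sr; rewrite hypE; have h1 : expR `|s| <= expR r by rewrite ler_expR.
have : (expR `|s|)^-1 <= 1 by rewrite invf_le1 ?expR_gt0// -expR0 ler_expR.
lra.
Qed.

(** [k] is 1 minus a small multiple of the sum of the [hyp y_i]: an exponential sum with strict
    maximum 1 at 0. The constant [c] keeps it nonnegative on the ball; [n + 1] keeps the denominator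
    positive. *)
Lemma exp_kernel (r : R) : exists (k : V -> R) T, [/\ forall y, k y = expsum T y, k 0 = 1,
  continuous k, forall y, `|y| <= r -> 0 <= k y <= 1 &
  forall d, 0 < d -> exists2 a, 0 <= a < 1 & forall y, d <= `|y| -> `|y| <= r -> k y <= a].
Proof.
pose c : R := (n.+1%:R * expR r)^-1.
have c0 : 0 < c by rewrite invr_gt0 mulr_gt0// expR_gt0.
pose k (y : V) := 1 - c * \sum_i hyp (y ord0 i).
pose T := (1 + 2 * c * n%:R, 0 : V) :: [seq (- c, delta_mx ord0 i : V) | i <- index_enum 'I_n] ++
  [seq (- c, - delta_mx ord0 i : V) | i <- index_enum 'I_n].
have kb y : `|y| <= r -> 0 <= k y <= 1.
  move=> yr; have S0 : 0 <= \sum_i hyp (y ord0 i) by apply: sumr_ge0 => i _; exact: hyp_ge0.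
  have S1 : \sum_i hyp (y ord0 i) <= n.+1%:R * expR r.
    apply: (@le_trans _ _ (\sum_(i < n) expR r)).
      by apply: ler_sum => i _; apply: hyp_upper; apply: le_trans yr; exact: norm_coord.
    rewrite sumr_const card_ord -[leLHS]mulr_natl ler_wpM2r ?ler_nat// ltW// expR_gt0.
  rewrite /k gerBl mulr_ge0 ?(ltW c0)// andbT subr_ge0.
  by rewrite /c mulrC ler_pdivrMr ?mulr_gt0 ?expR_gt0// mul1r.
exists k, T; split => //.
- move=> y; rewrite /expsum /T big_cons big_cat !big_map /= dotp0l expR0 mulr1 /k /hyp.
  have -> : \sum_i (expR (y ord0 i) + expR (- y ord0 i) - 2) =
     \sum_i expR (y ord0 i) + \sum_i expR (- y ord0 i) - 2 * n%:R.
    by rewrite sumrB big_split /= sumr_const card_ord -[2 *+ n]mulr_natr.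
  have -> : \sum_i - c * expR (dotp (delta_mx ord0 i) y) = - c * \sum_i expR (y ord0 i).
    by rewrite mulr_sumr; apply: eq_bigr => i _; rewrite dotp_delta.
  have -> : \sum_i - c * expR (dotp (- delta_mx ord0 i) y) = - c * \sum_i expR (- y ord0 i).
    by rewrite mulr_sumr; apply: eq_bigr => i _; rewrite dotpNl dotp_delta.
  ring.
- by rewrite /k big1 ?mulr0 ?subr0// => i _; rewrite mxE /hyp oppr0 expR0; ring.
- apply: contB; first exact: cont_cst.
  apply: contZ; apply: cont_sum => i _.
  have ci : continuous (fun y : V => y ord0 i).
    by rewrite (_ : (fun _ => _) = dotp (delta_mx ord0 i)); [exact: dotp_continuous|apply/funext => x; rewrite dotp_delta].
  apply: contB; last exact: cont_cst.
  apply: contD; first by apply: cont_comp ci _; exact: continuous_expR.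
  by apply: (cont_comp (contN ci)); exact: continuous_expR.
move=> d d0; have d2 : 0 < d / 2 by rewrite divr_gt0.
pose g := (1 + d / 2) + (1 + d / 2)^-1 - 2.
have g0 : 0 < g.
  rewrite /g (_ : _ - 2 = (d / 2) ^+ 2 / (1 + d / 2)); last by field; lra.
  by rewrite divr_gt0 ?exprn_gt0//; lra.
exists (Num.max 0 (1 - c * g)); first by rewrite le_max lexx /= gt_max ltr01 /= ltrBlDr ltrDl mulr_gt0.
move=> y dy yr; rewrite le_max; apply/orP; right.
have [i hi] : exists i, d / 2 < `|y ord0 i|.
  apply: contrapT => /forallNP h; have : `|y| <= d / 2.
    by apply: norm_le_coord; [exact: ltW|move=> i; rewrite leNgt; apply/negP/h].
  lra.
rewrite /k lerD2l lerN2 ler_wpM2l ?(ltW c0)// (bigD1 i)//=.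
apply: (le_trans (hyp_lower d2 (ltW hi))); rewrite lerDl; apply: sumr_ge0 => j _; exact: hyp_ge0.
Qed.

Definition cutoff (r : R) (y : V) : R := Num.min 1 (Num.max 0 (r + 1 - `|y|)).

Lemma cutoff01 r y : 0 <= cutoff r y <= 1.
Proof. by rewrite /cutoff le_min ler01 le_max lexx /= ge_min lexx. Qed.

Lemma cutoff1 r y : `|y| <= r -> cutoff r y = 1.
Proof. by move=> yr; rewrite /cutoff min_l// le_max; apply/orP; right; lra. Qed.

Lemma cutoff0 r y : r + 1 < `|y| -> cutoff r y = 0.
Proof. by move=> yr; rewrite /cutoff max_l ?min_r//; lra. Qed.

Lemma testfun_cutoff r : testfun (cutoff r).
Proof.
split; last by exists (r + 1); exact: cutoff0.
apply: cont_min; first exact: cont_cst.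
apply: cont_max; first exact: cont_cst.
by apply: contB; [exact: cont_cst|move=> x; exact: norm_continuous].
Qed.

Lemma rint_le (m : {measure set Borel R n -> \bar R}) (g h : V -> R) : locfin m -> testfun g -> testfun h ->
  (forall x, g x <= h x) -> int_real m g <= int_real m h.
Proof.
move=> lm tg th gh; rewrite -subr_ge0 -mulN1r -rintZ// -rintD//; last exact: testfunZ.
by apply: rint_ge0 => x; rewrite mulN1r subr_ge0.
Qed.

Lemma rint_sum (m : {measure set Borel R n -> \bar R}) (I : Type) (s : seq I) (a : I -> R) (g : I -> V -> R) :
  locfin m -> (forall i, testfun (g i)) ->
  int_real m (fun x => \sum_(i <- s) a i * g i x) = \sum_(i <- s) a i * int_real m (g i) /\
  testfun (fun x => \sum_(i <- s) a i * g i x).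
Proof.
move=> lm tg; elim: s => [|i s [IH tIH]].
  under eq_fun do rewrite big_nil; rewrite big_nil.
  split; first by rewrite /int_real integral0.
  by split; [exact: cont_cst|exists 0].
under eq_fun do rewrite big_cons; rewrite big_cons.
have ti : testfun (fun x => a i * g i x) by exact: testfunZ.
by rewrite rintD// rintZ// IH; split=> //; exact: testfunD.
Qed.

Local Notation L := (leb R n).

(** [A N] correlates [e] with [chi * k ^ N], normalized by the mass [Z N]. For [|x| <= r] the points
    [y] with [e (x + y)] nonzero lie where [chi = 1], so the cutoff disappears and an exponential
    sum remains. Convexity survives because [g + A N] is an average of functions [g + e (. + y)]. *)
Lemma mollify (e : V -> R) (r : R) : testfun e -> 0 <= r -> exists A : nat -> V -> R, [/\
  lu_cvg A e,
  forall N, exists T, forall x, `|x| <= r -> A N x = expsum T x &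
  forall N (g : V -> R), (forall y, convexf (fun x => g x + e (x + y))) -> convexf (fun x => g x + A N x)].
Proof.
move=> te r0; have lL := @leb_locfin R n.
have [s s0 hs] := testfun_radius te; have [M M0 hM] := testfun_bounded te.
pose rho := s + r; have rho0 : 0 <= rho by rewrite addr_ge0// ltW.
have [k [T1 [kT k0 kc k01 kd]]] := exp_kernel (rho + 1).
pose chi := cutoff rho; have tchi : testfun chi by exact: testfun_cutoff.
have chi0 y : 0 <= chi y by have /andP[] := cutoff01 rho y.
pose w N y := chi y * k y ^+ N.
have kNc N : continuous (fun y => k y ^+ N).
  by have [T hT] := expsum_pow T1 N; elim: N {T hT} => [|N IH];
    [under eq_fun do rewrite expr0; exact: cont_cst|under eq_fun do rewrite exprS; exact: contM].
have tw N : testfun (w N) by apply: testfunM.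
have w0 N y : 0 <= w N y.
  have [yr|yr] := leP `|y| (rho + 1); last by rewrite /w /chi cutoff0// mul0r.
  by rewrite mulr_ge0// exprn_ge0//; have /andP[] := k01 _ yr.
pose Z N := int_real L (w N).
(* For every [b < 1], [Z N] decays no faster than [b ^ N], whereas the mass outside a small ball is
   of order [a ^ N]; later [b] is the midpoint of [a] and 1. *)
have lowerZ (b : R) : 0 <= b < 1 -> exists2 c, 0 < c & forall N, c * b ^+ N <= Z N.
  move=> /andP[b0 b1]; have b10 : 0 < 1 - b by rewrite subr_gt0.
  have /(@cvgrPdist_lt _ _ _ (nbhs (0 : V)))/(_ _ b10)/nbhs_ballP[d /= d0 hd] := kc 0.
  pose d' := Num.min d rho; have d'0 : 0 < d' by rewrite lt_min d0 ltr_wpDr.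
  have scont (a : R) : continuous (fun y : V => a *: y).
    apply: continuous_rV => i; under eq_fun do rewrite mxE.
    by apply: contZ; rewrite (_ : (fun _ => _) = dotp (delta_mx ord0 i)); [exact: dotp_continuous|apply/funext => x; rewrite dotp_delta].
  have tb : testfun (fun y : V => bump (d'^-1 *: y)).
    apply: (@testfun_comp _ _ _ (fun y => d' *: y)) => //; last exact: testfun_bump.
    by move=> y; rewrite scalerA mulfV ?gt_eqF// scale1r.
  exists (int_real L (fun y => bump (d'^-1 *: y))).
    by apply: leb_bump_comp => //; rewrite scaler0.
  move=> N; rewrite mulrC -rintZ//; apply: rint_le => // [|y]; first exact: testfunZ.
  have [yd|yd] := ltP `|y| d'; last first.
    rewrite [bump _]max_l ?mulr0//; rewrite normrZ ger0_norm ?invr_ge0 ?(ltW d'0)//.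
    by rewrite subr_le0 mulrC ler_pdivlMr// mul1r.
  move: yd; rewrite lt_min => /andP[yd yrho]; rewrite /w /chi cutoff1 ?mul1r ?(ltW yrho)//.
  have bk : b <= k y.
    have := hd y; rewrite /= -ball_normE /= sub0r normrN k0 => /(_ yd) h.
    by have := ler_norm (1 - k y); lra.
  apply: (@le_trans _ _ (b ^+ N)); last by rewrite lerXn2r// nnegrE ?(le_trans b0).
  by rewrite ler_piMr ?exprn_ge0// ge_max ler01/= lerBlDr lerDl.
have Z0 N : 0 < Z N.
  have [|c c0 hc] := lowerZ (1 / 2); first by apply/andP; split; lra.
  apply: lt_le_trans (hc N); by rewrite mulr_gt0// exprn_gt0// divr_gt0.
have te' x : testfun (fun y => e (x + y)).
  by under eq_fun do rewrite addrC; exact: testfun_shift.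
have tew N x : testfun (fun y => e (x + y) * w N y).
  by apply: testfunM => //; exact: testfun_continuous.
pose A N x := int_real L (fun y => e (x + y) * w N y) / Z N.
have AE N x : A N x * Z N = int_real L (fun y => e (x + y) * w N y) by rewrite /A divfK// gt_eqF.
exists A; split.
- move=> r1 eps eps0; have e2 : 0 < eps / 2 by rewrite divr_gt0.
  have [d d0 hd] := continuous_unif_ball r1 (testfun_continuous te) e2.
  have [a /andP[a0 a1] ha] := kd d d0.
  have [|c c0 hc] := lowerZ ((1 + a) / 2); first by apply/andP; split; lra.
  pose b := (1 + a) / 2; have b0 : 0 < b by rewrite divr_gt0//; lra.
  pose I := int_real L chi; have I0 : 0 <= I by exact: rint_ge0.
  have [N0 hN0] : exists N0, forall j, (N0 <= j)%N -> (2 * M * I / c) * (a / b) ^+ j < eps / 2.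
    have q1 : `|a / b| < 1.
      have ab : 0 <= a / b by rewrite divr_ge0// ltW.
      rewrite (ger0_norm ab) ltr_pdivrMr// mul1r /b; lra.
    have h : (fun j => (2 * M * I / c) * (a / b) ^+ j) @ \oo --> (2 * M * I / c) * 0.
      by apply: seq_cvgM; [exact: seq_cvg_cst|exact: cvg_expr].
    rewrite mulr0 in h; have /cvgrPdist_lt/(_ _ e2)[N0 _ hN0] := h.
    exists N0 => j /hN0; rewrite sub0r normrN; exact: le_lt_trans (ler_norm _).
  exists N0 => j /hN0 hj x xr.
  have aM0 : 0 <= 2 * M * a ^+ j by rewrite !mulr_ge0// exprn_ge0.
  have bnd y : `|(e (x + y) - e x) * w j y| <= eps / 2 * w j y + 2 * M * a ^+ j * chi y.
    rewrite normrM [`|w j y|]ger0_norm//; have [yd|yd] := ltP `|y| d.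
      have h : `|e (x + y) - e x| < eps / 2 by apply: hd; rewrite // addrC addKr.
      apply: (@le_trans _ _ (eps / 2 * w j y)); last by rewrite lerDl mulr_ge0.
      by rewrite ler_wpM2r// ltW.
    have h2 : `|e (x + y) - e x| <= 2 * M.
      by rewrite (le_trans (ler_normB _ _))// mulr2n mulrDl mul1r lerD.
    apply: (@le_trans _ _ (2 * M * a ^+ j * chi y)); last by rewrite lerDr mulr_ge0// ltW.
    rewrite -[X in _ <= X]mulrA; apply: ler_pM => //.
    have [yr|yr] := leP `|y| (rho + 1); last by rewrite /w /chi cutoff0// mul0r mulr0.
    rewrite /w mulrC ler_wpM2r//.
    have /andP[ky0 _] := k01 _ yr.
    by apply: lerXn2r; rewrite ?nnegrE//; exact: ha.
  have te1 : testfun (fun y => eps / 2 * w j y) by exact: testfunZ.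
  have te2 : testfun (fun y => 2 * M * a ^+ j * chi y) by exact: testfunZ.
  have te3 : testfun (fun y => - e x * w j y) by exact: testfunZ.
  have diff : (A j x - e x) * Z j = int_real L (fun y => e (x + y) * w j y + - e x * w j y).
    by rewrite rintD// rintZ// -AE mulrDl.
  have up : int_real L (fun y => eps / 2 * w j y + 2 * M * a ^+ j * chi y) = eps / 2 * Z j + 2 * M * a ^+ j * I.
    by rewrite rintD// !rintZ.
  have tD : testfun (fun y => e (x + y) * w j y + - e x * w j y) by exact: testfunD.
  have tU : testfun (fun y => eps / 2 * w j y + 2 * M * a ^+ j * chi y) by exact: testfunD.
  have H1 : `|(A j x - e x) * Z j| <= eps / 2 * Z j + 2 * M * a ^+ j * I.
    have tU' : testfun (fun y => -1 * (eps / 2 * w j y + 2 * M * a ^+ j * chi y)) by exact: testfunZ.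
    rewrite diff -up ler_norml -mulN1r -rintZ//; apply/andP; split; apply: rint_le => // y.
      by have := bnd y; rewrite mulrBl mulNr => /ler_normlP[]; lra.
    by have := bnd y; rewrite mulrBl mulNr => /ler_normlP[]; lra.
  rewrite -(ltr_pM2r (Z0 j)); move: H1; rewrite normrM (ger0_norm (ltW (Z0 j))) => H1.
  apply: (le_lt_trans H1).
  have H2 : 2 * M * a ^+ j * I < eps / 2 * Z j.
    have h3 := hc j; rewrite -/b in h3.
    have bj : 0 < b ^+ j by exact: exprn_gt0.
    apply: (@lt_le_trans _ _ (eps / 2 * (c * b ^+ j))); last by rewrite ler_wpM2l// ltW.
    have -> : 2 * M * a ^+ j * I = 2 * M * I / c * (a / b) ^+ j * (c * b ^+ j).
      by rewrite expr_div_n; field; rewrite !gt_eqF.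
    by rewrite ltr_pM2r// mulr_gt0.
  lra.
- move=> N; have [T hT] := expsum_pow T1 N.
  pose I (q : R * V) := int_real L (fun u => e u * expR (dotp q.2 u)).
  exists [seq (q.1 * I q / Z N, - q.2) | q <- T] => x xr.
  have ce (v : V) : continuous (fun u : V => expR (dotp v u)).
    by apply: (cont_comp (@dotp_continuous R n v)); exact: continuous_expR.
  have tI (q : R * V) : testfun (fun u => e u * expR (dotp q.2 u)) by exact: testfunM.
  have E1 : (fun y => e (x + y) * w N y) = (fun y => e (x + y) * k y ^+ N).
    apply/funext => y; rewrite /w; have [exy|exy] := eqVneq (e (x + y)) 0; first by rewrite exy !mul0r.
    rewrite /chi cutoff1 ?mul1r//; have := ler_normB (x + y) x; rewrite addrC addKr => h.
    apply: (le_trans h); rewrite lerD// leNgt; apply: contra_neqN exy => /hs; by rewrite addrC.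
  have E2 : (fun y => e (x + y) * k y ^+ N) = (fun y => (fun u => e u * k (u - x) ^+ N) (y + x)).
    by apply/funext => y; rewrite addrK addrC.
  have E3 : (fun u => e u * k (u - x) ^+ N) = (fun u => \sum_(q <- T) (q.1 * expR (dotp (- q.2) x)) * (e u * expR (dotp q.2 u))).
    apply/funext => u; rewrite kT hT mulr_sumr; apply: eq_bigr => q _.
    by rewrite dotpDr dotpNr expRD dotpNl; ring.
  have [S1 S2] := rint_sum T (fun q => q.1 * expR (dotp (- q.2) x)) lL tI.
  pose pe u := e u * k (u - x) ^+ N.
  have te3 : testfun pe by rewrite /pe E3.
  have S3 : int_real L (fun y => e (x + y) * k y ^+ N) = int_real L pe by rewrite E2; exact: (leb_shift_int x te3).
  rewrite /A E1 S3 /pe E3 S1 /expsum big_map mulr_suml; apply: eq_bigr => q _ /=.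
  rewrite /I; ring.
- move=> N g cg x x' t t01; have /andP[t0 t1] := t01.
  set z := t *: x + (1 - t) *: x'.
  have tz a b : testfun (fun y => a * (e (b + y) * w N y)) by exact: testfunZ.
  have : 0 <= int_real L (fun y => t * (e (x + y) * w N y) + (1 - t) * (e (x' + y) * w N y)
     + - 1 * (e (z + y) * w N y) + (t * g x + (1 - t) * g x' - g z) * w N y).
    apply: rint_ge0 => y; have := cg y x x' t t01; rewrite -/z => h.
    rewrite (_ : _ + _ = (t * (g x + e (x + y)) + (1 - t) * (g x' + e (x' + y)) - (g z + e (z + y))) * w N y); last by ring.
    by rewrite mulr_ge0// subr_ge0.
  have tc : testfun (fun y => (t * g x + (1 - t) * g x' - g z) * w N y) by exact: testfunZ.
  rewrite rintD//; last by do 2 apply: testfunD => //.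
  rewrite rintD//; last by apply: testfunD.
  rewrite rintD// !rintZ// -/(Z N) => h.
  move: h; rewrite -!AE => h; have := Z0 N => z0.
  rewrite -subr_ge0 -(pmulr_lge0 _ z0); nra.
Qed.

End Mollifier.

(** * Convex functions as quadratics plus compactly supported functions *)

Section InfConvolution.
Variables (R : realType) (n : nat).
Local Notation V := 'rV[R]_n.
Implicit Types x y : V.

(** Infimal convolution of [f] on the ball with [C] times the norm, [C] a Lipschitz constant there:
    nothing changes on the ball, and growth is linear. *)
Lemma convex_lipschitz_extension (f : V -> R) r : convexf f -> 0 <= r ->
  exists g C D, [/\ convexf g, 0 <= C, 0 <= D, forall x, `|x| <= r -> g x = f x &
    forall x, g x <= C * `|x| + D].
Proof.
move=> cf r0; have [C C0 hC] := convexf_lipschitz r cf; have [M M0 hM] := convexf_bound r cf.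
pose S x : set R := [set f y + C * `|x - y| | y in [set y | `|y| <= r]].
have lbS x : lbound (S x) (- M).
  move=> _ [y /= yr <-]; have := hM y yr; rewrite ler_norml => /andP[h _].
  by have : 0 <= C * `|x - y| by [exact: mulr_ge0]; lra.
have infS x : has_inf (S x).
  by split; [exists (f 0 + C * `|x - 0|), 0; rewrite //= normr0|exists (- M); exact: lbS].
pose g x := inf (S x).
have gle x y : `|y| <= r -> g x <= f y + C * `|x - y|.
  by move=> yr; apply: ge_inf; [exists (- M); exact: lbS|exists y].
exists g, C, `|f 0|; split => //.
- move=> x x' t t01; have /andP[t0 t1] := t01.
  apply/ler_addgt0Pl => e e0.
  have [_ [y yr <-] hy] := inf_adherent e0 (infS x).
  have [_ [y' yr' <-] hy'] := inf_adherent e0 (infS x').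
  have yy : `|t *: y + (1 - t) *: y'| <= r.
    apply: (le_trans (ler_normD _ _)); rewrite !normrZ !ger0_norm ?subr_ge0//; move: yr yr' => /= *; nra.
  apply: (le_trans (gle _ _ yy)).
  have h1 := cf y y' t t01.
  have h2 : `|t *: x + (1 - t) *: x' - (t *: y + (1 - t) *: y')| <= t * `|x - y| + (1 - t) * `|x' - y'|.
    rewrite opprD addrACA -!scalerBr; apply: (le_trans (ler_normD _ _)).
    by rewrite !normrZ !ger0_norm ?subr_ge0.
  have h3 := ler_wpM2l C0 h2; rewrite -/(g x) -/(g x') in hy hy'.
  have h4 : t * (f y + C * `|x - y|) <= t * (g x + e) by rewrite ler_wpM2l// ltW.
  have h5 : (1 - t) * (f y' + C * `|x' - y'|) <= (1 - t) * (g x' + e) by rewrite ler_wpM2l ?subr_ge0// ltW.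
  lra.
- move=> x xr; apply/le_anti; apply/andP; split.
    by have := gle x x xr; rewrite subrr normr0 mulr0 addr0.
  apply: lb_le_inf; first by case: (infS x).
  move=> _ [y yr <-]; have := hC x y xr yr; have := ler_norm (f x - f y); lra.
- move=> x; have := gle x 0; rewrite normr0 subr0 => /(_ r0); have := ler_norm (f 0); lra.
Qed.

Definition nsq x : R := \sum_i x ord0 i ^+ 2.

Lemma nsqE x : nsq x = \sum_i sq (delta_mx ord0 i) x.
Proof. by apply: eq_bigr => i _; rewrite /sq dotp_delta. Qed.

Lemma convexf_nsq : convexf nsq.
Proof. by rewrite (funext nsqE); apply: convexf_sum => i; exact: convexf_sq. Qed.

Lemma nsq_add x y : nsq (x + y) = nsq x + (dotp (2 *: y) x + nsq y).
Proof.
rewrite dotpZl /nsq /dotp mulr_sumr -!big_split; apply: eq_bigr => i _ /=; rewrite mxE; ring.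
Qed.

Lemma nsq_ge x : `|x| ^+ 2 <= nsq x.
Proof.
have q0 : 0 <= nsq x by apply: sumr_ge0 => i _; exact: sqr_ge0.
have h : `|x| <= Num.sqrt (nsq x).
  apply: norm_le_coord; first exact: sqrtr_ge0.
  move=> i; rewrite -sqrtr_sqr ler_wsqrtr// /nsq (bigD1 i)//= lerDl.
  by apply: sumr_ge0 => j _; exact: sqr_ge0.
by rewrite -(sqr_sqrtr q0) lerXn2r ?nnegrE// sqrtr_ge0.
Qed.

Lemma nsq_le x r : `|x| <= r -> nsq x <= n%:R * r ^+ 2.
Proof.
move=> xr; apply: (@le_trans _ _ (\sum_(i < n) r ^+ 2)).
  apply: ler_sum => i _; rewrite -[x ord0 i ^+ 2]ger0_norm ?sqr_ge0// normrX.
  by rewrite lerXn2r ?nnegrE// ?(le_trans (norm_coord x i))// (le_trans _ xr).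
by rewrite sumr_const card_ord mulr_natl.
Qed.

(** Take the maximum of the extension [g] and a paraboloid [h] lying below [f] on the ball. The
    paraboloid wins at infinity, so [max g h - h] has compact support. *)
Lemma convex_compact_defect (f : V -> R) r : convexf f -> 0 <= r ->
  exists e C D, [/\ testfun e, 0 <= C, convexf (fun x => C * nsq x + D + e x) &
    forall x, `|x| <= r -> C * nsq x + D + e x = f x].
Proof.
move=> cf r0; have [g [A [B [cg A0 B0 gf gle]]]] := convex_lipschitz_extension cf r0.
have [M M0 hM] := convexf_bound r cf.
(* These constants give [h <= - C <= - M] on the ball, and [C >= 1] lets the quadratic growth beat
   the linear bound on [g]. *)
pose C := M + 1; have C1 : 1 <= C by rewrite lerDr.
have C0 : 0 <= C by lra.
pose R2 := n%:R * r ^+ 2 + 1; have R20 : 0 <= R2 by rewrite addr_ge0// mulr_ge0// sqr_ge0.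
pose h x := C * nsq x + - (C * R2).
have ch : convexf h by apply: convexfD; [apply: convexfZ => //; exact: convexf_nsq|exact: convexf_cst].
pose e x := Num.max (g x) (h x) - h x.
have he x : h x + e x = Num.max (g x) (h x) by rewrite /e addrC subrK.
exists e, C, (- (C * R2)); split => //.
- split.
    by apply: contB; [apply: cont_max|]; exact: convexf_continuous.
  exists (A + B + C * R2 + 1) => x xr; apply/eqP; rewrite subr_eq0; apply/eqP/max_r.
  have q := nsq_ge x; have CR : 0 <= C * R2 by exact: mulr_ge0.
  have gx := gle x; set s := `|x| in xr q gx *.
  have s1 : 1 <= s by lra.
  rewrite /h; apply: (le_trans gx); rewrite lerBrDr.
  apply: (@le_trans _ _ (C * s ^+ 2)); last by rewrite ler_wpM2l.
  apply: (@le_trans _ _ (1 * s ^+ 2)); last by rewrite ler_wpM2r ?sqr_ge0.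
  rewrite mul1r expr2; nra.
- by rewrite (_ : (fun x => _) = fun x => Num.max (g x) (h x)); [exact: convexf_max|apply/funext => x; rewrite -he].
move=> x xr; rewrite -/(h x) he gf// max_l//.
have := hM x xr; rewrite ler_norml => /andP[fx _]; apply: le_trans fx.
have := nsq_le xr; rewrite /h /R2 => q.
have : C * nsq x <= C * (n%:R * r ^+ 2) by rewrite ler_wpM2l.
rewrite mulrDr mulr1 /C; lra.
Qed.

End InfConvolution.

(** * Vanishing of the pairing *)

Section Vanishing.
Variables (R : realType) (n k : nat).
Local Notation V := 'rV[R]_n.
Variable J : (V -> R) -> (V -> R) -> R.
Hypothesis lJ : lfun k J.
Hypothesis kn : (k <= n)%N.
Hypothesis J0 : forall (M : 'M[R]_(k, n)) phi, testfun phi -> J (qm M) phi = 0.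

Local Notation cr := {p : R -> R | conv1 p}.
Definition rsum (l : seq (cr * V)) (x : V) : R := \sum_(q <- l) sval q.1 (dotp q.2 x).

Lemma convexf_rsum l : convexf (rsum l).
Proof. by apply: convexf_sum => q; apply: convexf_ridge; exact: (svalP q.1). Qed.

Lemma J_rsum l phi : testfun phi -> J (rsum l) phi = 0.
Proof.
move=> tp; have := J_ridges lJ kn J0 (p := fun i => sval (tnth (in_tuple l) i).1)
  (fun i => (tnth (in_tuple l) i).2) tp (fun i => svalP (tnth (in_tuple l) i).1).
by congr (J _ _ = 0); apply/funext => x; rewrite /rsum [RHS]big_tnth.
Qed.

(** Induction on the subtracted ridges: with [z] the first of them, [F + z] and [F + 2 z] have one
    ridge less to subtract, so [J] vanishes there; being affine along [z], it vanishes at [F]. *)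
Lemma J_dc l : forall F l' U phi, convexf F -> open U ->
  (forall x, U x -> F x + rsum l x = rsum l' x) -> testfun phi -> (forall x, phi x != 0 -> U x) ->
  J F phi = 0.
Proof.
elim: l => [|q l IH] F l' U phi cF oU e tp pU.
  rewrite -(J_rsum l' tp); apply: (lf_loc lJ oU) => //; first exact: convexf_rsum.
  by move=> x /e; rewrite /rsum big_nil addr0.
have [cz hz] := adir_ridge lJ q.2 (svalP q.1).
have h2 := hz F phi 2 cF tp (ler0n _ _).
have c1 : convexf (fun x => F x + sval q.1 (dotp q.2 x)) by exact: convexfD.
have c2 : convexf (fun x => F x + 2 * sval q.1 (dotp q.2 x)) by apply: convexfD => //; exact: convexfZ.
have e1 : J (fun x => F x + sval q.1 (dotp q.2 x)) phi = 0.
  by apply: (IH _ l' U) => // x /e <-; rewrite /rsum big_cons addrA.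
have e2 : J (fun x => F x + 2 * sval q.1 (dotp q.2 x)) phi = 0.
  by apply: (IH _ (q :: l') U) => // x /e h; rewrite [RHS]/rsum big_cons -/(rsum l' x) -h /rsum big_cons; ring.
by rewrite e1 e2 in h2; lra.
Qed.

Lemma conv1_scale c (p : R -> R) : 0 <= c -> conv1 p -> conv1 (fun s => c * p s).
Proof. by move=> c0 cp s t u u01; have := ler_wpM2l c0 (cp s t u u01); lra. Qed.

Lemma conv1_expR : conv1 (@expR R).
Proof.
move=> s t u /andP[u0 u1]; set m := u * s + _.
have h a : expR m * (1 + (a - m)) <= expR a.
  have -> : expR a = expR m * expR (a - m) by rewrite -expRD addrC subrK.
  by rewrite ler_wpM2l ?expR_ge0// expR_ge1Dx.
have h1 := ler_wpM2l u0 (h s); have h2 : (1 - u) * (expR m * (1 + (t - m))) <= (1 - u) * expR t by rewrite ler_wpM2l ?subr_ge0.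
have E : u * (expR m * (1 + (s - m))) + (1 - u) * (expR m * (1 + (t - m))) = expR m by rewrite /m; ring.
lra.
Qed.

Lemma conv1_cst (c : R) : conv1 (fun _ => c).
Proof. by move=> s t u _; lra. Qed.

Lemma max0_ge (a : R) : 0 <= Num.max 0 a. Proof. by rewrite le_max lexx. Qed.

(** Negative coefficients are truncated to 0, so that the bundled function is always convex. *)
Definition cr_exp (a : R) : cr := exist _ _ (conv1_scale (max0_ge a) conv1_expR).
Definition cr_cst (a : R) : cr := exist _ _ (conv1_cst a).
Definition cr_sq (a : R) : cr := exist _ _ (conv1_scale (max0_ge a) (@conv1_sq R)).

(** On the ball, adding to [g + A N] its negative exponential terms with reversed sign leaves
    squares, a constant and positive exponentials, so [J_dc] applies to [g + A N]. *)
Lemma lf_vanish f phi : convexf f -> testfun phi -> J f phi = 0.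
Proof.
move=> cf tp; have [r r0 hr] := testfun_radius tp.
pose rho := r + 1; have rho0 : 0 <= rho by rewrite addr_ge0// ltW.
have [e [C [D [te C0 cF Ff]]]] := convex_compact_defect cf rho0.
pose g (x : V) := C * nsq x + D; pose U := [set x : V | `|x| < rho].
have oU : open U by exact: open_ball0.
have pU x : phi x != 0 -> U x.
  by move=> px; rewrite /U /= /rho ltr_pwDr//; rewrite leNgt; apply: contra_neqN px => /hr.
rewrite (lf_loc lJ oU (h := fun x => g x + e x))//; last by move=> x /ltW /Ff <-.
have [A [lA hA cA]] := mollify te rho0.
have cG N : convexf (fun x => g x + A N x).
  apply: cA => y.
  (* [g (x + y)] and [g x] differ by an affine function, so convexity of [g + e] passes to every
     translate of [e]. *)
  have -> : (fun x => g x + e (x + y)) = (fun x => (g (x + y) + e (x + y)) + (dotp (- (C * 2) *: y) x + - C * nsq y)).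
    by apply/funext => x; rewrite /g nsq_add !dotpZl; ring.
  by apply: convexfD; [exact: (convexf_shift y cF)|exact: convexf_aff].
have L : (fun N => J (fun x => g x + A N x) phi) @ \oo --> J (fun x => g x + e x) phi.
  by apply: (lf_cont lJ) => //; apply: lu_cvgD lA; exact: lu_cst.
apply: (seq_lim_eq L (seq_cvg_cst 0)) => N.
have [T hT] := hA N.
pose l := [seq (cr_exp (- q.1), q.2) | q <- T].
pose l' := (cr_cst D, 0 : V) :: [seq (cr_sq C, delta_mx ord0 i : V) | i <- index_enum 'I_n] ++
  [seq (cr_exp q.1, q.2) | q <- T].
apply: (@J_dc l _ l' U) => // x /ltW xU.
rewrite hT// /rsum /l /l' big_cons big_cat !big_map /= /g nsqE mulr_sumr max_r//.
have -> : \sum_(q <- T) Num.max 0 q.1 * expR (dotp q.2 x) =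
   expsum T x + \sum_(q <- T) Num.max 0 (- q.1) * expR (dotp q.2 x).
  rewrite /expsum -big_split; apply: eq_bigr => q _ /=; rewrite -mulrDl; congr (_ * _).
  by case: (leP 0 q.1) => q0; [rewrite [Num.max 0 (- _)]max_l ?addr0// oppr_le0|rewrite [Num.max 0 (- _)]max_r ?subrr// oppr_ge0 ltW].
by rewrite -!addrA addrCA.
Qed.

End Vanishing.

(** * Partial minimizers and the subgradient measure *)

Section PartialMinimizers.
Variables (R : realType) (n k : nat).
Local Notation V := 'rV[R]_n.
Implicit Types (f h : V -> R) (x y z w : V).

Definition hd z : V := \row_i (if (i < k)%N then z ord0 i else 0).
Definition tl z : V := z - hd z.

Lemma hdE z i : hd z ord0 i = if (i < k)%N then z ord0 i else 0.
Proof. by rewrite mxE. Qed.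
Lemma tlE z i : tl z ord0 i = if (i < k)%N then 0 else z ord0 i.
Proof. by rewrite !mxE; case: ifP; rewrite ?subrr ?subr0. Qed.

Lemma hdD x y : hd (x + y) = hd x + hd y.
Proof. by apply/rowP => i; rewrite !(hdE, mxE); case: ifP; rewrite ?addr0. Qed.
Lemma hdN x : hd (- x) = - hd x.
Proof. by apply/rowP => i; rewrite !(hdE, mxE); case: ifP; rewrite ?oppr0. Qed.
Lemma hdZ c x : hd (c *: x) = c *: hd x.
Proof. by apply/rowP => i; rewrite !(hdE, mxE); case: ifP; rewrite ?mulr0. Qed.
Lemma hd_hd x : hd (hd x) = hd x.
Proof. by apply/rowP => i; rewrite !hdE; case: (i < k)%N. Qed.
Lemma hd_tl x : hd (tl x) = 0.
Proof. by rewrite /tl hdD hdN hd_hd subrr. Qed.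
Lemma tlD x y : tl (x + y) = tl x + tl y.
Proof. by rewrite /tl hdD opprD addrACA. Qed.
Lemma tlN x : tl (- x) = - tl x.
Proof. by rewrite /tl hdN opprD. Qed.
Lemma tlZ c x : tl (c *: x) = c *: tl x.
Proof. by rewrite /tl hdZ scalerBr. Qed.
Lemma tl_hd x : tl (hd x) = 0.
Proof. by rewrite /tl hd_hd subrr. Qed.
Lemma tl_tl x : tl (tl x) = tl x.
Proof. by rewrite {1}/tl hd_tl subr0. Qed.
Lemma hd_tlK x : hd x + tl x = x.
Proof. by rewrite /tl addrC subrK. Qed.
Lemma dotp_hd z x : dotp (hd z) x = dotp (hd z) (hd x).
Proof.
by apply: eq_bigr => i _; rewrite !hdE; case: ifP; rewrite ?mul0r.
Qed.

(** [z] encodes both parameters: [hd z] is the slope and [tl z] selects the slice on which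
    [f - dotp (hd z)] is minimized. *)
Definition am f z x : Prop :=
  tl x = tl z /\ forall y, tl y = tl z -> f x + dotp (hd z) (y - x) <= f y.

(** A local minimum of a convex function is global: the competitor is contracted towards [x] by a
    factor [s] small enough to enter [U]. *)
Lemma am_local f z x (U : set V) : convexf f -> open U -> U x -> tl x = tl z ->
  (forall y, U y -> tl y = tl z -> f x + dotp (hd z) (y - x) <= f y) -> am f z x.
Proof.
move=> cf oU Ux tx H; split=> // y ty.
have [e /= e0 he] := (nbhs_ballP _ _).1 (open_nbhs_nbhs (conj oU Ux)).
pose s := Num.min 1 (e / (`|y - x| + 1) / 2).
have n1 : 0 < `|y - x| + 1 by rewrite ltr_pwDr.
have s0 : 0 < s by rewrite lt_min ltr01 !divr_gt0.
have s1 : s <= 1 by rewrite ge_min lexx.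
have E : s *: y + (1 - s) *: x = x + s *: (y - x).
  by rewrite scalerBr scalerBl scale1r addrCA addrA addrC addrA.
have Uy : U (s *: y + (1 - s) *: x).
  apply: he; rewrite -ball_normE /= E opprD addrA subrr sub0r normrN normrZ (ger0_norm (ltW s0)).
  have h : s <= e / (`|y - x| + 1) / 2 by rewrite ge_min lexx orbT.
  have h2 : s * (`|y - x| + 1) <= e / 2 by rewrite -ler_pdivlMr// mulrAC.
  have := normr_ge0 (y - x); nra.
have tys : tl (s *: y + (1 - s) *: x) = tl z.
  by rewrite tlD !tlZ ty tx -scalerDl addrC subrK scale1r.
have := H _ Uy tys; rewrite {1}E [x + _]addrC addrK dotpZr => h1.
have s01 : 0 <= s <= 1 by rewrite ltW.
have := cf y x s s01 => h2.
rewrite -(ler_pM2l s0); lra.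
Qed.

Lemma am_eq_local f h (U : set V) z x : convexf f -> convexf h -> open U -> U x ->
  (forall y, U y -> f y = h y) -> am f z x -> am h z x.
Proof.
move=> cf ch oU Ux e [tx H]; apply: (am_local ch oU Ux) => // y Uy ty.
by rewrite -!e//; exact: H.
Qed.

Lemma open_lt_fun f h : continuous f -> continuous h -> open [set x | f x < h x].
Proof.
move=> cf ch; have := open_comp (fun x _ => contB ch cf (x:=x)) (@open_gt R 0).
by congr open; apply/seteqP; split => x /=; rewrite subr_gt0.
Qed.

Section MaxMin.
Variables f h : V -> R.
Hypotheses (cf : convexf f) (ch : convexf h).
Let a x := Num.max (f x) (h x).
Let b x := Num.min (f x) (h x).
Hypothesis cb : convexf b.

Let ca : convexf a. Proof. exact: convexf_max. Qed.

Lemma am_lt z x : f x < h x -> (am a z x <-> am h z x) /\ (am b z x <-> am f z x).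
Proof.
move=> fh; pose U := [set y | f y < h y].
have oU : open U by apply: open_lt_fun; exact: convexf_continuous.
have ea y : U y -> a y = h y by move=> /ltW; exact: max_r.
have eb y : U y -> b y = f y by move=> /ltW; exact: min_l.
split; split; apply: (am_eq_local _ _ oU) => // y Uy; by rewrite ?ea ?eb.
Qed.

Lemma am_min_eq z x : f x = h x -> (am b z x <-> am f z x /\ am h z x).
Proof.
move=> fh; have bx : b x = f x by rewrite /b fh minxx.
split=> [[tx H]|[[tx H1] [_ H2]]].
  split; split=> // y /H; rewrite bx ?fh => /le_trans; apply; rewrite /b ge_min lexx ?orbT//.
by split=> // y ty; rewrite bx /b le_min H1//= fh H2.
Qed.

(* A convex minimum of two functions that both drop below a supporting plane
   forces, by the intermediate value theorem, a point where both do. *)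
Lemma am_max_eq z x : f x = h x -> (am a z x <-> am f z x \/ am h z x).
Proof.
move=> fh; have ax : a x = f x by rewrite /a fh maxxx.
split=> [[tx H]|[[tx H]|[tx H]]]; last 2 first.
- by split=> // y /H h1; rewrite ax (le_trans h1)// /a le_max lexx.
- by split=> // y /H h1; rewrite ax fh (le_trans h1)// /a le_max lexx orbT.
apply: contrapT => /not_orP[nf nh].
have /not_andP[//|/existsNP[y1 /not_implyP[t1 /negP]]] := nf; rewrite -ltNge => F1.
have /not_andP[//|/existsNP[y2 /not_implyP[t2 /negP]]] := nh; rewrite -ltNge => F2.
have A1 := H y1 t1; have A2 := H y2 t2.
have H1 : f x + dotp (hd z) (y1 - x) <= h y1.
  by move: A1; rewrite ax /a le_max => /orP[|//]; rewrite leNgt F1.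
have G2 : f x + dotp (hd z) (y2 - x) <= f y2.
  by move: A2; rewrite ax /a le_max => /orP[//|]; rewrite leNgt fh F2.
pose y s := s *: y2 + (1 - s) *: y1.
pose d s := f (y s) - h (y s).
have yc : continuous y.
  apply: continuous_rV => i; under eq_fun do rewrite !mxE.
  have ci : continuous (fun s : R => s) by move=> s; exact: cvg_id.
  apply: contD; apply: contM => //; [exact: cont_cst| |exact: cont_cst].
  by apply: contB => //; exact: cont_cst.
have dc : continuous d by apply: contB; apply: (cont_comp yc); exact: convexf_continuous.
have [s /[!in_itv]/= s01 ds] : exists2 s, s \in `[0, 1] & d s = 0.
  have y0 : y 0 = y1 by rewrite /y scale0r add0r subr0 scale1r.
  have y1' : y 1 = y2 by rewrite /y subrr scale0r addr0 scale1r.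
  apply: IVT => //; first exact: continuous_subspaceT.
  rewrite /d y0 y1' ge_min le_max; apply/andP; split; apply/orP; [left|right]; lra.
have ty : tl (y s) = tl z by rewrite /y tlD !tlZ t1 t2 -scalerDl addrC subrK scale1r.
have := H _ ty; have e : f (y s) = h (y s) by apply/eqP; rewrite -subr_eq0 -/(d s) ds.
rewrite ax /a e maxxx; have := cb y2 y1 s01; rewrite -/(y s) /b e minxx.
have -> : y s - x = s *: (y2 - x) + (1 - s) *: (y1 - x).
  rewrite !scalerBr addrACA -opprD -scalerDl [s + _]addrC subrK scale1r //.
rewrite dotpDr !dotpZr => h1 h2; have /andP[s0 s1] := s01.
have m1 : Num.min (f y1) (h y1) < f x + dotp (hd z) (y1 - x) by rewrite gt_min F1.
have m2 : Num.min (f y2) (h y2) < f x + dotp (hd z) (y2 - x) by rewrite gt_min fh F2 orbT.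
have [s00|s00] := ltP 0 s; last by have s0' : s = 0 by [lra]; subst s; lra.
have p2 := mulr_gt0 s00 (_ : 0 < f x + dotp (hd z) (y2 - x) - Num.min (f y2) (h y2)).
have p1 := mulr_ge0 (_ : 0 <= 1 - s) (ltW (_ : 0 < f x + dotp (hd z) (y1 - x) - Num.min (f y1) (h y1))).
move: p1 p2; rewrite !subr_gt0 subr_ge0 => /(_ s1 m1) p1 /(_ m2) p2; lra.
Qed.

End MaxMin.

(** Pointwise source of the valuation property: where [f x] and [h x] differ, maximum and minimum
    coincide locally with [f] and [h] in some order; at equality, [am_max_eq] and [am_min_eq] give
    the union and the intersection. *)
Lemma am_valuation f h z x : convexf f -> convexf h -> convexf (fun x => Num.min (f x) (h x)) ->
  (am (fun x => Num.max (f x) (h x)) z x \/ am (fun x => Num.min (f x) (h x)) z x <->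
   am f z x \/ am h z x) /\
  (am (fun x => Num.max (f x) (h x)) z x /\ am (fun x => Num.min (f x) (h x)) z x <->
   am f z x /\ am h z x).
Proof.
move=> cf ch cb; have [fh|fh|fh] := ltrgtP (f x) (h x).
- by have [h1 h2] := am_lt cf ch cb z fh; tauto.
- have cb' : convexf (fun x => Num.min (h x) (f x)) by under eq_fun do rewrite minC.
  have [h1 h2] := am_lt ch cf cb' z fh.
  have -> : (fun x => Num.max (f x) (h x)) = (fun x => Num.max (h x) (f x)) by apply/funext => ?; rewrite maxC.
  have -> : (fun x => Num.min (f x) (h x)) = (fun x => Num.min (h x) (f x)) by apply/funext => ?; rewrite minC.
  tauto.
- have h1 := am_max_eq cf ch cb z fh; have h2 := am_min_eq z fh; tauto.
Qed.

(** This operation on [f], like the two below, acts on [z] by a translation or a diagonal scaling,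
    under which Lebesgue measure is known to transform. *)
Lemma am_aff f y c z x : am (fun x => f x + (dotp y x + c)) z x <-> am f (z - hd y) x.
Proof.
have tz : tl (z - hd y) = tl z by rewrite tlD tlN tl_hd oppr0 addr0.
have hz : hd (z - hd y) = hd z - hd y by rewrite hdD hdN hd_hd.
have E w : tl w = tl z -> tl x = tl z -> dotp (hd y) (w - x) = dotp y w - dotp y x.
  move=> tw tx; rewrite dotpC dotpC -dotpNr -dotpDr.
  have e : w - x = hd (w - x) by rewrite -[LHS]hd_tlK tlD tlN tw tx subrr addr0.
  by rewrite dotp_hd e hd_hd [in RHS]e dotpC [in RHS]dotpC; apply: eq_bigr => i _; rewrite !hdE; case: ifP; rewrite ?mul0r ?mulr0.
split=> -[tx H]; split; rewrite ?tz// ?tx ?tz// => w tw.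
  have := H w tw; rewrite hz dotpBl E//; lra.
have tx' := tx; rewrite tz in tx'.
have := H w; rewrite tz hz dotpBl E// => /(_ tw); lra.
Qed.

Lemma am_shift f v z x : am (fun x => f (x + v)) z x <-> am f (z + tl v) (x + v).
Proof.
have tz : tl (z + tl v) = tl z + tl v by rewrite tlD tl_tl.
have hz : hd (z + tl v) = hd z by rewrite hdD hd_tl addr0.
split=> -[tx H]; split.
- by rewrite tlD tz tx.
- move=> y; rewrite tz hz => ty; have := H (y - v).
  rewrite tlD tlN ty addrK => /(_ erefl); rewrite subrK.
  by rewrite -addrA -opprD [v + x]addrC.
- by move: tx; rewrite tlD tz => /addIr.
- move=> y ty; have := H (y + v); rewrite tlD tz ty hz => /(_ erefl).
  by rewrite opprD addrACA subrr addr0.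
Qed.

Lemma am_scale f t z x : 0 < t -> am (fun x => t * f x) z x <-> am f (t^-1 *: hd z + tl z) x.
Proof.
move=> t0; have tz : tl (t^-1 *: hd z + tl z) = tl z by rewrite tlD tlZ tl_hd scaler0 add0r tl_tl.
have hz : hd (t^-1 *: hd z + tl z) = t^-1 *: hd z by rewrite hdD hdZ hd_hd hd_tl addr0.
have E c y : (t * f x + c <= t * f y) = (f x + t^-1 * c <= f y).
  by rewrite -[RHS](ler_pM2l t0) mulrDr mulrA mulfV ?gt_eqF// mul1r.
rewrite /am tz hz; split=> -[tx H]; split=> // y ty; have := H y ty.
  by rewrite dotpZl E.
by rewrite dotpZl E.
Qed.

(** Add the two minimality inequalities, each tested at the other minimizer. *)
Lemma am_monotone f z z' x x' : tl z = tl z' -> am f z x -> am f z' x' -> 0 <= dotp (hd z - hd z') (x - x').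
Proof.
move=> tz [tx H] [tx' H'].
have h1 := H x'; rewrite tx' tz in h1; have {h1} := h1 erefl.
have h2 := H' x; rewrite tx tz in h2; have {h2} := h2 erefl.
rewrite dotpBl; rewrite -[x' - x]opprB dotpNr; lra.
Qed.

End PartialMinimizers.

(** * Almost everywhere uniqueness of minimizers and the pushforward measure *)

Section SubgradientMeasure.
Variables (R : realType) (n k : nat).
Local Notation V := 'rV[R]_n.
Local Notation BV := (Borel R n).
Local Notation am := (am k).
Local Notation L := (leb R n).
Implicit Types (f h : V -> R) (x y z w : V) (B : set V).

Lemma cont_coord (T : topologicalType) (g : T -> V) i : continuous g -> continuous (fun t => g t ord0 i).
Proof.
move=> cg; rewrite (_ : (fun t => _) = fun t => dotp (delta_mx ord0 i) (g t)).
  by apply: cont_comp cg _; exact: dotp_continuous.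
by apply/funext => t; rewrite dotp_delta.
Qed.

Lemma cont_hd (T : topologicalType) (g : T -> V) : continuous g -> continuous (fun t => hd k (g t)).
Proof.
move=> cg; apply: continuous_rV => i; under eq_fun do rewrite hdE.
by case: (i < k)%N; [exact: cont_coord|exact: cont_cst].
Qed.

Lemma cont_addV (T : topologicalType) (g g' : T -> V) : continuous g -> continuous g' ->
  continuous (fun t => g t + g' t).
Proof.
by move=> c c'; apply: continuous_rV => i; under eq_fun do rewrite mxE; apply: contD; exact: cont_coord.
Qed.

Lemma cont_oppV (T : topologicalType) (g : T -> V) : continuous g -> continuous (fun t => - g t).
Proof.
by move=> c; apply: continuous_rV => i; under eq_fun do rewrite mxE; apply: contN; exact: cont_coord.
Qed.

Lemma cont_dotp (T : topologicalType) (g g' : T -> V) : continuous g -> continuous g' ->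
  continuous (fun t => dotp (g t) (g' t)).
Proof. by move=> c c'; apply: cont_sum => i _; apply: contM; exact: cont_coord. Qed.

(** A violated condition stays violated under perturbation; the competitor [Y p] moves along with
    [tl z] to stay in the slice. *)
Lemma not_am_open f : convexf f -> open [set p : V * V | ~ am f p.1 p.2].
Proof.
move=> cf; have cfc := convexf_continuous cf.
have c1 : continuous (@fst V V) by move=> p; exact: cvg_fst.
have c2 : continuous (@snd V V) by move=> p; exact: cvg_snd.
have cT (g : V * V -> V) : continuous g -> continuous (fun p => tl k (g p)).
  by move=> cg; apply: cont_addV => //; apply: cont_oppV; exact: cont_hd.
rewrite openE => -[z0 x0] /= /not_andP[nt|/existsNP[y /not_implyP[ty /negP]]].
  pose U := [set p : V * V | 0 < `|tl k p.2 - tl k p.1|].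
  have oU : open U.
    apply: (open_comp _ (@open_gt R 0)) => p _.
    apply: (cont_comp (h := fun p : V * V => tl k p.2 - tl k p.1)); last exact: norm_continuous.
    by apply: cont_addV; [exact: cT|apply: cont_oppV; exact: cT].
  apply: (@filterS _ _ _ U); last first.
    by apply: open_nbhs_nbhs; split => //; rewrite /U /= normr_gt0 subr_eq0; apply/eqP.
  by move=> p; rewrite /U /= => + [e _]; rewrite e subrr normr0 ltxx.
rewrite -ltNge => lt0.
pose Y (p : V * V) := y + (tl k p.1 - tl k z0).
have cY : continuous Y.
  apply: cont_addV; first exact: (fun _ => cvg_cst _).
  by apply: cont_addV; [exact: cT|exact: (fun _ => cvg_cst _)].
pose U := [set p : V * V | 0 < f p.2 + dotp (hd k p.1) (Y p - p.2) - f (Y p)].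
have oU : open U.
  apply: (open_comp _ (@open_gt R 0)) => p _.
  apply: contB; last exact: cont_comp.
  apply: contD; first exact: cont_comp.
  exact: (cont_dotp (cont_hd c1) (cont_addV cY (cont_oppV c2))).
apply: (@filterS _ _ _ U).
  move=> p; rewrite /U /= => + [tp H]; rewrite subr_gt0 ltNge => /negP; apply; apply: H.
  by rewrite /Y tlD ty tlD tlN !tl_tl addrC subrK.
apply: open_nbhs_nbhs; split => //.
by rewrite /U /= /Y /= subrr addr0 subr_gt0.
Qed.

Definition Nset f B : set V := [set z | exists2 x, B x & am f z x].
Definition dbl f : set V := [set z | exists x x', [/\ am f z x, am f z x' & x <> x']].

(** Compactness of [B] makes the open condition [~ am] uniform over [B]. *)
Lemma Nset_closed f r B : convexf f -> closed B -> (forall x, B x -> `|x| <= r) -> closed (Nset f B).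
Proof.
move=> cf cB Br; rewrite -openC openE => z nz.
have /compact_near_coveringP K : compact B.
  by apply: (subclosed_compact cB (@cball_compact R n r)) => x /Br.
have H : \forall z' \near z, forall x, B x -> ~ am f z' x.
  apply: (K V (nbhs z) (fun z' x => ~ am f z' x)) => x Bx.
  have nzx : [set p : V * V | ~ am f p.1 p.2] (z, x) by move=> /= ax; apply: nz; exists x.
  have := open_nbhs_nbhs (conj (not_am_open cf) nzx).
  by move=> [[U W] /= [Uz Wx] UW]; exists (W, U) => // -[x' z'] /= [Wx' Uz']; exact: (UW (z', x')).
by apply: filterS H => z' h [x Bx ax]; exact: (h x).
Qed.

(** The slope components of [z] are controlled by comparing [x] with [x + e_i] and [x - e_i], still
    in the ball of radius [r + 1]; the other components are those of [x]. *)
Lemma Nset_bounded f r M z : (forall x, `|x| <= r + 1 -> `|f x| <= M) ->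
  Nset f [set x | `|x| <= r] z -> `|z| <= r + 2 * M.
Proof.
move=> hM [x /= xr [tx H]].
have r0 : 0 <= r := le_trans (normr_ge0 _) xr.
have fx : `|f x| <= M by apply: hM; lra.
have M0 : 0 <= M := le_trans (normr_ge0 _) fx.
apply: norm_le_coord => [|i]; first by rewrite addr_ge0// mulr_ge0.
have [ik|ik] := ltnP i k; last first.
  have := congr1 (fun v : V => v ord0 i) tx; rewrite !tlE ltnNge ik /= => <-.
  by have := norm_coord x i; have : 0 <= 2 * M by [exact: mulr_ge0]; lra.
have e1 : `|delta_mx ord0 i : V| <= 1.
  by apply: norm_le_coord => // j; rewrite mxE eqxx /=; case: eqP; rewrite ?normr1 ?normr0.
have hb (s : R) : `|s| = 1 -> s * z ord0 i <= 2 * M.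
  move=> s1; have := H (x + s *: delta_mx ord0 i).
  have -> : tl k (x + s *: delta_mx ord0 i) = tl k z.
    rewrite tlD tx tlZ (_ : tl k (delta_mx ord0 i) = 0) ?scaler0 ?addr0//.
    apply/rowP => j; rewrite tlE !mxE eqxx /=; case: ifP => // /negbT jk.
    by case: eqP => // ji; rewrite ji ik in jk.
  move=> /(_ erefl); rewrite [x + _]addrC addrK dotpZr dotpC dotp_delta hdE ik.
  have : `|f (s *: delta_mx ord0 i + x)| <= M.
    apply: hM; apply: (le_trans (ler_normD _ _)); rewrite normrZ s1 mul1r; lra.
  by move: fx; rewrite !ler_norml => /andP[? ?] /andP[? ?]; lra.
rewrite ler_norml; have h1 := hb 1 (normr1 _); have h2 := hb (- 1).
rewrite normrN normr1 in h2; have {}h2 := h2 erefl.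
apply/andP; split; lra.
Qed.

Lemma leb1_subsingleton (A : set R) : (forall s s', s < s' -> A s -> A s' -> False) ->
  lebesgue_measure A = 0%E.
Proof.
move=> h; have [->|/set0P[s As]] := eqVneq A set0; first by rewrite measure0.
rewrite (_ : A = [set s]) ?lebesgue_measure_set1//.
apply/seteqP; split=> [t At|t ->//] /=.
by have [ts|st|//] := ltrgtP t s; [case: (h _ _ ts)|case: (h _ _ st)].
Qed.

(** With rational [q < q'] and integer radius [j], countably many of these sets exhaust [dbl f]. *)
Definition gap f (i : 'I_n) (q q' : R) (j : nat) : set V :=
  Nset f [set x : V | `|x| <= j%:R /\ x ord0 i <= q] `&` Nset f [set x : V | `|x| <= j%:R /\ q' <= x ord0 i].

Lemma measurable_Nset_ball f B (j : nat) : convexf f -> closed B ->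
  measurable (Nset f (B `&` [set x | `|x| <= j%:R]) : set BV).
Proof.
move=> cf cB; apply: closed_borel; apply: (@Nset_closed f j%:R) => //; last by move=> x [].
by apply: closedI => //; exact: closed_ball_closed.
Qed.

Lemma measurable_gap f (i : 'I_n) (q q' : R) j : convexf f -> measurable (gap f i q q' j : set BV).
Proof.
move=> cf; have cc : continuous (fun x : V => x ord0 i) by apply: cont_coord => x; exact: cvg_id.
apply: measurableI.
  have := @measurable_Nset_ball f [set x : V | x ord0 i <= q] j cf (closed_comp (fun x _ => cc x) (@closed_le R q)).
  by congr measurable; apply/seteqP; split=> z [x /= [h1 h2] ax]; exists x.
have := @measurable_Nset_ball f [set x : V | q' <= x ord0 i] j cf (closed_comp (fun x _ => cc x) (@closed_ge R q')).
by congr measurable; apply/seteqP; split=> z [x /= [h1 h2] ax]; exists x.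
Qed.

(* By monotonicity of subgradients, every line in direction [i] meets a gap in
   at most one point. *)
Lemma gap_null f (i : 'I_n) (q q' : R) j : convexf f -> (i < k)%N -> q < q' -> L (gap f i q q' j) = 0%E.
Proof.
move=> cf ik qq; apply: (@leb_null_lines _ _ _ i); first exact: measurable_gap.
move=> x; apply: leb1_subsingleton => s s' ss [_ [x1 /= [_ x1q] a1]] [[x2 /= [_ x2q] a2] _].
have tlu t : tl k (updv x i t) = tl k x.
  by apply/rowP => l; rewrite !tlE mxE; case: ifP => // /negbT; case: eqP => // ->; rewrite ik.
have := am_monotone _ a1 a2; rewrite !tlu => /(_ erefl).
have -> : hd k (updv x i s) - hd k (updv x i s') = (s - s') *: delta_mx ord0 i.
  apply/rowP => l; rewrite !mxE eqxx /=; case: eqP => [->|_]; first by rewrite ik mulr1.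
  by rewrite subrr mulr0.
rewrite dotpZl dotp_delta !mxE; nra.
Qed.

Lemma dbl_gap f z : dbl f z <-> exists (i : 'I_n) q q' j,
  [/\ (i < k)%N, (ratr q < ratr q' :> R) & gap f i (ratr q) (ratr q') j z].
Proof.
split=> [[x [x' [ax ax' xx]]]|[i [q [q' [j [ik qq [[x /= [_ xq] ax] [x' /= [_ xq'] ax']]]]]]]]; last first.
  by exists x, x'; split=> // e; rewrite e in xq; lra.
have [i xi] : exists i, x ord0 i != x' ord0 i.
  by apply: contrapT => /forallNP h; apply: xx; apply/rowP => i; apply/eqP; apply: contrapT => /negP; exact: h.
wlog lt : x x' ax ax' xx xi / x ord0 i < x' ord0 i.
  move=> W; have [lt|lt|e] := ltrgtP (x ord0 i) (x' ord0 i); first exact: (W x x').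
    by apply: (W x' x) => //; [exact: nesym|rewrite eq_sym].
  by rewrite e eqxx in xi.
have ik : (i < k)%N.
  rewrite ltnNge; apply/negP => ki; have [tx _] := ax; have [tx' _] := ax'.
  have := congr1 (fun v : V => v ord0 i) (etrans tx (esym tx')); rewrite !tlE ltnNge ki /= => e.
  by rewrite e ltxx in lt.
have [q /andP[q1 q2]] := rat_in_itvoo lt; rewrite !bnd_simp in q1 q2.
have [q' /andP[q1' q2']] := rat_in_itvoo q2; rewrite !bnd_simp in q1' q2'.
have [j hj] := natr_unbounded (Num.max `|x| `|x'|); move: hj; rewrite gt_max => /andP[h1 h2].
exists i, q, q', j; split=> //; split; [exists x|exists x'] => //=; split; exact: ltW.
Qed.

Definition gapn f (m : nat) : set V :=
  if unpickle m is Some p then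
    let: (i, q, q', j) := (p : 'I_n * rat * rat * nat) in
    if (i < k)%N && ((ratr q : R) < ratr q') then gap f i (ratr q) (ratr q') j else set0
  else set0.

Lemma dblE f : dbl f = \bigcup_m gapn f m.
Proof.
apply/seteqP; split=> z.
  move=> /dbl_gap[i [q [q' [j [ik qq gz]]]]]; exists (pickle (i, q, q', j)) => //.
  by rewrite /gapn pickleK ik qq.
move=> [m _]; rewrite /gapn; case: unpickle => // -[[[i q] q'] j]; case: ifP => // /andP[ik qq] gz.
by apply/dbl_gap; exists i, q, q', j.
Qed.

Lemma gapn_null f m : convexf f -> measurable (gapn f m : set BV) /\ L (gapn f m) = 0%E.
Proof.
move=> cf; rewrite /gapn; case: unpickle => [[[[i q] q'] j]|]; last by rewrite measure0.
case: ifP => [/andP[ik qq]|_]; last by rewrite measure0.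
by split; [exact: measurable_gap|exact: gap_null].
Qed.

Lemma measurable_dbl f : convexf f -> measurable (dbl f : set BV).
Proof. by move=> cf; rewrite dblE; apply: bigcupT_measurable => m; case: (gapn_null m cf). Qed.

Lemma dbl_null f : convexf f -> L (dbl f) = 0%E.
Proof.
move=> cf; apply: measure_negligible; first exact: measurable_dbl.
rewrite dblE; apply: negligible_bigcup => m; have [mg g0] := gapn_null m cf.
by apply/negligibleP.
Qed.

Definition Xset f B : set V := Nset f B `\` dbl f.

(** Uniqueness of the minimizer makes [Xset f] compatible with complements and unions, which reduces
    the claim to closed sets; those are cut into compact pieces. *)
Lemma measurable_Xset f B : convexf f -> measurable (B : set BV) -> measurable (Xset f B : set BV).
Proof.
move=> cf; have mC (K : set V) : closed K -> measurable (Xset f K : set BV).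
  move=> cK; apply: measurableD; last exact: measurable_dbl.
  rewrite (_ : Nset f K = \bigcup_j Nset f (K `&` [set x | `|x| <= j%:R])).
    by apply: bigcupT_measurable => j; exact: measurable_Nset_ball.
  apply/seteqP; split=> [z [x Kx ax]|z [j _ [x [Kx _] ax]]]; last by exists x.
  by have [j /ltW hj] := natr_unbounded `|x|; exists j => //; exists x.
have XC (K : set V) : Xset f (~` K) = Xset f setT `\` Xset f K.
  apply/seteqP; split=> z.
    move=> [[x Kx ax] nd]; split; first by split=> //; exists x.
    move=> [[x' Kx' ax'] _]; apply: nd; exists x, x'; split=> // e; by rewrite e in Kx.
  move=> [[[x _ ax] nd] nK]; split=> //; exists x => // Kx; apply: nK; split=> //; by exists x.
have mT : measurable (Xset f setT : set BV) by apply: mC; exact: closedT.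
move: B; apply: smallest_sub => /=.
  split => /=.
  - by rewrite /Xset (_ : Nset f set0 = set0) ?set0D//; apply/seteqP; split=> // z [].
  - by move=> A mA; rewrite setTD XC; exact: measurableD.
  - move=> F mF; rewrite (_ : Xset f _ = \bigcup_i Xset f (F i)); first exact: bigcupT_measurable.
    apply/seteqP; split=> [z [[x [i _ Fx] ax] nd]|z [i _ [[x Fx ax] nd]]]; first by exists i => //; split=> //; exists x.
    by split=> //; exists x => //; exists i.
move=> U oU; rewrite -[U]setCK XC; apply: measurableD => //; apply: mC; exact: open_closedC.
Qed.

(** The value 0 makes the map total; [ama] restricts Lebesgue measure to the set where the minimizer
    exists and is unique. *)
Definition argm f z : V := if `[< Xset f setT z >] then xget 0 [set x | am f z x] else 0.

Lemma Xset_argm f B z : Xset f B z <-> Xset f setT z /\ B (argm f z).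
Proof.
rewrite /argm; split=> [[[x Bx ax] nd]|].
  have X : Xset f setT z by split=> //; exists x.
  rewrite asboolT//; split=> //; have a' : am f z (xget 0 [set x | am f z x]) by apply: (xgetPex 0 (P := [set x | am f z x])); exists x.
  suff -> : xget 0 [set x | am f z x] = x by [].
  by apply: contrapT => e; apply: nd; exists (xget 0 [set x | am f z x]), x.
move=> [X]; rewrite asboolT// => Bx; have [[x _ ax] nd] := X; split=> //.
by exists (xget 0 [set x | am f z x]) => //; by apply: (xgetPex 0 (P := [set x | am f z x])); exists x.
Qed.

Lemma measurable_argm f : convexf f -> measurable_fun setT (argm f : BV -> BV).
Proof.
move=> cf _ B mB; rewrite setTI.
rewrite (_ : _ @^-1` B = Xset f B `|` (~` Xset f setT `&` [set _ | B 0])).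
  apply: measurableU; first exact: measurable_Xset.
  apply: measurableI; first by apply: measurableC; exact: measurable_Xset.
  have [B0|B0] := pselect (B 0).
    by rewrite (_ : [set _ | _] = setT)//; apply/seteqP; split.
  by rewrite (_ : [set _ | _] = set0)//; apply/seteqP; split.
apply/seteqP; split=> z /=.
  have [X|X] := pselect (Xset f setT z) => Bz; first by left; apply/Xset_argm.
  by right; split=> //; move: Bz; rewrite /argm asboolF.
by move=> [/Xset_argm[]//|[X B0]]; rewrite /argm asboolF.
Qed.

Definition ama f (cf : convexf f) : {measure set BV -> \bar R} :=
  pushm (mrestr L (measurable_Xset cf (@measurableT _ BV))) (measurable_argm cf).

Lemma amaE f (cf : convexf f) B : ama cf B = L (Xset f B).
Proof.
rewrite /ama pushmE /mrestr; congr (L _); apply/seteqP; split=> z /=.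
  by move=> [Bz X]; apply/Xset_argm.
by move=> /Xset_argm[].
Qed.

Lemma ama_locfin f (cf : convexf f) : locfin (ama cf).
Proof.
move=> r; rewrite amaE; have [M M0 hM] := convexf_bound (r + 1) cf.
apply: le_lt_trans (@leb_locfin R n (r + 2 * M)); apply: le_measure.
- by rewrite inE; apply: measurable_Xset => //; exact: cball_borel.
- by rewrite inE; exact: cball_borel.
by move=> z [/(Nset_bounded hM)].
Qed.

End SubgradientMeasure.

(** * Invariance, locality, homogeneity and the valuation property *)

Section MongeAmpere.
Variables (R : realType) (n k : nat).
Hypothesis hn : (0 < n)%N.
Local Notation V := 'rV[R]_n.
Local Notation BV := (Borel R n).
Local Notation am := (am k).
Local Notation L := (leb R n).
Local Notation dbl := (dbl k).
Local Notation Xset := (Xset k).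
Local Notation Nset := (Nset k).
Local Notation argm := (argm k).
Implicit Types (f h : V -> R) (x y z w : V) (B : set V).

Lemma leb_ae_eq (A A' D : set V) : measurable (A : set BV) -> measurable (A' : set BV) ->
  measurable (D : set BV) -> L D = 0%E -> (forall z, ~ D z -> (A z <-> A' z)) -> L A = L A'.
Proof.
have le C C' : measurable (C : set BV) -> measurable (C' : set BV) ->
    measurable (D : set BV) -> L D = 0%E -> (forall z, ~ D z -> (C z <-> C' z)) -> (L C <= L C')%E.
  move=> mC mC' mD D0 e; rewrite -(measureU0 mC' mD D0); apply: le_measure.
  - by rewrite inE.
  - by rewrite inE; exact: measurableU.
  by move=> z Cz; have [Dz|nD] := pselect (D z); [right|left; apply/(e z nD)].
move=> mA mA' mD D0 e; apply/le_anti/andP; split; apply: le => // z nD.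
by have [] := e z nD.
Qed.

Definition maP f B : R := if `[< convexf f /\ bborel B >] then fine (L (Xset f B)) else 0.

Lemma maPE f B : convexf f -> bborel B -> maP f B = fine (L (Xset f B)).
Proof. by move=> cf bB; rewrite /maP asboolT. Qed.

Lemma Xset_fin f B : convexf f -> bborel B -> (L (Xset f B) < +oo)%E.
Proof.
move=> cf bB; rewrite -(amaE k cf); have := locfin_fin_num (@ama_locfin R n k f cf) bB.
by rewrite ge0_fin_numE.
Qed.

Lemma maP_rdecomp f (cf : convexf f) : rdecomp (maP f) (ama k cf) mzero.
Proof.
split.
- exact: ama_locfin.
- by move=> r; rewrite /mzero ltry.
- by move=> B bB; rewrite maPE// amaE subr0.
- by move=> B nB; rewrite /maP asboolF// => -[].
Qed.

Lemma Xset_iff f h z z' v B B' : (forall x, am f z x <-> am h z' (x + v)) ->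
  (forall x, B x <-> B' (x + v)) -> (Xset f B z <-> Xset h B' z').
Proof.
move=> e eB; split=> -[[x Bx ax] nd]; split.
- by exists (x + v); [apply/eB|apply/e].
- move=> [x1 [x2 [a1 a2 ne]]]; apply: nd; exists (x1 - v), (x2 - v); split.
  + by apply/e; rewrite subrK.
  + by apply/e; rewrite subrK.
  + by move=> /addIr.
- by exists (x - v); [apply/eB; rewrite subrK|apply/e; rewrite subrK].
- move=> [x1 [x2 [a1 a2 ne]]]; apply: nd; exists (x1 + v), (x2 + v); split; [exact/e|exact/e|].
  by move=> /addIr.
Qed.

Lemma Xset_eq f h (g : V -> V) v B B' : (forall z x, am f z x <-> am h (g z) (x + v)) ->
  (forall x, B x <-> B' (x + v)) -> Xset f B = g @^-1` (Xset h B').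
Proof.
move=> e eB; apply/funext => z; apply/propext; apply: (@Xset_iff f h z (g z) v) => //.
Qed.

Lemma Xset_eq0 f h (g : V -> V) B : (forall z x, am f z x <-> am h (g z) x) ->
  Xset f B = g @^-1` (Xset h B).
Proof. by move=> e; apply: (@Xset_eq _ _ _ 0) => *; rewrite addr0. Qed.

Lemma maP_aff f y c : convexf f -> maP (fun x => f x + (dotp y x + c)) = maP f.
Proof.
move=> cf; have cf' : convexf (fun x => f x + (dotp y x + c)) by apply: convexfD => //; exact: convexf_aff.
apply/funext => B; have [bB|nB] := pselect (bborel B); last by rewrite /maP !asboolF// => -[].
rewrite !maPE//; congr fine.
rewrite -[RHS](leb_shift (- hd k y)); last by apply: measurable_Xset => //; case: bB.
by rewrite (@Xset_eq0 _ f (fun z => z - hd k y))// => z x; exact: am_aff.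
Qed.

(** Off the null set where either function has several minimizers, a minimizer in [U] for one
    function is one for the other. *)
Lemma maP_local f h U : open U -> convexf f -> convexf h -> (forall x, U x -> f x = h x) ->
  forall B, bborel B -> maP f (B `&` U) = maP h (B `&` U).
Proof.
move=> oU cf ch e B bB.
have bBU : bborel (B `&` U).
  split; last by have [_ [r Br]] := bB; exists r => x [/Br].
  by apply: (@measurableI _ BV); [case: bB|exact: open_borel].
rewrite !maPE//; congr fine; apply: (@leb_ae_eq _ _ (dbl f `|` dbl h)).
- by apply: measurable_Xset => //; case: bBU.
- by apply: measurable_Xset => //; case: bBU.
- by apply: measurableU; exact: measurable_dbl.
- by rewrite measureU0 ?dbl_null//; exact: measurable_dbl.
move=> z /not_orP[nf nh]; split=> -[[x [Bx Ux] ax] nd]; split=> //; exists x => //.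
  exact: (am_eq_local cf ch oU Ux e).
by apply: (am_eq_local ch cf oU Ux) => // y Uy; rewrite e.
Qed.

Lemma bborel_shift B v : bborel B -> bborel [set x : V | B (x + v)].
Proof.
move=> bB; apply: (bborel_preimage (h := fun x => x + v) (@shift_continuous R n v) _ bB) => r.
exists (r + `|v|) => z zr; rewrite -[z](addrK v) (le_trans (ler_normB _ _))//.
by rewrite lerD2r.
Qed.

Lemma maP_trans f v : convexf f -> forall B, bborel B ->
  maP (fun z => f (z + v)) B = maP f [set b + v | b in B].
Proof.
move=> cf B bB; have cf' := convexf_shift v cf.
have -> : [set b + v | b in B] = [set x | B (x - v)].
  by apply/seteqP; split=> [_ [b Bb <-]|x Bx] /=; [rewrite addrK|exists (x - v); rewrite // subrK].
have bB' := bborel_shift (- v) bB.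
rewrite !maPE//; congr fine; rewrite -[RHS](leb_shift (tl k v)); last by apply: measurable_Xset => //; case: bB'.
rewrite (@Xset_eq _ f (fun z => z + tl k v) v _ [set x | B (x - v)])//.
  by move=> z x; exact: am_shift.
by move=> x /=; rewrite addrK.
Qed.

Lemma am0 f z x : k = 0%N -> (am f z x <-> x = z).
Proof.
move=> k0; have h0 y : hd k y = 0 by apply/rowP => i; rewrite hdE k0 ltn0 mxE.
have t0 y : tl k y = y by rewrite /tl h0 subr0.
split=> [[+ _]|->]; first by rewrite !t0.
by split=> // y; rewrite !t0 => ->; rewrite subrr dotp0r addr0.
Qed.

(** A linear form with a minimum on the slice is constant there, so every point of the slice is a
    minimizer; the slice has positive dimension because [k > 0]. *)
Lemma am_zero_dbl z x : (0 < k <= n)%N -> am (fun _ => 0) z x -> dbl (fun _ => 0) z.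
Proof.
move=> /andP[k0 kn] [tx H]; pose i : 'I_n := Ordinal hn.
have te : tl k (delta_mx ord0 i : V) = 0.
  apply/rowP => j; rewrite tlE !mxE eqxx /=; case: ifP => // /negbT jk; case: eqP => // ji.
  by rewrite ji /= k0 in jk.
have dz y : dotp (hd k z) (y - x) <= 0 -> tl k y = tl k z -> True by [].
have d0 w : tl k w = 0 -> dotp (hd k z) w = 0.
  move=> tw; apply/le_anti; have h1 := H (x + w); have h2 := H (x - w).
  rewrite !tlD ?tlN tw tx ?subr0 addr0 in h1 h2.
  have {h1} := h1 erefl; have {h2} := h2 erefl.
  by rewrite ![x + _]addrC !addrK add0r dotpNr add0r => h1 h2; apply/andP; split; lra.
exists x, (x + delta_mx ord0 i); split=> //.
  split; first by rewrite tlD te addr0.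
  move=> y ty; rewrite add0r d0// tlD tlN tlD te ty tx addr0 subrr//.
move=> /rowP/(_ i); rewrite !mxE !eqxx /= => e; have : (1 : R) = 0 by lra.
by move/eqP; rewrite oner_eq0.
Qed.

(** For [t > 0] slopes scale by [t], a diagonal change of the first [k] coordinates with determinant
    [t ^ k]. For [t = 0] and [k > 0] no minimizer is unique; for [k = 0] the slices are points and
    [f] does not matter. *)
Lemma maP_hom f t : (k <= n)%N -> convexf f -> 0 <= t ->
  maP (fun x => t * f x) = (fun B => t ^+ k * maP f B).
Proof.
move=> kn cf t0; have cf' := convexfZ t0 cf; apply/funext => B.
have [bB|nB] := pselect (bborel B); last by rewrite /maP !asboolF ?mulr0// => -[].
rewrite !maPE//; have mX := measurable_Xset k cf bB.1; have mX' := measurable_Xset k cf' bB.1.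
move: t0; rewrite le_eqVlt => /orP[/eqP t0|t0].
  subst t; have [k0|k0] := posnP k.
    have -> : (0 : R) ^+ k = 1 by rewrite k0 expr0.
    rewrite mul1r (@Xset_eq0 _ f id)// => z x.
    by have := am0 (fun x => 0 * f x) z x k0; have := am0 f z x k0; rewrite /=; tauto.
  rewrite expr0n gtn_eqF// mul0r (_ : Xset _ B = set0) ?measure0//.
  apply/seteqP; split=> // z [[x _ ax] nd]; apply: nd; move: ax.
  have -> : (fun x => 0 * f x) = fun _ => 0 by apply/funext => y; rewrite mul0r.
  by move=> ax; apply: am_zero_dbl ax; rewrite k0.
pose c : V := \row_i (if (i < k)%N then t^-1 else 1).
have c0 i : 0 < c ord0 i by rewrite mxE; case: ifP; rewrite ?invr_gt0.
rewrite (leb_affine 0 c0 mX).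
have -> : \prod_i c ord0 i = (t ^+ k)^-1.
  under eq_bigr do rewrite mxE.
  by rewrite -big_mkcond -(big_ord_widen n (fun=> t^-1) kn) prodr_const card_ord exprVn.
have -> : affv c 0 @^-1` Xset f B = Xset (fun x => t * f x) B.
  have E z : affv c 0 z = t^-1 *: hd k z + tl k z.
    by apply/rowP => i; rewrite !mxE; case: (i < k)%N; ring.
  apply/esym/Xset_eq0 => z x; rewrite E; exact: am_scale.
have fX := Xset_fin cf' bB; have : L (Xset (fun x => t * f x) B) \is a fin_num by rewrite ge0_fin_numE.
by move=> fn; rewrite fineM//= mulrA mulfV ?mul1r// expf_neq0// gt_eqF.
Qed.

(** Inclusion-exclusion: off the parameters with several minimizers, the two pairs of sets have the
    same union and the same intersection by [am_valuation]. *)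
Lemma maP_val f h : convexf f -> convexf h -> convexf (fun x => Num.min (f x) (h x)) ->
  forall B, maP (fun x => Num.max (f x) (h x)) B + maP (fun x => Num.min (f x) (h x)) B = maP f B + maP h B.
Proof.
move=> cf ch cb B; have ca := convexf_max cf ch.
have [bB|nB] := pselect (bborel B); last by rewrite /maP !asboolF ?addr0// => -[].
rewrite !maPE//.
pose A := Xset (fun x => Num.max (f x) (h x)) B; pose C := Xset (fun x => Num.min (f x) (h x)) B.
pose F := Xset f B; pose H := Xset h B.
have [mA mC mF mH] : [/\ measurable (A : set BV), measurable (C : set BV), measurable (F : set BV) & measurable (H : set BV)].
  by split; apply: measurable_Xset => //; exact: bB.1.
have [fA fC fF fH] : [/\ (L A < +oo)%E, (L C < +oo)%E, (L F < +oo)%E & (L H < +oo)%E].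
  by split; exact: Xset_fin.
have S (X Y : set BV) : measurable X -> measurable Y -> (L X < +oo)%E -> (L Y < +oo)%E ->
    fine (L X) + fine (L Y) = fine (L (X `|` Y)) + fine (L (X `&` Y)).
  move=> mX mY fX fY; rewrite measureUfinl//.
  have n1 : L X \is a fin_num by rewrite ge0_fin_numE.
  have n2 : L Y \is a fin_num by rewrite ge0_fin_numE.
  have n3 : L (X `&` Y) \is a fin_num by rewrite ge0_fin_numE// (le_lt_trans _ fX)// measureIl.
  by rewrite fineB ?fin_numD ?n1// fineD// subrK.
apply: (etrans (S A C mA mC fA fC)); apply/esym; apply: (etrans (S F H mF mH fF fH)); apply/esym.
pose D := (dbl (fun x => Num.max (f x) (h x)) `|` dbl (fun x => Num.min (f x) (h x))) `|` (dbl f `|` dbl h).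
have mD : measurable (D : set BV) by do ![apply: measurableU]; exact: measurable_dbl.
have D0 : L D = 0%E.
  have z f1 f2 : convexf f1 -> convexf f2 -> L (dbl f1 `|` dbl f2) = 0%E.
    by move=> c1 c2; rewrite measureU0 ?dbl_null//; exact: measurable_dbl.
  by rewrite measureU0 ?z//; apply: measurableU; exact: measurable_dbl.
congr (fine _ + fine _); apply: (@leb_ae_eq _ _ D) => //; try exact: measurableU; try exact: measurableI.
  move=> z /not_orP[/not_orP[na nc] /not_orP[nf nh]].
  split=> -[[[x Bx ax] _]|[[x Bx ax] _]]; have [[h1 h2] _] := am_valuation k z x cf ch cb.
  - by have [a'|a'] := h1 (or_introl ax); [left|right]; split=> //; exists x.
  - by have [a'|a'] := h1 (or_intror ax); [left|right]; split=> //; exists x.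
  - by have [a'|a'] := h2 (or_introl ax); [left|right]; split=> //; exists x.
  - by have [a'|a'] := h2 (or_intror ax); [left|right]; split=> //; exists x.
move=> z /not_orP[/not_orP[na nc] /not_orP[nf nh]].
(* The two unique minimizers either coincide, and are then shared by [g1] and [g2], or differ, and
   then [g1] and [g2] have one each. *)
have key (f1 f2 g1 g2 : V -> R) : ~ dbl f1 z -> ~ dbl f2 z -> ~ dbl g1 z -> ~ dbl g2 z ->
   (forall x, (am f1 z x \/ am f2 z x <-> am g1 z x \/ am g2 z x) /\
              (am f1 z x /\ am f2 z x <-> am g1 z x /\ am g2 z x)) ->
   Xset f1 B z /\ Xset f2 B z -> Xset g1 B z /\ Xset g2 B z.
  move=> n1 n2 m1 m2 e [[[x Bx ax] _] [[y By ay] _]].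
  have U g a b : ~ dbl g z -> am g z a -> am g z b -> a = b.
    by move=> ng ga gb; apply: contrapT => ab; apply: ng; exists a, b.
  have [ex ex'] := e x; have [ey ey'] := e y.
  have [xy|xy] := pselect (x = y).
    by subst y; have [g1x g2x] := ex'.1 (conj ax ay); split; split=> //; exists x.
  have [g1x|g2x] := ex.1 (or_introl ax); have [g1y|g2y] := ey.1 (or_intror ay).
  - by case: xy; exact: (U g1).
  - by split; split=> //; [exists x|exists y].
  - by split; split=> //; [exists y|exists x].
  - by case: xy; exact: (U g2).
split; apply: key => // x; have := am_valuation k z x cf ch cb; tauto.
Qed.

End MongeAmpere.

(** * Weak continuity of the subgradient measure *)

Section WeakContinuity.
Variables (R : realType) (n k : nat).
Hypothesis hn : (0 < n)%N.
Local Notation V := 'rV[R]_n.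
Local Notation BV := (Borel R n).
Local Notation am := (am k).
Local Notation L := (leb R n).
Local Notation dbl := (dbl k).
Local Notation Xset := (Xset k).
Local Notation Nset := (Nset k).
Local Notation argm := (argm k).
Local Notation maP := (@maP R n k).
Implicit Types (f h phi : V -> R) (x y z w : V) (B : set V).

Lemma eventually_compact (K : set V) (P : nat -> V -> Prop) : compact K ->
  (forall x, K x -> exists N d, 0 < d /\ forall j x', (N <= j)%N -> `|x' - x| < d -> P j x') ->
  exists N, forall j x, (N <= j)%N -> K x -> P j x.
Proof.
move=> /compact_near_coveringP cK h.
have [|N _ hN] := cK nat \oo P _; last by exists N => j x /hN; apply.
move=> x /h[N [d [d0 H]]]; exists (ball x d, [set j | (N <= j)%N]) => /=.
  by split; [exact: nbhsx_ballx|exists N].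
move=> [x' j] /= [xx Nj]; apply: H => //.
by move: xx; rewrite -ball_normE /= distrC.
Qed.

Lemma lu_near (f_ : nat -> V -> R) f x e : lu_cvg f_ f -> continuous f -> 0 < e ->
  exists N d, 0 < d /\ forall j x', (N <= j)%N -> `|x' - x| < d -> `|f_ j x' - f x| < e.
Proof.
move=> lu cf e0; have e2 : 0 < e / 2 by rewrite divr_gt0.
have [N hN] := lu (`|x| + 1) _ e2.
have [d d0 hd] := continuous_unif_ball `|x| cf e2.
exists N, (Num.min 1 d); split; first by rewrite lt_min ltr01.
move=> j x' Nj; rewrite lt_min => /andP[x1 xd].
have h1 : `|f_ j x' - f x'| < e / 2.
  apply: hN => //; rewrite -[x'](subrK x) (le_trans (ler_normD _ _))// addrC lerD2l ltW//.
have h2 := hd x x' (lexx _) xd.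
rewrite (_ : _ - _ = (f_ j x' - f x') + (f x' - f x)); last by ring.
rewrite (le_lt_trans (ler_normD _ _))//; lra.
Qed.

Lemma tl_dist x y : `|tl k x - tl k y| <= `|x - y|.
Proof.
rewrite -tlN -tlD; apply: norm_le_coord => // i; rewrite tlE; case: ifP => _; first by rewrite normr0.
exact: norm_coord.
Qed.

(* [P] holds near a non-minimizer and for all large [j]: the strict inequality
   against the competitor [y] is stable. *)
Lemma not_min_stable (f_ : nat -> V -> R) f z x y : lu_cvg f_ f -> continuous f ->
  f y < f x + dotp (hd k z) (y - x) ->
  exists N d, 0 < d /\ forall j x', (N <= j)%N -> `|x' - x| < d ->
    f_ j y < f_ j x' + dotp (hd k z) (y - x').
Proof.
move=> lu cf; rewrite -subr_gt0; set g := _ - f y => g0.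
have g4 : 0 < g / 4 by rewrite divr_gt0.
have [N1 [d1 [d10 h1]]] := lu_near x lu cf g4.
have [N2 [d2 [d20 h2]]] := lu_near y lu cf g4.
have q0 : 0 < dotn (hd k z) + 1 by rewrite ltr_pwDr// dotn_ge0.
exists (maxn N1 N2), (Num.min d1 (g / 4 / (dotn (hd k z) + 1))); split.
  by rewrite lt_min d10 !divr_gt0.
move=> j x'; rewrite geq_max lt_min => /andP[j1 j2] /andP[xd xq].
have := h1 j x' j1 xd; have := h2 j y j2; rewrite subrr normr0 => /(_ d20).
have := dotp_le (hd k z) (x' - x).
have : dotn (hd k z) * `|x' - x| <= g / 4.
  rewrite ltr_pdivlMr// in xq; apply: le_trans (ltW xq); rewrite mulrC ler_wpM2l//.
  by rewrite lerDl.
have -> : y - x' = (y - x) - (x' - x) by rewrite opprB addrA subrK.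
rewrite [dotp _ (y - x - _)]dotpDr dotpNr.
move=> a1 a2; rewrite !ltr_norml => /andP[b1 b2] /andP[c1 c2].
have := le_trans a2 a1; rewrite ler_norml => /andP[e1 e2].
move: g0 c1 c2 b1 b2 e1 e2; rewrite /g; lra.
Qed.

(** At each point of the ball minimality fails stably: either some competitor is strictly better, or
    the slice is missed by a positive distance. *)
Lemma am_escape (f_ : nat -> V -> R) f z r : lu_cvg f_ f -> convexf f -> ~ Nset f setT z ->
  exists N, forall j x, (N <= j)%N -> `|x| <= r -> ~ am (f_ j) z x.
Proof.
move=> lu cf nz; have cfc := convexf_continuous cf.
apply: (eventually_compact (P := fun j x => ~ am (f_ j) z x) (@cball_compact R n r)) => x _.
have nx : ~ am f z x by move=> ax; apply: nz; exists x.
have /not_andP[nt|/existsNP[y /not_implyP[ty /negP]]] := nx.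
  exists 0%N, `|tl k x - tl k z|; split; first by rewrite normr_gt0 subr_eq0; apply/eqP.
  move=> j x' _ xx [tx' _]; move: xx; rewrite -tx' distrC => xx.
  by have := tl_dist x x'; rewrite leNgt xx.
rewrite -ltNge => /(not_min_stable lu cfc)[N [d [d0 H]]]; exists N, d; split=> // j x' Nj xd.
by move=> [_ /(_ y ty)]; rewrite leNgt H.
Qed.

(** By uniqueness [f_ j] minus the slope is eventually larger than at [x] on the part of the slice
    with [e / 2 <= |x' - x| <= e]. So its minimum over the closed ball lies inside, and is global by
    [am_local]. *)
Lemma am_stable (f_ : nat -> V -> R) f z x e : (forall j, convexf (f_ j)) -> lu_cvg f_ f -> convexf f ->
  am f z x -> ~ dbl f z -> 0 < e ->
  exists N, forall j, (N <= j)%N -> exists2 y, `|y - x| < e & am (f_ j) z y.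
Proof.
move=> cf_ lu cf ax nd e0; have cfc := convexf_continuous cf.
have [tx H] := ax.
pose K : set V := [set y | `|y - x| <= e].
have cK : compact K.
  have cs : closed K.
    apply: (closed_comp _ (@closed_le R e)) => y _.
    by apply: (cont_comp (@shift_continuous R n (- x))); exact: norm_continuous.
  apply: (subclosed_compact cs (@cball_compact R n (e + `|x|))) => y /= yx.
  by rewrite -[y](subrK x) (le_trans (ler_normD _ _))// lerD2r.
pose P j x' := e / 2 <= `|x' - x| -> tl k x' = tl k z -> f_ j x < f_ j x' + dotp (hd k z) (x - x').
have e2 : 0 < e / 2 by rewrite divr_gt0.
have [N hN] : exists N, forall j y, (N <= j)%N -> K y -> P j y.
  apply: eventually_compact => // y _.
  have [ye|ye] := ltP `|y - x| (e / 2).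
    exists 0%N, (e / 2 - `|y - x|); split; first by rewrite subr_gt0.
    move=> j x' _ xy h _; exfalso; have := ler_distD y x' x; lra.
  have [ty|ty] := pselect (tl k y = tl k z); last first.
    exists 0%N, `|tl k y - tl k z|; split; first by rewrite normr_gt0 subr_eq0; apply/eqP.
    move=> j x' _ xx _ tx'; exfalso; move: xx; rewrite -tx' => xx.
    by have := tl_dist y x'; rewrite [X in _ <= X]distrC leNgt xx.
  have lt : f x < f y + dotp (hd k z) (x - y).
    rewrite ltNge; apply/negP => le; apply: nd; exists x, y; split=> //.
      split=> // w tw; have := H w tw; have -> : w - x = (w - y) - (x - y) by rewrite opprB addrA subrK.
      rewrite dotpDr dotpNr; lra.
    by move=> xy; rewrite xy subrr normr0 in ye; lra.
  by have [N [d [d0 h]]] := not_min_stable lu cfc lt; exists N, d; split=> // j x' Nj xd _ _; exact: h.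
exists N => j Nj.
pose C := K `&` [set y | tl k y = tl k z].
have cC : compact C.
  apply: compact_closedI => //.
  rewrite (_ : [set _ | _] = [set y | `|tl k y - tl k z| <= 0]); last first.
    apply/seteqP; split=> y /=; first by move=> ->; rewrite subrr normr0.
    by rewrite normr_le0 subr_eq0 => /eqP.
  apply: (closed_comp _ (@closed_le R 0)) => y _.
  have ct : continuous (fun y : V => tl k y - tl k z).
    have ci : continuous (fun y : V => y) by move=> ?; exact: cvg_id.
    have cc : continuous (fun _ : V => - tl k z) by apply: continuous_rV => i; exact: cont_cst.
    apply: cont_addV => //.
    by apply: cont_addV => //; apply: cont_oppV; exact: cont_hd.
  by apply: (cont_comp ct); exact: norm_continuous.
have xC : C x by split=> //; rewrite /K /= subrr normr0 ltW.
pose F y := f_ j y - dotp (hd k z) y.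
have cF : continuous F by apply: contB; [exact: convexf_continuous|exact: dotp_continuous].
have [y /[!inE] [[Ky ty]] ymin] := @compact_EVT_min _ R F C (ex_intro _ x xC) cC (continuous_subspaceT cF).
have yx : `|y - x| < e / 2.
  rewrite ltNge; apply/negP => h; have := hN j y Nj Ky h ty.
  by have := ymin x; rewrite inE => /(_ xC); rewrite /F dotpDr dotpNr; lra.
exists y; first by lra.
apply: (am_local (U := [set w | `|w - x| < e])) => //.
- apply: (open_comp _ (@open_lt R e)) => w _.
  by apply: (cont_comp (@shift_continuous R n (- x))); exact: norm_continuous.
- by rewrite /=; lra.
move=> w we tw; have := ymin w; rewrite inE => /(_ (conj (ltW we) tw)).
rewrite /F dotpDr dotpNr; lra.
Qed.

Definition uam f phi z : R := phi (argm f z) * \1_(Xset f setT) z.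

Lemma uam_in f phi z x : am f z x -> ~ dbl f z -> uam f phi z = phi x.
Proof.
move=> ax nd; have X : Xset f setT z by split=> //; exists x.
have /Xset_argm[_ e] : Xset f [set x] z by split=> //; exists x.
by rewrite /uam indicE mem_set//= mulr1 e.
Qed.

Lemma uam_out f phi z : (forall x, am f z x -> phi x = 0) -> uam f phi z = 0.
Proof.
move=> h; rewrite /uam indicE; have [X|X] := pselect (Xset f setT z); last by rewrite memNset// mulr0.
have [[x _ ax] nd] := X; have := uam_in phi ax nd; rewrite /uam indicE => ->; exact: h.
Qed.

Lemma measurable_uam f phi : convexf f -> testfun phi -> measurable_fun setT (uam f phi : BV -> R).
Proof.
move=> cf tp; apply: measurable_funM.
  exact: (measurableT_comp (continuous_borel (testfun_continuous tp)) (measurable_argm k cf)).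
by apply: measurable_indic; exact: measurable_Xset.
Qed.

Lemma int_ama f (cf : convexf f) phi : testfun phi ->
  int_real (ama k cf) phi = fine (\int[L]_(z in setT) (uam f phi z)%:E)%E.
Proof.
move=> tp; rewrite /int_real; congr fine.
have mG := measurable_Xset k cf (@measurableT _ BV).
pose m := mrestr L mG.
have mp : measurable_fun setT (EFin \o (phi : BV -> R)).
  by apply/measurable_EFinP; apply: continuous_borel; exact: testfun_continuous.
have ma := measurable_argm k cf.
have If : m.-integrable setT ((EFin \o (phi : BV -> R)) \o argm f).
  have Ia := testfun_integrable (@ama_locfin R n k f cf) tp.
  apply/integrableP; split; first exact: measurableT_comp.
  have /integrableP[_] := Ia; apply: le_lt_trans.
  rewrite [X in (_ <= X)%E](ge0_integral_pushforward ma)//=.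
  by apply/measurable_EFinP; apply: continuous_borel; apply: cont_abs; exact: testfun_continuous.
rewrite /ama (integral_pushm _ mp If).
transitivity (\int[m]_(z in Xset f setT) (phi (argm f z))%:E)%E.
  rewrite (negligible_integral (N := (~` Xset f setT : set BV)))//; first by rewrite setTD setCK.
    exact: measurableC.
  by rewrite [LHS]/(mrestr _ _ _) setICl measure0.
rewrite (@eq_measure_integral _ _ _ _ L); last first.
  by move=> A mA AG; rewrite /m /mrestr; congr (L _); apply/setIidl.
rewrite integral_mkcond; apply: eq_integral => z _.
rewrite patchE /uam indicE; by case: (z \in _); rewrite ?mulr1 ?mulr0.
exact: ma.
Qed.

Lemma maP_rcint f (cf : convexf f) phi : testfun phi ->
  rcint (maP f) phi = fine (\int[L]_(z in setT) (uam f phi z)%:E)%E.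
Proof.
move=> tp; rewrite (rcintE (maP_rdecomp k cf) tp) int_ama// [int_real mzero _]/int_real.
by rewrite integral_measure_zero subr0.
Qed.

Lemma uam_cvg (f_ : nat -> V -> R) f phi z : (forall j, convexf (f_ j)) -> lu_cvg f_ f -> convexf f ->
  testfun phi -> ~ dbl f z -> (forall j, ~ dbl (f_ j) z) ->
  (fun j => uam (f_ j) phi z) @ \oo --> uam f phi z.
Proof.
move=> cf_ lu cf tp nd nd_; apply/cvgrPdist_lt => e e0.
have [r r0 hr] := testfun_radius tp.
have [[x _ ax]|nz] := pselect (Nset f setT z).
  have [d d0 hd] := continuous_unif_ball `|x| (testfun_continuous tp) e0.
  have [N hN] := am_stable cf_ lu cf ax nd d0.
  exists N => // j /= /hN[y yx ay]; rewrite (uam_in phi ax nd) (uam_in phi ay (nd_ j)) distrC.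
  exact: hd.
have [N hN] := am_escape r lu cf nz.
exists N => // j /= Nj; rewrite !uam_out ?subrr ?normr0//.
  by move=> x ax; apply: hr; rewrite ltNge; apply/negP => xr; exact: (hN j x Nj xr).
by move=> x ax; case: nz; exists x.
Qed.

(** Dominated convergence in the parameter [z]: pointwise convergence holds off countably many null
    sets, and [Nset_bounded] gives a common bounded support from index [N] on, where [C + 1] bounds
    all [f_ j]. *)
Lemma maP_cvg (f_ : nat -> V -> R) f : (forall j, convexf (f_ j)) -> convexf f ->
  lu_cvg f_ f -> forall phi, testfun phi -> (fun j => rcint (maP (f_ j)) phi) @ \oo --> rcint (maP f) phi.
Proof.
move=> cf_ cf lu phi tp; have [r r0 hr] := testfun_radius tp; have [M M0 hM] := testfun_bounded tp.
have [C C0 hC] := convexf_bound (r + 1) cf.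
have [N hN] := lu (r + 1) 1 ltr01.
rewrite maP_rcint//; under eq_fun do rewrite maP_rcint//.
pose rho := r + 2 * (C + 1); pose D : set BV := [set z : V | `|z| <= rho].
have mD : measurable D by exact: cball_borel.
have LD : (L D < +oo)%E by exact: leb_locfin.
have bnd g z : (forall x, `|x| <= r + 1 -> `|g x| <= C + 1) -> convexf g -> `|uam g phi z| <= M * \1_D z.
  move=> hg cg; rewrite indicE; have [Dz|nD] := pselect (D z).
    rewrite mem_set//= mulr1 /uam indicE normrM; have := hM (argm g z).
    by case: (_ \in _); rewrite ?normr1 ?normr0 ?mulr1 ?mulr0.
  rewrite memNset// mulr0 uam_out ?normr0// => x ax; apply: hr; rewrite ltNge; apply/negP => xr.
  by apply: nD; have := @Nset_bounded R n k g r (C + 1) z hg; apply; exists x.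
have hgj j x : `|x| <= r + 1 -> `|f_ (j + N)%N x| <= C + 1.
  move=> xr; rewrite -[f_ _ x](subrK (f x)) (le_trans (ler_normD _ _))// addrC lerD ?hC//.
  by rewrite ltW// hN// leq_addl.
have Ig : L.-integrable setT (fun z => (M%:E * (\1_D z)%:E)%E).
  by apply: integrableZl => //; exact: integrable_indic_fin.
pose N0 := dbl f `|` \bigcup_j dbl (f_ j).
have N00 : L.-negligible N0.
  apply: negligibleU; first by apply/negligibleP; [exact: measurable_dbl|exact: dbl_null].
  by apply: negligible_bigcup => j; apply/negligibleP; [exact: measurable_dbl|exact: dbl_null].
have [] := @dominated_convergence _ _ _ L setT measurableT (fun j z => (uam (f_ (j + N)%N) phi z)%:E)
  (fun z => (uam f phi z)%:E) (fun z => (M%:E * (\1_D z)%:E)%E).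
- by move=> j; apply/measurable_EFinP; exact: measurable_uam.
- by apply/measurable_EFinP; exact: measurable_uam.
- apply: negligibleS N00 => z /= nz; apply: contrapT => /not_orP[nd ndj]; apply: nz => _.
  apply: cvg_EFin; first by apply: nearW.
  have ndj' j : ~ dbl (f_ j) z by move=> d; apply: ndj; exists j.
  have := uam_cvg cf_ lu cf tp nd ndj'.
  by rewrite -(cvg_shiftn N).
- exact: Ig.
- by apply: aeW => z j _; rewrite -EFinM lee_fin; apply: bnd; [exact: hgj|].
move=> If _ lim; pose u j := fine (\int[L]_z (uam (f_ j) phi z)%:E)%E.
suff : u @ \oo --> fine (\int[L]_z (uam f phi z)%:E)%E by [].
rewrite -(cvg_shiftn N); apply: fine_cvg.
by rewrite fineK//; exact: integrable_fin_num.
Qed.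

Lemma maP_rMAVal : (k <= n)%N -> rMAVal k maP.
Proof.
move=> kn; do ?split.
- by move=> f nf; apply/funext => B; rewrite /maP asboolF// => -[].
- by move=> f cf; exists (ama k cf), mzero; exact: maP_rdecomp.
- by move=> f_ f ? ? ?; exact: maP_cvg.
- by move=> f h ? ? ?; exact: maP_val.
- by move=> f y c ?; exact: maP_aff.
- by move=> f h U *; exact: maP_local.
- by move=> f v cf B bB; exact: maP_trans.
- by move=> f t cf t0; exact: maP_hom.
Qed.

(** For half the squared Euclidean norm the unique minimizer at [z] is [z] itself, so the measure is
    Lebesgue measure. *)
Lemma maP_nonzero : exists f B, maP f B != 0.
Proof.
have cq : convexf (fun x : V => 2^-1 * nsq x) by apply: convexfZ; [rewrite invr_ge0|exact: convexf_nsq].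
pose B := [set x : V | `|x| <= 1].
have bB : bborel B by split; [exact: cball_borel|exists 1].
exists (fun x : V => 2^-1 * nsq x), B; rewrite maPE//.
have key z x : am (fun x : V => 2^-1 * nsq x) z x <-> x = z.
  have sub y : dotp (hd k z) (y - z) = dotp z (hd k (y - z)).
    by apply: eq_bigr => i _; rewrite !hdE; case: ifP; rewrite ?mul0r ?mulr0.
  have nn y : nsq y = nsq z + (2 * dotp z (y - z) + nsq (y - z)).
    have := nsq_add (y - z) z; rewrite subrK dotpZl => ->; set a := nsq (y - z); set b := dotp z _; ring.
  have nsq0 y : 0 <= nsq y by apply: sumr_ge0 => i _; exact: sqr_ge0.
  have hdsub y : tl k y = tl k z -> hd k (y - z) = y - z.
    by move=> ty; rewrite -[RHS](hd_tlK k) tlD tlN ty subrr addr0.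
  split=> [[tx H]|->]; last first.
    split=> // y ty; rewrite sub hdsub// (nn y); have := nsq0 (y - z); lra.
  have := H z erefl; have -> : dotp (hd k z) (z - x) = - dotp (hd k z) (x - z) by rewrite -dotpNr opprB.
  rewrite sub hdsub// (nn x) => h; have q0 : nsq (x - z) = 0 by apply/le_anti; rewrite nsq0 andbT; lra.
  have := nsq_ge (x - z); rewrite q0 => h2; apply/eqP; rewrite -subr_eq0 -normr_eq0.
  by have := sqr_ge0 `|x - z|; rewrite -(sqrf_eq0 `|x - z|) => h3; apply/eqP/le_anti; rewrite h2.
have -> : Xset (fun x : V => 2^-1 * nsq x) B = B.
  apply/seteqP; split=> [z [[x Bx /key e] _]|z Bz]; first by rewrite -e.
  split; first by exists z => //; exact/key.
  by move=> [x [x' [/key -> /key ->]]].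
by rewrite leb_cball// gt_eqF//= exprn_gt0// addr_gt0.
Qed.

End WeakContinuity.

(** * Action of the linear group *)

Section LinearAction.
Variables (R : realType) (n k : nat).
Hypothesis hn : (0 < n)%N.
Local Notation V := 'rV[R]_n.
Local Notation C := (complex R).
Implicit Types (f h phi : V -> R) (g : 'M[R]_n).

Lemma rMAVal_lincomb a b (P Q : (V -> R) -> set V -> R) : rMAVal k P -> rMAVal k Q ->
  rMAVal k (fun f B => a * P f B + b * Q f B).
Proof.
move=> [p1 [p2 [p3 [p4 [p5 [p6 [p7 p8]]]]]]] [q1 [q2 [q3 [q4 [q5 [q6 [q7 q8]]]]]]].
have lc f (cf : convexf f) := rrad_lincomb a b (p2 f cf) (q2 f cf).
do ?split.
- by move=> f nf; apply/funext => B; rewrite p1// q1// !mulr0 addr0.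
- by move=> f cf; case: (lc f cf).
- move=> f_ f cf_ cf lu phi tp; have [_ ->//] := lc f cf.
  under eq_fun do rewrite (lc _ (cf_ _)).2//.
  have h1 := p3 f_ f cf_ cf lu phi tp; have h2 := q3 f_ f cf_ cf lu phi tp.
  by apply: seq_cvgD; apply: seq_cvgM => //; exact: seq_cvg_cst.
- move=> f h cf ch cb B; have := p4 f h cf ch cb B; have := q4 f h cf ch cb B => e1 e2.
  by rewrite addrACA -!mulrDr e1 e2 !mulrDr addrACA.
- by move=> f y c cf; rewrite p5// q5.
- by move=> f h U *; rewrite (p6 f h U)// (q6 f h U).
- by move=> f x *; rewrite p7// q7.
- by move=> f t *; apply/funext => B; rewrite p8// q8//; ring.
Qed.

Lemma lin_continuous g : continuous (lin g : V -> V).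
Proof.
have ci : continuous (fun x : V => x) by move=> x; exact: cvg_id.
apply: continuous_rV => i; under eq_fun do rewrite mxE.
by apply: cont_sum => j _; apply: contM; [exact: cont_coord|exact: cont_cst].
Qed.

Lemma linK g : g \in unitmx -> cancel (lin g : V -> V) (lin (invmx g)).
Proof. by move=> ug x; rewrite /lin -mulmxA -trmx_mul mulVmx// trmx1 mulmx1. Qed.

Lemma linVK g : g \in unitmx -> cancel (lin (invmx g) : V -> V) (lin g).
Proof. by move=> ug x; rewrite /lin -mulmxA -trmx_mul mulmxV// trmx1 mulmx1. Qed.

Lemma linD g (x y : V) : lin g (x + y) = lin g x + lin g y.
Proof. exact: mulmxDl. Qed.

Lemma linZ g c (x : V) : lin g (c *: x) = c *: lin g x.
Proof. by rewrite /lin -scalemxAl. Qed.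

Lemma dotp_lin g (y x : V) : dotp y (lin g x) = dotp (lin g^T y) x.
Proof.
have E (u v : V) : dotp u v = (u *m v^T) ord0 ord0 by rewrite mxE; apply: eq_bigr => i _; rewrite mxE.
by rewrite !E /lin trmx_mul !trmxK mulmxA.
Qed.

Lemma convexf_lin g f : convexf f -> convexf (f \o lin g).
Proof. by move=> cf x y t t01; rewrite /= linD !linZ; exact: cf. Qed.

Lemma lu_lin g (f_ : nat -> V -> R) f : lu_cvg f_ f -> lu_cvg (fun j => f_ j \o lin g) (f \o lin g).
Proof.
move=> lu r e e0; have [s hs] := continuous_bounded_map (@lin_continuous g) r.
by have [N hN] := lu s e e0; exists N => j Nj x xr; apply: hN => //; exact: hs.
Qed.

Lemma bborel_lin g (B : set V) : g \in unitmx -> bborel B -> bborel (lin (invmx g) @` B).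
Proof.
move=> ug bB; rewrite (image_inv B (linK ug) (linVK ug)).
apply: bborel_preimage => //; first exact: lin_continuous.
move=> r; have [s hs] := continuous_bounded_map (@lin_continuous (invmx g)) r.
by exists s => x /hs; rewrite linK.
Qed.

Definition ract g (P : (V -> R) -> set V -> R) f B := P (f \o lin g) (lin (invmx g) @` B).

Lemma ract_rcint g P f phi : g \in unitmx -> rMAVal k P -> convexf f -> testfun phi ->
  rrad (ract g P f) /\ rcint (ract g P f) phi = rcint (P (f \o lin g)) (fun x => phi (lin g x)).
Proof.
move=> ug [_ [p2 _]] cf tp.
have [h1 h2] := rrad_push (@lin_continuous g) (@lin_continuous (invmx g)) (linK ug) (linVK ug)
  (p2 _ (convexf_lin g cf)).
by split=> //; exact: h2.
Qed.

Lemma testfun_lin g phi : g \in unitmx -> testfun phi -> testfun (fun x => phi (lin g x)).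
Proof.
move=> ug; exact: (testfun_comp (@lin_continuous g) (@lin_continuous (invmx g)) (linK ug)).
Qed.

Lemma rMAVal_act g P : g \in unitmx -> rMAVal k P -> rMAVal k (ract g P).
Proof.
move=> ug rP; have rc f phi := @ract_rcint g P f phi ug rP.
have [p1 [p2 [p3 [p4 [p5 [p6 [p7 p8]]]]]]] := rP.
have IM (B : set V) : lin (invmx g) @` B = lin g @^-1` B by rewrite (image_inv B (linK ug) (linVK ug)).
do ?split.
- move=> f nf; apply/funext => B; rewrite /ract p1// => cfg; apply: nf.
  rewrite (_ : f = (f \o lin g) \o lin (invmx g)); first exact: convexf_lin.
  by apply/funext => x; rewrite /= linVK.
- by move=> f cf; have [] := rc f _ cf (@testfun_bump R n).
- move=> f_ f cf_ cf lu phi tp; have [_ ->] := rc f phi cf tp.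
  under eq_fun do rewrite (rc _ _ (cf_ _) tp).2.
  apply: p3 => //; [by move=> j; exact: convexf_lin|exact: convexf_lin|exact: lu_lin|exact: testfun_lin].
- move=> f h cf ch cb B; apply: (p4 (f \o lin g) (h \o lin g)); [exact: convexf_lin|exact: convexf_lin|].
  exact: (convexf_lin g cb).
- move=> f y c cf; apply/funext => B; rewrite /ract -(p5 _ (lin g^T y) c (convexf_lin g cf)).
  by congr (P _ _); apply/funext => x; rewrite /= dotp_lin.
- move=> f h U oU cf ch e B bB; rewrite /ract IM preimage_setI -!IM.
  rewrite (p6 (f \o lin g) (h \o lin g) (lin (invmx g) @` U)) //; [|exact: convexf_lin|exact: convexf_lin| |exact: bborel_lin].
    by rewrite IM; apply: open_comp => // x _; exact: lin_continuous.
  by move=> x; rewrite IM => /e.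
- move=> f x cf B bB; rewrite /ract.
  have := p7 (f \o lin g) (lin (invmx g) x) (convexf_lin g cf) _ (bborel_lin ug bB).
  have -> : (fun z => (f \o lin g) (z + lin (invmx g) x)) = (fun z => f (z + x)) \o lin g.
    by apply/funext => z; rewrite /= linD linVK.
  move=> ->; congr (P _ _); apply/seteqP; split=> y.
    by move=> [_ [b Bb <-] <-]; exists (b + x); [exists b|rewrite linD].
  by move=> [_ [b Bb <-] <-]; exists (lin (invmx g) b); [exists b|rewrite linD].
- move=> f t cf t0; apply/funext => B.
  exact: (congr1 (fun F => F (lin (invmx g) @` B)) (p8 _ t (convexf_lin g cf) t0)).
Qed.

Lemma MAVal_act g (P : MAV R n) : g \in unitmx -> MAVal k P -> MAVal k (act g P).
Proof.
move=> ug /MAVal_re_im[p q]; apply/MAVal_re_im; split; [exact: (rMAVal_act ug p)|exact: (rMAVal_act ug q)].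
Qed.

Lemma act1 (P : MAV R n) : act 1%:M P = P.
Proof.
have l1 (x : V) : lin 1%:M x = x by rewrite /lin trmx1 mulmx1.
apply/funext => f; apply/funext => B; rewrite /act invmx1; congr (P _ _).
  by apply/funext => x; rewrite /= l1.
by apply/seteqP; split=> [x [y By <-]|x Bx]; [rewrite l1|exists x; rewrite ?l1].
Qed.

Lemma lin_mul g (h : 'M[R]_n) (x : V) : lin (g *m h) x = lin g (lin h x).
Proof. by rewrite /lin trmx_mul mulmxA. Qed.

Lemma invmx_mul g (h : 'M[R]_n) : g \in unitmx -> h \in unitmx -> invmx (g *m h) = invmx h *m invmx g.
Proof.
move=> ug uh; have ugh : g *m h \in unitmx by rewrite unitmx_mul ug.
rewrite -[RHS]mulmx1 -(mulmxV ugh) !mulmxA -(mulmxA _ (invmx g) g) mulVmx// mulmx1 mulVmx// mul1mx //.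
Qed.

Lemma act_mul g (h : 'M[R]_n) (P : MAV R n) : g \in unitmx -> h \in unitmx -> act (g *m h) P = act g (act h P).
Proof.
move=> ug uh; apply/funext => f; apply/funext => B; rewrite /act invmx_mul//; congr (P _ _).
  by apply/funext => x; rewrite /= lin_mul.
apply/seteqP; split=> [_ [x Bx <-]|_ [_ [x Bx <-] <-]].
  by exists (lin (invmx g) x); [exists x|rewrite lin_mul].
by exists x; rewrite ?lin_mul.
Qed.

Lemma MAVal_lincomb (c : C) (P Q : MAV R n) : MAVal k P -> MAVal k Q ->
  MAVal k (MAVadd P (MAVscale c Q)).
Proof.
move=> /MAVal_re_im[pr pi] /MAVal_re_im[qr qi]; apply/MAVal_re_im; case: c => a b; split.
  have := rMAVal_lincomb 1 1 pr (rMAVal_lincomb a (- b) qr qi).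
  congr rMAVal; apply/funext => f; apply/funext => B; rewrite /MAVadd /MAVscale.
  by case: (P f B) => x y; case: (Q f B) => u v /=; ring.
have := rMAVal_lincomb 1 1 pi (rMAVal_lincomb b a qr qi).
congr rMAVal; apply/funext => f; apply/funext => B; rewrite /MAVadd /MAVscale.
by case: (P f B) => x y; case: (Q f B) => u v /=; ring.
Qed.

(** The form Q of [P], up to the positive factor given by the integral of [bump]. *)
Definition qr (P : (V -> R) -> set V -> R) (M : 'M[R]_(k, n)) : R := rcint (P (qm M)) (@bump R n).

Definition qv (P : MAV R n) (M : 'M[R]_(k, n)) : C :=
  Complex (qr (fun f B => complex.Re (P f B)) M) (qr (fun f B => complex.Im (P f B)) M).

Lemma Qax_qr P : rMAVal k P -> Qax (qr P).
Proof. by move=> rP; exact: (Qax_J (lfun_of_rMAVal rP)). Qed.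

Lemma qr_inj P : (k <= n)%N -> rMAVal k P -> (forall M, qr P M = 0) -> P = fun _ _ => 0.
Proof.
move=> kn rP q0; have lJ := lfun_of_rMAVal rP; have [p1 [p2 _]] := rP.
apply/funext => f; have [cf|nf] := pselect (convexf f); last by rewrite p1.
have J0 (M : 'M[R]_(k, n)) phi : testfun phi -> rcint (P (qm M)) phi = 0.
  by move=> tp; have e := q0 M; rewrite /qr in e; rewrite (J_qm lJ M tp) e !mul0r.
have Z := rrad_lincomb 0 0 (p2 f cf) (p2 f cf).
rewrite (rcint_inj hn (p2 f cf) Z.1); first by apply/funext => B; rewrite !mul0r addr0.
move=> phi tp; rewrite Z.2// !mul0r addr0.
exact: (lf_vanish lJ kn J0 cf tp).
Qed.

Lemma qr_lincomb a b P Q M : rMAVal k P -> rMAVal k Q ->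
  qr (fun f B => a * P f B + b * Q f B) M = a * qr P M + b * qr Q M.
Proof.
move=> [_ [p2 _]] [_ [q2 _]]; have cq := convexf_qm M.
exact: (rrad_lincomb a b (p2 _ cq) (q2 _ cq)).2 (@testfun_bump R n).
Qed.

Lemma qv_lincomb (c : C) (P Q : MAV R n) M : MAVal k P -> MAVal k Q ->
  qv (MAVadd P (MAVscale c Q)) M = qv P M + c * qv Q M.
Proof.
move=> /MAVal_re_im[pr pi] /MAVal_re_im[qr' qi]; case: c => a b.
have E1 : (fun f B => complex.Re (MAVadd P (MAVscale (Complex a b) Q) f B)) =
   (fun f B => 1 * complex.Re (P f B) + 1 * (a * complex.Re (Q f B) + (- b) * complex.Im (Q f B))).
  apply/funext => f; apply/funext => B; rewrite /MAVadd /MAVscale.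
  by case: (P f B) => x y; case: (Q f B) => u v /=; ring.
have E2 : (fun f B => complex.Im (MAVadd P (MAVscale (Complex a b) Q) f B)) =
   (fun f B => 1 * complex.Im (P f B) + 1 * (b * complex.Re (Q f B) + a * complex.Im (Q f B))).
  apply/funext => f; apply/funext => B; rewrite /MAVadd /MAVscale.
  by case: (P f B) => x y; case: (Q f B) => u v /=; ring.
rewrite /qv E1 E2 (qr_lincomb 1 1 M pr (rMAVal_lincomb a (- b) qr' qi)).
rewrite (qr_lincomb 1 1 M pi (rMAVal_lincomb b a qr' qi)) !(qr_lincomb _ _ M qr' qi).
by apply/complexP; split => /=; ring.
Qed.

Lemma qv_inj (P Q : MAV R n) : (k <= n)%N -> MAVal k P -> MAVal k Q -> (forall M, qv P M = qv Q M) -> P = Q.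
Proof.
move=> kn mP mQ e; have mD := MAVal_lincomb (-1) mP mQ.
have /MAVal_re_im[dr di] := mD.
have z M : qv (MAVadd P (MAVscale (-1) Q)) M = 0 by rewrite qv_lincomb// e mulN1r subrr.
have zr := qr_inj kn dr (fun M => congr1 (@complex.Re R) (z M)).
have zi := qr_inj kn di (fun M => congr1 (@complex.Im R) (z M)).
apply/funext => f; apply/funext => B; apply/eqP; rewrite -subr_eq0; apply/eqP/complexP; split.
  by have := congr1 (fun F => F f B) zr; rewrite /MAVadd /MAVscale mulN1r.
by have := congr1 (fun F => F f B) zi; rewrite /MAVadd /MAVscale mulN1r.
Qed.

(** The Jacobian factor of the substitution by [g], kept as a ratio of integrals. *)
Definition kap g : R := int_real (leb R n) (fun y => bump (lin g (- y))) / int_real (leb R n) (@bump R n).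

Lemma kap_gt0 g : g \in unitmx -> 0 < kap g.
Proof.
move=> ug; rewrite divr_gt0 ?bump_int_gt0//; apply: (@leb_bump_comp _ _ (fun y : V => lin g (- y))).
- by rewrite oppr0 /lin mul0mx.
- rewrite (_ : (fun y : V => lin g (- y)) = fun y => - lin g y).
    by apply: cont_oppV; exact: lin_continuous.
  by apply/funext => y; rewrite /lin mulNmx.
- exact: (testfunN (testfun_lin ug (@testfun_bump R n))).
Qed.

Lemma qm_lin g (M : 'M[R]_(k, n)) : qm M \o lin g = qm (M *m g).
Proof.
apply/funext => x; apply: eq_bigr => i _; rewrite /sq dotp_lin row_mul.
by rewrite /lin trmxK.
Qed.

Lemma qr_act g P M : g \in unitmx -> rMAVal k P -> qr (ract g P) M = kap g * qr P (M *m g).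
Proof.
move=> ug rP; have cq := convexf_qm M; have tb := @testfun_bump R n.
rewrite /qr (ract_rcint ug rP cq tb).2 qm_lin.
rewrite (J_qm (lfun_of_rMAVal rP) (M *m g) (testfun_lin ug tb)) /kap; ring.
Qed.

Lemma qv_act g (P : MAV R n) M : g \in unitmx -> MAVal k P ->
  qv (act g P) M = ((kap g)%:C)%C * qv P (M *m g).
Proof.
move=> ug /MAVal_re_im[pr pi].
by apply/complexP; split=> /=; rewrite ?mul0r ?subr0 ?addr0; exact: qr_act.
Qed.

End LinearAction.

(** * Finite dimension *)

Section FiniteDimension.
Variables (R : realType) (n k : nat).
Hypothesis hn : (0 < n)%N.
Hypothesis kn : (k <= n)%N.
Local Notation V := 'rV[R]_n.
Local Notation C := (complex R).

(** By polarization a quadratic form is determined by its values at the vectors [e_a] and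
    [e_a + e_b]. *)
Definition node (t : 'I_n * 'I_n * bool) : V :=
  if t.2 then delta_mx ord0 t.1.1 + delta_mx ord0 t.1.2 else delta_mx ord0 t.1.1.

Definition nodes (s : {ffun 'I_k -> 'I_n * 'I_n * bool}) : 'M[R]_(k, n) :=
  \matrix_(i, j) node (s i) ord0 j.

Lemma quad_nodes (G : V -> R) (b : 'I_n -> 'I_n -> R) :
  (forall v, G v = \sum_a \sum_c v ord0 a * v ord0 c * b a c) ->
  (forall t, G (node t) = 0) -> forall v, G v = 0.
Proof.
move=> /quad_polar hG G0 v; rewrite hG big1// => a _; rewrite big1// => c _.
have := G0 (a, c, true); have := G0 (a, c, false); have := G0 (c, a, false).
by rewrite /node /polar /= => -> -> ->; rewrite !subr0 !mulr0.
Qed.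

(** Rows are freed one at a time: a form vanishing at all nodes in row [m] vanishes for every choice
    of that row. *)
Lemma Qax_nodes (Q : 'M[R]_(k, n) -> R) : Qax Q -> (forall s, Q (nodes s) = 0) -> forall M, Q M = 0.
Proof.
move=> qx Q0 M; rewrite -(mixrow_max M 0).
suff H m : (m <= k)%N -> forall s, Q (mixrow M (nodes s) m) = 0.
  have [s _] : exists s : {ffun 'I_k -> 'I_n * 'I_n * bool}, true.
    by exists [ffun=> (Ordinal hn, Ordinal hn, true)].
  by have := H k (leqnn k) s; rewrite !mixrow_max.
elim: m => [|m IH] mk s; first by rewrite mixrow0.
pose t : 'I_k := Ordinal mk.
have [b hb] := qa_quad qx (mixrow M (nodes s) m) t.
rewrite (mixrowS M (nodes s) t).
apply: (quad_nodes (G := fun v => Q (setrow (mixrow M (nodes s) m) t v)) hb) => u.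
pose s' : {ffun 'I_k -> 'I_n * 'I_n * bool} := [ffun i => if i == t then u else s i].
rewrite -(IH (ltnW mk) s'); congr Q; apply/matrixP => i j; rewrite !mxE.
case: eqP => [->|/eqP it]; first by rewrite /= ltnn ffunE eqxx.
by rewrite ffunE (negbTE it).
Qed.

Lemma qv_nodes (P : MAV R n) : MAVal k P -> (forall s, qv P (nodes s) = 0) -> forall M : 'M[R]_(k, n), qv P M = 0.
Proof.
move=> /MAVal_re_im[pr pi] z M; apply/complexP; split=> /=.
  by apply: (Qax_nodes (Qax_qr pr)) => s; have := congr1 (@complex.Re R) (z s).
by apply: (Qax_nodes (Qax_qr pi)) => s; have := congr1 (@complex.Im R) (z s).
Qed.

(** An independent family in [S] of maximal length, which is at most [N]: adjoining any further [v]
    of [S] destroys independence. *)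
Lemma max_row_free (F : fieldType) (N : nat) (S : 'rV[F]_N -> Prop) :
  exists (m : nat) (A : 'M[F]_(m, N)), (forall i, S (row i A)) /\ forall v, S v -> (v <= A)%MS.
Proof.
pose Pm (m : nat) := `[< exists A : 'M[F]_(m, N), row_free A /\ forall i, S (row i A) >].
have ex0 : exists m, Pm m.
  exists 0%N; apply/asboolP; exists 0; split; last by case.
  by rewrite /row_free mxrank0.
have ub m : Pm m -> (m <= N)%N.
  by move=> /asboolP[A [/eqP rA _]]; rewrite -[X in (X <= _)%N]rA rank_leq_col.
have [m /asboolP[A [fA SA]] mmax] := ex_maxnP ex0 ub.
exists m, A; split => // v Sv; apply: contrapT => /negP nv.
suff : (m.+1 <= m)%N by rewrite ltnn.
apply: mmax; apply/asboolP; rewrite -addn1; exists (col_mx A v); split; last first.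
  by move=> i; case: (split_ordP i) => j ->; rewrite ?rowKu ?rowKd ?row_id.
rewrite /row_free eqn_leq rank_leq_row /= -addsmxE addn1 -[X in (X < _)%N](eqP fA).
have : (A < A + v)%MS.
  rewrite ltmxE addsmxSl /=; apply: contra nv; rewrite addsmx_sub; by move=> /andP[].
by rewrite ltmxErank => /andP[].
Qed.

Lemma sum_complex (I : Type) (r : seq I) (c : I -> R) (z : I -> C) :
  \sum_(i <- r) ((c i)%:C)%C * z i =
  Complex (\sum_(i <- r) c i * complex.Re (z i)) (\sum_(i <- r) c i * complex.Im (z i)).
Proof.
elim: r => [|i r IH]; first by rewrite !big_nil.
rewrite !big_cons IH; case: (z i) => a b; apply/complexP; split=> /=; ring.
Qed.

Lemma MAVal_real (P : (V -> R) -> set V -> R) : rMAVal k P -> MAVal k (fun f B => Complex (P f B) 0).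
Proof.
move=> rP; apply/MAVal_re_im; split=> //=.
have := rMAVal_lincomb 0 0 rP rP; congr rMAVal.
by apply/funext => f; apply/funext => B; rewrite !mul0r addr0.
Qed.

Lemma MAVal_zero : MAVal k (@MAVzero R n).
Proof.
have rP := maP_rMAVal R hn kn; have := MAVal_real (rMAVal_lincomb 0 0 rP rP).
by congr MAVal; apply/funext => f; apply/funext => B; rewrite !mul0r addr0.
Qed.

Lemma qv_zero (M : 'M[R]_(k, n)) : qv (@MAVzero R n) M = 0.
Proof.
have := qv_lincomb (-1) M MAVal_zero MAVal_zero.
rewrite mulN1r subrr => <-; congr (qv _ M); apply/funext => f; apply/funext => B.
by rewrite /MAVadd /MAVscale /MAVzero mulr0 addr0.
Qed.

Lemma MAVal_sum m (c : 'I_m -> C) (E : 'I_m -> MAV R n) : (forall i, MAVal k (E i)) ->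
  MAVal k (fun f B => \sum_(i < m) c i * E i f B) /\
  forall M, qv (fun f B => \sum_(i < m) c i * E i f B) M = \sum_(i < m) c i * qv (k := k) (E i) M.
Proof.
elim: m c E => [|m IH] c E mE.
  have -> : (fun f B => \sum_(i < 0) c i * E i f B) = @MAVzero R n.
    by apply/funext => f; apply/funext => B; rewrite big_ord0.
  by split=> [|M]; [exact: MAVal_zero|rewrite big_ord0 qv_zero].
have [mS qS] := IH (fun i => c (widen_ord (leqnSn m) i)) (fun i => E (widen_ord (leqnSn m) i))
  (fun i => mE (widen_ord (leqnSn m) i)).
have -> : (fun f B => \sum_(i < m.+1) c i * E i f B) =
    MAVadd (fun f B => \sum_(i < m) c (widen_ord (leqnSn m) i) * E (widen_ord (leqnSn m) i) f B)
      (MAVscale (c ord_max) (E ord_max)).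
  by apply/funext => f; apply/funext => B; rewrite big_ord_recr.
split; first exact: MAVal_lincomb.
by move=> M; rewrite qv_lincomb// qS big_ord_recr.
Qed.

(** Evaluation at the nodes is linear and injective; preimages of a maximal independent family of
    values span. *)
Lemma MAVal_finite_dim : exists (m : nat) (E : 'I_m -> MAV R n), (forall i, MAVal k (E i)) /\
  forall Psi : MAV R n, MAVal k Psi ->
    exists c : 'I_m -> C, Psi = (fun f B => \sum_(i < m) c i * E i f B).
Proof.
pose T := {ffun 'I_k -> 'I_n * 'I_n * bool}.
pose ev (P : MAV R n) : 'rV[C]_#|{: T}| := \row_t qv P (nodes (enum_val t) : 'M[R]_(k, n)).
have [m [A [SA spanA]]] := max_row_free (fun v => exists2 P, MAVal k P & ev P = v).
have /choice[E hE] : forall i, exists P, MAVal k P /\ ev P = row i A.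
  by move=> i; have [P mP eP] := SA i; exists P.
exists m, E; split=> [i|Psi mPsi]; first by case: (hE i).
have /submxP[D hD] := spanA (ev Psi) (ex_intro2 _ _ Psi mPsi erefl).
exists (D ord0); have mE i : MAVal k (E i) by case: (hE i).
have [mS qS] := MAVal_sum (D ord0) mE.
have mD := MAVal_lincomb (-1) mPsi mS.
suff z M : qv (MAVadd Psi (MAVscale (-1) (fun f B => \sum_(i < m) D ord0 i * E i f B))) (M : 'M[R]_(k, n)) = 0.
  apply: (qv_inj hn kn mPsi mS) => M; have := z M.
  by rewrite (qv_lincomb)// mulN1r => /eqP; rewrite subr_eq0 => /eqP.
move: M; apply: qv_nodes => // s; rewrite (qv_lincomb)// qS mulN1r.
apply/eqP; rewrite subr_eq0; apply/eqP.
have := congr1 (fun v : 'rV_#|{: T}| => v ord0 (enum_rank s)) hD; rewrite !mxE enum_rankK => ->.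
apply: eq_bigr => i _; congr (_ * _); have [_ e] := hE i.
by have := congr1 (fun v : 'rV_#|{: T}| => v ord0 (enum_rank s)) e; rewrite !mxE enum_rankK.
Qed.

End FiniteDimension.

(** * Irreducibility *)

Section Irreducibility.
Variables (R : realType) (n k : nat).
Hypothesis hn : (0 < n)%N.
Hypothesis kn : (k <= n)%N.
Local Notation V := 'rV[R]_n.
Local Notation C := (complex R).

Variable W : set (MAV R n).
Hypothesis WM : W `<=` MAVal k.
Hypothesis W0 : W (@MAVzero R n).
Hypothesis WD : forall P Q, W P -> W Q -> W (MAVadd P Q).
Hypothesis WZ : forall c P, W P -> W (MAVscale c P).
Hypothesis WA : forall g : 'M[R]_n, g \in unitmx -> forall P, W P -> W (act g P).

(** Quadratic parts of elements of [W]; as [qv] is injective, membership in [W] can be decided on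
    them. *)
Definition inW (F : 'M[R]_(k, n) -> C) : Prop := exists2 P, W P & forall M, qv P M = F M.

Lemma inW_lincomb c F G : inW F -> inW G -> inW (fun M => F M + c * G M).
Proof.
move=> [P wP eP] [Q wQ eQ]; exists (MAVadd P (MAVscale c Q)); first by apply: WD => //; exact: WZ.
by move=> M; rewrite (qv_lincomb) ?eP ?eQ//; exact: WM.
Qed.

Lemma inW0 : inW (fun _ => 0).
Proof.
by exists (@MAVzero R n) => // M; rewrite qv_zero.
Qed.

Lemma inW_ext F G : (forall M, F M = G M) -> inW F -> inW G.
Proof. by move=> /funext ->. Qed.

Lemma inW_sum (I : Type) (r : seq I) (c : I -> C) (F : I -> 'M[R]_(k, n) -> C) :
  (forall i, inW (F i)) -> inW (fun M => \sum_(i <- r) c i * F i M).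
Proof.
move=> hF; elim: r => [|i r IH]; first by apply: inW_ext inW0 => M; rewrite big_nil.
by apply: inW_ext (inW_lincomb (c i) IH (hF i)) => M; rewrite big_cons addrC.
Qed.

Lemma inW_act F g : g \in unitmx -> inW F -> inW (fun M => F (M *m g)).
Proof.
move=> ug [P wP eP]; have k0 := kap_gt0 ug.
apply: (inW_ext _ (inW_lincomb ((kap g)^-1%:C)%C inW0 (ex_intro2 _ _ (act g P) (WA ug wP) (fun M => erefl)))) => M.
rewrite add0r qv_act//; last exact: WM.
by rewrite mulrA -rmorphM mulVf ?gt_eqF// rmorph1 mul1r eP.
Qed.

Lemma inW_irreducible P : W P -> P <> @MAVzero R n -> forall Q, MAVal k Q -> W Q.
Proof.
move=> wP Pn0 Q mQ; have mP := WM wP; have [pr pi] := (MAVal_re_im k P).1 mP.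
have qxr := Qax_qr pr; have qxi := Qax_qr pi.
have [M0 qM0] : exists M0 : 'M[R]_(k, n), qv P M0 <> 0.
  apply: contrapT => /forallNP h; apply: Pn0; apply: (qv_inj hn kn mP (WM W0)) => M.
  by rewrite qv_zero//; apply: contrapT => /h.
(* Base point of the orbit: every matrix of full row rank is [E *m g] with [g] invertible. *)
pose E : 'M[R]_(k, n) := pid_mx k.
have EEt : E *m E^T = 1%:M by rewrite tr_pid_mx pid_mx_id// pid_mx_1.
have fM0 : row_free M0.
  apply: contrapT => /negP nf; apply: qM0; apply/complexP; split; [exact: (Q_not_free qxr)|exact: (Q_not_free qxi)].
have orbit (N : 'M[R]_(k, n)) : row_free N -> exists2 g, g \in unitmx & N = E *m g.
  move=> fN; have [|g ug e] := @complete_unitmx _ k n E (E^T *m N).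
    by rewrite mulmxA EEt mul1mx (eqP fN) /E rank_pid_mx.
  by exists g => //; rewrite -e mulmxA EEt mul1mx.
have [g0 ug0 M0E] := orbit M0 fM0.
pose F (M : 'M[R]_(k, n)) := qv P (M *m g0).
have WF : inW F by apply: inW_act => //; exists P.
(* [Pi + s Pi'] is invertible for [s <> 0] and becomes the projection [Pi] at [s = 0]. *)
pose Pi : 'M[R]_n := pid_mx k; pose Pi' := 1%:M - Pi.
have PiE : Pi = E^T *m E by rewrite tr_pid_mx pid_mx_id.
have PiPi : Pi *m Pi = Pi by rewrite {1 2}PiE -mulmxA (mulmxA E) EEt mul1mx -PiE.
have PiPi' : Pi *m Pi' = 0 by rewrite mulmxBr mulmx1 PiPi subrr.
have Pi'Pi : Pi' *m Pi = 0 by rewrite mulmxBl mul1mx PiPi subrr.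
have Pi'Pi' : Pi' *m Pi' = Pi' by rewrite {1}/Pi' mulmxBl mul1mx PiPi' subr0.
have ug (s : R) : s != 0 -> Pi + s *: Pi' \in unitmx.
  move=> s0; have : (Pi + s *: Pi') *m (Pi + s^-1 *: Pi') = 1%:M.
    rewrite mulmxDl !mulmxDr -!scalemxAl -!scalemxAr PiPi PiPi' Pi'Pi Pi'Pi' !scaler0 addr0 add0r.
    by rewrite scalerA mulfV// scale1r /Pi' addrC subrK.
  by move=> /mulmx1_unit[].
(* The degree is at most [2 k], so [2 k + 1] nonzero values of [s] recover the value at [s = 0] by a
   combination that stays in [W]. *)
have [c hc] := @interpolate0 R (k.*2).+1.
have lim (q : 'M[R]_(k, n) -> R) M : Qax q ->
    q (M *m Pi *m g0) = \sum_(i < (k.*2).+1) c i * q (M *m (Pi + i.+1%:R *: Pi') *m g0).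
  move=> qx; have [p sp hp] := Q_poly (M *m Pi *m g0) (M *m Pi' *m g0) qx.
  have E1 s : p.[s] = q (M *m (Pi + s *: Pi') *m g0).
    have gen (A B : 'M[R]_n) : M *m (A + s *: B) *m g0 = M *m A *m g0 + s *: (M *m B *m g0).
      by rewrite mulmxDr mulmxDl -scalemxAr -scalemxAl.
    by rewrite hp gen.
  rewrite (_ : q (M *m Pi *m g0) = p.[0]); last by rewrite E1 scale0r addr0.
  by rewrite hc//; apply: eq_bigr => i _; rewrite E1.
have WFPi : inW (fun M => F (M *m Pi)).
  apply: inW_ext (inW_sum (index_enum 'I_(k.*2).+1) (fun i => ((c i)%:C)%C)
    (F := fun i M => F (M *m (Pi + i.+1%:R *: Pi'))) _); last first.
    by move=> i; apply: inW_act => //; apply: ug; rewrite pnatr_eq0.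
  by move=> M; rewrite sum_complex /F [RHS]/qv (lim _ M qxr) (lim _ M qxi).
pose D (N M : 'M[R]_(k, n)) : C := ((Dk N M)%:C)%C.
(* [M *m Pi] is [(M *m E^T) *m E], so [Q_det] gives [det (M E^T) ^ 2] times the nonzero constant
   [F E]. *)
have WDE : inW (D E).
  have FE : F E <> 0 by rewrite /F -M0E.
  apply: inW_ext (inW_lincomb (F E)^-1 inW0 WFPi) => M; rewrite add0r /D /Dk.
  have -> : F (M *m Pi) = ((\det (M *m E^T) ^+ 2)%:C)%C * F E.
    rewrite /F PiE mulmxA -mulmxA -M0E /qv (Q_det _ _ qxr) (Q_det _ _ qxi).
    by apply/complexP; split => /=; ring.
  by rewrite mulrC -mulrA mulfV ?mulr1//; apply/eqP.
(* Other matrices of full rank are reached through the transpose of [g]; for dependent rows [Dk N]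
   is zero. *)
have WDN N : inW (D N).
  have [fN|nfN] := boolP (row_free N).
    have [g ugN ->] := orbit N fN.
    apply: inW_ext (inW_act (g := g^T) _ WDE) => [M|]; last by rewrite unitmx_tr.
    by rewrite /D /Dk trmx_mul mulmxA.
  apply: inW_ext inW0 => M; rewrite /D /Dk.
  suff -> : \det (M *m N^T) = 0 by rewrite expr0n.
  apply/eqP; apply: contraNT nfN => d0; rewrite /row_free eqn_leq rank_leq_row /=.
  have : \rank (M *m N^T) = k by apply: mxrank_unit; rewrite unitmxE unitfE.
  by move=> {1}<-; rewrite -[\rank N]mxrank_tr mxrankM_maxr.
have [qr' qi'] := (MAVal_re_im k Q).1 mQ.
have [Lr hLr] := Q_reproducing (Qax_qr qr'); have [Li hLi] := Q_reproducing (Qax_qr qi').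
have [P' wP' eP'] : inW (qv Q).
  apply: inW_ext (inW_lincomb (Complex 0 1)
    (inW_sum Lr (fun z => (z.1%:C)%C) (F := fun z => D z.2) (fun z => WDN z.2))
    (inW_sum Li (fun z => (z.1%:C)%C) (F := fun z => D z.2) (fun z => WDN z.2))) => M.
  rewrite !sum_complex /qv hLr hLi; apply/complexP; split => /=.
    rewrite mul0r mul1r sub0r [X in _ - X]big1 ?subr0// => z _; exact: mulr0.
  rewrite mul0r mul1r add0r [X in X + _]big1 ?add0r// => z _; exact: mulr0.
by rewrite (qv_inj hn kn mQ (WM wP')) // => M; rewrite eP'.
Qed.

End Irreducibility.


Unset Implicit Arguments. Set Strict Implicit.

Theorem theorem1p4 (R : realType) (n k : nat) (hn : (0 < n)%N) (hk : (k <= n)%N) :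
  (* the action is a linear representation of GL(n,R) on MAVal_k(R^n) *)
  (forall g : 'M[R]_n, g \in unitmx ->
     forall Psi : MAV R n, MAVal k Psi -> MAVal k (act g Psi)) /\
  (forall Psi : MAV R n, MAVal k Psi -> act 1%:M Psi = Psi) /\
  (forall g h : 'M[R]_n, g \in unitmx -> h \in unitmx ->
     forall Psi : MAV R n, MAVal k Psi -> act (g *m h) Psi = act g (act h Psi)) /\
  (forall g : 'M[R]_n, g \in unitmx -> forall (c : complex R) (P Q : MAV R n),
     act g (MAVadd P (MAVscale c Q)) = MAVadd (act g P) (MAVscale c (act g Q))) /\
  (* finite dimensional (over C) *)
  (exists (m : nat) (E : 'I_m -> MAV R n), (forall i, MAVal k (E i)) /\
     forall Psi : MAV R n, MAVal k Psi ->
       exists c : 'I_m -> complex R, Psi = (fun f B => \sum_(i < m) c i * E i f B)) /\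
  (* irreducible: nonzero, and no nontrivial proper invariant C-subspace *)
  (exists Psi : MAV R n, MAVal k Psi /\ Psi <> @MAVzero R n) /\
  (forall W : set (MAV R n), W `<=` MAVal k -> W (@MAVzero R n) ->
     (forall P Q, W P -> W Q -> W (MAVadd P Q)) ->
     (forall c P, W P -> W (MAVscale c P)) ->
     (forall g : 'M[R]_n, g \in unitmx -> forall P, W P -> W (act g P)) ->
     W = [set @MAVzero R n] \/ W = MAVal k).
Proof.
have [[f0 [B0 nz]] rP] := (maP_nonzero R n k, maP_rMAVal R hn hk).
split; first by move=> g ug Psi; exact: MAVal_act.
split; first by move=> Psi _; exact: act1.
split; first by move=> g h ug uh Psi _; exact: act_mul.
split; first by [].
split; first exact: MAVal_finite_dim.
split.
  exists (fun f B => Complex (maP k f B) 0); split; first exact: MAVal_real.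
  by move=> /(congr1 (fun F => complex.Re (F f0 B0)))/eqP; apply/negP.
move=> W WM W0 WD WZ WA.
have [[P WP P0]|none] := pselect (exists2 P, W P & P <> @MAVzero R n).
  by right; apply/seteqP; split=> // Q; exact: (inW_irreducible hn hk WM W0 WD WZ WA WP P0).
left; apply/seteqP; split=> [P WP|P ->] //=.
by apply: contrapT => P0; apply: none; exists P.
Qed.
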